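(* Let $\mathbb K\in\{\mathbb R,\mathbb C\}$ and let $\theta\subset\Delta=\{\alpha_1,\dots,\alpha_{d-1}\}$ be symmetric. Suppose $\Gamma\subset\mathsf{PSL}(d,\mathbb K)$ is a non-elementary $\mathsf P_\theta$-Anosov subgroup and $G$ is an infinite index quasiconvex subgroup of $\Gamma$. If $\phi\in\mathfrak a_\theta^*$ and $\delta^\phi(\Gamma)<+\infty$, then $\delta^\phi(\Gamma)>\delta^\phi(G)$.
   Context: $\mathfrak a=\{\mathrm{diag}(a_1,\dots,a_d): a_i\in\mathbb R,\ \sum a_i=0\}$. The Cartan projection of $g\in\mathsf{PSL}(d,\mathbb K)$ is $\kappa(g)=\mathrm{diag}(\log\sigma_1(g),\dots,\log\sigma_d(g))$, where $\sigma_1(g)\ge\dots\ge\sigma_d(g)$ are the singular values of a lift of $g$ to $\mathsf{SL}(d,\mathbb K)$. The simple roots are $\alpha_j(\mathrm{diag}(a_1,\dots,a_d))=a_j-a_{j+1}$, $\Delta=\{\alpha_1,\dots,\alpha_{d-1}\}$, with fundamental weights $\omega_{\alpha_j}(\mathrm{diag}(a_1,\dots,a_d))=a_1+\dots+a_j$. A subset $\theta\subset\Delta$ is symmetric if $\alpha_k\in\theta\iff\alpha_{d-k}\in\theta$. Set $\mathfrak a_\theta=\{\mathrm{diag}(a_1,\dots,a_d)\in\mathfrak a: a_j=a_{j+1}\text{ for all }\alpha_j\notin\theta\}$; the restrictions $\omega_\alpha|_{\mathfrak a_\theta}$, $\alpha\in\theta$, form a basis of $\mathfrak a_\theta^*$.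 The partial Cartan projection $\kappa_\theta:\mathsf{PSL}(d,\mathbb K)\to\mathfrak a_\theta$ is defined by $\omega_\alpha(\kappa_\theta(g))=\omega_\alpha(\kappa(g))$ for all $\alpha\in\theta$. $\mathcal F_\theta$ is the manifold of partial flags $F=(F^j)_{\alpha_j\in\theta}$ in $\mathbb K^d$ with $\dim F^j=j$ (nested). Flags $F,G\in\mathcal F_\theta$ are transverse if $F^j\oplus G^{d-j}=\mathbb K^d$ for all $\alpha_j\in\theta$. A subgroup $\Gamma$ is $\mathsf P_\theta$-divergent if $\min_{\alpha\in\theta}\alpha(\kappa(\gamma_n))\to+\infty$ for every sequence $\{\gamma_n\}$ of distinct elements of $\Gamma$. If $\alpha(\kappa(g))>0$ for all $\alpha\in\theta$, then $U_\theta(g)\in\mathcal F_\theta$ is the flag whose $j$-dimensional part is $k\langle e_1,\dots,e_j\rangle$, where $g=k\,e^{\kappa(g)}\,\ell$ is a singular value decomposition. For $\Gamma$ $\mathsf P_\theta$-divergent, the limit set $\Lambda_\theta(\Gamma)\subset\mathcal F_\theta$ is the set of limits of convergent sequences $U_\theta(\gamma_n)$ with $\gamma_n\in\Gamma$ distinct. $\Gamma$ is $\mathsf P_\theta$-transverse if it is $\mathsf P_\theta$-divergent and any two distinct flags in $\Lambda_\theta(\Gamma)$ are transverse; it is non-elementary if $\Lambda_\theta(\Gamma)$ is infinite. A $\mathsf P_\theta$-transverse subgroup $\Gamma$ is $\mathsf P_\theta$-Anosov if it is Gromov hyperbolic with Gromov boundary $\partial\Gamma$ and there is a $\Gamma$-equivariant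 homeomorphism $\xi:\partial\Gamma\to\Lambda_\theta(\Gamma)$. A subgroup $G$ of a hyperbolic group $\Gamma$ is quasiconvex if there is $K>0$ such that any geodesic in the Cayley graph of $\Gamma$ (with respect to some finite presentation) joining two points of $G$ lies within distance $K$ of the vertices associated to $G$. For a discrete subgroup $\Gamma$ and $\phi\in\mathfrak a_\theta^*$, $Q_\Gamma^\phi(s)=\sum_{\gamma\in\Gamma}e^{-s\phi(\kappa_\theta(\gamma))}$ and $\delta^\phi(\Gamma)=\inf\{s>0: Q_\Gamma^\phi(s)<+\infty\}\in[0,+\infty]$ is its critical exponent. *)

(* Defs.v *)
From HB Require Import structures.
From mathcomp Require Import all_boot all_order all_algebra.
From mathcomp Require Import all_classical all_reals all_analysis.
From mathcomp Require Import complex.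
From mathcomp Require Import lra zify.

Set Implicit Arguments.
Unset Strict Implicit.
Unset Printing Implicit Defensive.

Import Order.TTheory GRing.Theory Num.Theory.
Import numFieldNormedType.Exports.

Local Open Scope classical_set_scope.
Local Open Scope quotient_scope.
Local Open Scope ring_scope.

Inductive base_field := RealField | ComplexField.

Definition scalars (R : realType) (b : base_field) : numFieldType :=
  match b with
  | RealField => R
  | ComplexField => R[i]
  end.

Definition scalar_of_real (R : realType) (b : base_field) :
    R -> scalars R b :=
  match b with
  | RealField => fun x => x
  | ComplexField => real_complex R
  end.

Definition scalar_conj (R : realType) (b : base_field) :
    scalars R b -> scalars R b :=
  match b with
  | RealField => fun x => x
  | ComplexField => @conjc R
  end.

Section SpecialLinear.
Variables (K : fieldType) (d : nat).

Record SL := MkSL { SLmx :> 'M[K]_d; SLmxP : \det SLmx == 1 }.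

HB.instance Definition _ := [isSub for SLmx].
HB.instance Definition _ := [Choice of SL by <:].

Fact SL_one_subproof : \det (1%:M : 'M[K]_d) == 1.
Proof. by rewrite det1. Qed.

Fact SL_mul_subproof (A B : SL) : \det (A *m B) == 1.
Proof. by rewrite det_mulmx (eqP (SLmxP A)) (eqP (SLmxP B)) mulr1. Qed.

Fact SL_inv_subproof (A : SL) : \det (invmx A) == 1.
Proof. by rewrite det_inv (eqP (SLmxP A)) invr1. Qed.

Definition SL_one := MkSL SL_one_subproof.
Definition SL_mul A B := MkSL (SL_mul_subproof A B).
Definition SL_inv A := MkSL (SL_inv_subproof A).

Lemma SL_unit (A : SL) : (A : 'M[K]_d) \in unitmx.
Proof. by rewrite unitmxE (eqP (SLmxP A)) unitr1. Qed.

Fact SL_mulA : associative SL_mul.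
Proof. by move=> A B C; apply: val_inj; rewrite /= mulmxA. Qed.

Fact SL_mul1 : left_id SL_one SL_mul.
Proof. by move=> A; apply: val_inj; rewrite /= mul1mx. Qed.

Fact SL_mulr1 : right_id SL_one SL_mul.
Proof. by move=> A; apply: val_inj; rewrite /= mulmx1. Qed.

Fact SL_mulV : left_inverse SL_one SL_inv SL_mul.
Proof. by move=> A; apply: val_inj; rewrite /= mulVmx ?SL_unit. Qed.

Fact SL_mulrV : right_inverse SL_one SL_inv SL_mul.
Proof. by move=> A; apply: val_inj; rewrite /= mulmxV ?SL_unit. Qed.

HB.instance Definition _ := isGroup.Build SL
  SL_mulA SL_mul1 SL_mulr1 SL_mulV SL_mulrV.

(* The center of SL(d, K) consists of its scalar matrices, so PSL(d, K) is
   SL(d, K) modulo proportionality. *)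
Definition proportional (A B : SL) : bool :=
  `[< exists c : K, (B : 'M[K]_d) = c *: (A : 'M[K]_d) >].

Lemma proportionalP (A B : SL) :
  reflect (exists c : K, (B : 'M[K]_d) = c *: (A : 'M[K]_d)) (proportional A B).
Proof. exact: asboolP. Qed.

Fact proportional_refl : reflexive proportional.
Proof. by move=> A; apply/proportionalP; exists 1; rewrite scale1r. Qed.

Fact proportional_sub A B : proportional A B -> proportional B A.
Proof.
move=> /proportionalP[c cE]; apply/proportionalP.
have [c0|c0] := eqVneq c 0; last first.
  by exists c^-1; rewrite cE scalerA mulVf // scale1r.
exists 1; rewrite scale1r.
have B0 : (B : 'M[K]_d) = 0 by rewrite cE c0 scale0r.
have AB : (A : 'M[K]_d) = A *m invmx B *m B by rewrite mulmxKV ?SL_unit.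
by rewrite AB B0 mulmx0.
Qed.

Fact proportional_sym : symmetric proportional.
Proof. by move=> A B; apply/idP/idP; apply: proportional_sub. Qed.

Fact proportional_trans : transitive proportional.
Proof.
move=> B A C /proportionalP[c cE] /proportionalP[e eE]; apply/proportionalP.
by exists (e * c); rewrite eE cE scalerA.
Qed.

Canonical proportional_equiv :=
  EquivRel proportional proportional_refl proportional_sym proportional_trans.

Definition PSL := {eq_quot proportional_equiv}.

HB.instance Definition _ := Choice.on PSL.
HB.instance Definition _ := EqQuotient.on PSL.

Definition lift (g : PSL) : SL := repr g.

Definition PSL_one : PSL := \pi_PSL (SL_one).
Definition PSL_mul (g h : PSL) : PSL := \pi_PSL (SL_mul (lift g) (lift h)).
Definition PSL_inv (g : PSL) : PSL := \pi_PSL (SL_inv (lift g)).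

Lemma lift_pi (A : SL) :
  exists c : K, (lift (\pi_PSL A) : 'M[K]_d) = c *: (A : 'M[K]_d).
Proof.
suff /eqmodP/proportionalP : A = lift (\pi_PSL A) %[mod PSL] by [].
by rewrite reprK.
Qed.

Lemma PSL_mul_pi (A B : SL) :
  PSL_mul (\pi_PSL A) (\pi_PSL B) = \pi_PSL (SL_mul A B).
Proof.
apply/esym/eqmodP/proportionalP => /=.
have [a ->] := lift_pi A; have [b ->] := lift_pi B.
by exists (a * b); rewrite -scalemxAl -scalemxAr scalerA.
Qed.

Lemma PSL_inv_pi (A : SL) : PSL_inv (\pi_PSL A) = \pi_PSL (SL_inv A).
Proof.
apply/esym/eqmodP/proportional_sub/proportionalP => /=.
have [a aE] := lift_pi A; exists a.
have := mulmxV (SL_unit (lift (\pi_PSL A))); rewrite aE -scalemxAl => aV.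
rewrite -[RHS]mul1mx -(mulVmx (SL_unit A)) -mulmxA -scalemxAr.
by rewrite aV mulmx1.
Qed.

Lemma liftK (g : PSL) : \pi_PSL (lift g) = g.
Proof. exact: reprK. Qed.

Fact PSL_mulA : associative PSL_mul.
Proof.
move=> f g h; rewrite -(liftK f) -(liftK g) -(liftK h).
by rewrite !PSL_mul_pi SL_mulA.
Qed.

Fact PSL_mul1 : left_id PSL_one PSL_mul.
Proof. by move=> g; rewrite -(liftK g) PSL_mul_pi SL_mul1. Qed.

Fact PSL_mulr1 : right_id PSL_one PSL_mul.
Proof. by move=> g; rewrite -(liftK g) PSL_mul_pi SL_mulr1. Qed.

Fact PSL_mulV : left_inverse PSL_one PSL_inv PSL_mul.
Proof. by move=> g; rewrite -(liftK g) PSL_inv_pi PSL_mul_pi SL_mulV. Qed.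

Fact PSL_mulrV : right_inverse PSL_one PSL_inv PSL_mul.
Proof. by move=> g; rewrite -(liftK g) PSL_inv_pi PSL_mul_pi SL_mulrV. Qed.

HB.instance Definition _ := isGroup.Build PSL
  PSL_mulA PSL_mul1 PSL_mulr1 PSL_mulV PSL_mulrV.

End SpecialLinear.

Section GroupsAndWords.
Variable gT : groupType.
Implicit Types (S H G : set gT) (g h x y w : gT).

Definition is_subgroup H :=
  [/\ H 1%g, (forall x y, H x -> H y -> H (x * y)%g)
    & (forall x, H x -> H (x^-1)%g)].

Definition infinite_index H G :=
  infinite_set [set [set (x * h)%g | h in H] | x in G].

Definition is_word S (s : seq gT) :=
  forall x, x \in s -> S x \/ S (x^-1)%g.

Definition generated S : set gT :=
  [set g | exists2 s, is_word S s & (\prod_(x <- s) x)%g = g].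

Definition finite_generating_set S G := finite_set S /\ generated S = G.

Definition word_length S g : nat :=
  xget 0%N [set m | (exists s, [/\ is_word S s, size s = m
                                 & (\prod_(x <- s) x)%g = g])
                    /\ (forall s, is_word S s -> (\prod_(x <- s) x)%g = g ->
                          (m <= size s)%N)].

(* Distance between vertices of the Cayley graph with edges (x, x s). *)
Definition word_dist S x y : nat := word_length S (x^-1 * y)%g.

(* (x | y)_w *)
Definition gromov_product S w x y : rat :=
  ((word_dist S w x)%:R + (word_dist S w y)%:R - (word_dist S x y)%:R) / 2%:R.

Definition gromov_hyperbolic S :=
  exists delta : rat, forall w x y z,
    generated S w -> generated S x -> generated S y -> generated S z ->
    Num.min (gromov_product S w x y) (gromov_product S w y z) - delta
      <= gromov_product S w x z.

Definition product_diverges S (x y : nat -> gT) :=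
  forall M : nat, exists N : nat, forall i j : nat, (N <= i)%N -> (N <= j)%N ->
    M%:R <= gromov_product S 1%g (x i) (y j).

Definition converges_at_infinity S (x : nat -> gT) :=
  (forall i, generated S (x i)) /\ product_diverges S x x.

Definition boundary_class S (x : nat -> gT) : set (nat -> gT) :=
  [set y | converges_at_infinity S y /\ product_diverges S x y].

Definition translate g (p : set (nat -> gT)) : set (nat -> gT) :=
  [set (fun i => g * x i)%g | x in p].

Lemma is_word_cat S s t : is_word S s -> is_word S t -> is_word S (s ++ t).
Proof. by move=> sS tS x; rewrite mem_cat => /orP[/sS|/tS]. Qed.

Lemma is_word_rev S s : is_word S s -> is_word S [seq (x^-1)%g | x <- rev s].
Proof.
move=> sS x /mapP[y]; rewrite mem_rev => /sS[yS|yS] ->; last by left.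
by right; rewrite invgK.
Qed.

Lemma prod_rev s :
  (\prod_(x <- [seq (x^-1)%g | x <- rev s]) x)%g = ((\prod_(x <- s) x)^-1)%g.
Proof.
elim: s => [|a s IHs]; first by rewrite /= !big_nil invg1.
by rewrite rev_cons map_rcons -cats1 big_cat /= IHs big_seq1 big_cons invgM.
Qed.

Lemma generatedM S g h : generated S g -> generated S h -> generated S (g * h)%g.
Proof.
move=> [s sS <-] [t tS <-]; exists (s ++ t); first exact: is_word_cat.
by rewrite big_cat.
Qed.

Lemma generatedV S g : generated S g -> generated S (g^-1)%g.
Proof.
move=> [s sS <-]; exists [seq (x^-1)%g | x <- rev s]; last exact: prod_rev.
exact: is_word_rev.
Qed.

Lemma word_lengthP S g : generated S g ->
  (exists s, [/\ is_word S s, size s = word_length S g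
               & (\prod_(x <- s) x)%g = g])
  /\ (forall s, is_word S s -> (\prod_(x <- s) x)%g = g ->
        (word_length S g <= size s)%N).
Proof.
move=> [s0 s0S s0g]; rewrite /word_length.
case: xgetP => [m _ //|none]; exfalso.
pose P m := `[< exists s, [/\ is_word S s, size s = m
                            & (\prod_(x <- s) x)%g = g] >].
have exP : exists m, P m by exists (size s0); apply/asboolP; exists s0.
have [m /asboolP mP mmin] := ex_minnP exP.
apply: (none m); split=> // s sS sg; apply: mmin.
by apply/asboolP; exists s.
Qed.

Lemma word_lengthM S g h : generated S g -> generated S h ->
  (word_length S (g * h)%g <= word_length S g + word_length S h)%N.
Proof.
move=> gS hS; have [_ min] := word_lengthP (generatedM gS hS).
have [[s [sS <- sg]] _] := word_lengthP gS.
have [[t [tS <- th]] _] := word_lengthP hS.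
rewrite -size_cat; apply: min; first exact: is_word_cat.
by rewrite big_cat /= sg th.
Qed.

Lemma gromov_product_translate S g x y :
  generated S g -> generated S x -> generated S y ->
  gromov_product S 1%g x y - (word_length S (g^-1)%g)%:R
    <= gromov_product S 1%g (g * x)%g (g * y)%g.
Proof.
move=> gS xS yS; rewrite /gromov_product /word_dist invg1 !mul1g.
have -> : ((g * x)^-1 * (g * y) = x^-1 * y)%g by rewrite invgM -mulgA mulKg.
have len z : generated S z ->
    (word_length S z <= word_length S (g^-1)%g + word_length S (g * z)%g)%N.
  move=> zS; rewrite -{1}(mulKg g z).
  by apply: word_lengthM; [exact: generatedV | exact: generatedM].
have := len x xS; have := len y yS.
by rewrite -!(ler_nat rat) !natrD; lra.
Qed.

Lemma product_diverges_translate S g (x y : nat -> gT) : generated S g ->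
  (forall i, generated S (x i)) -> (forall i, generated S (y i)) ->
  product_diverges S x y ->
  product_diverges S (fun i => g * x i)%g (fun i => g * y i)%g.
Proof.
move=> gS xS yS xy M.
have [N NP] := xy (M + word_length S (g^-1)%g)%N.
exists N => i j Ni Nj.
have := gromov_product_translate gS (xS i) (yS j).
by have := NP i j Ni Nj; rewrite natrD; lra.
Qed.

Lemma converges_translate S g (x : nat -> gT) : generated S g ->
  converges_at_infinity S x -> converges_at_infinity S (fun i => g * x i)%g.
Proof.
move=> gS [xS xx]; split; first by move=> i; exact: generatedM.
exact: product_diverges_translate.
Qed.

Lemma translate_class S g (x : nat -> gT) : generated S g -> converges_at_infinity S x ->
  translate g (boundary_class S x) = boundary_class S (fun i => g * x i)%g.
Proof.
move=> gS xC; apply/seteqP; split=> y.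
  move=> [z [zC xz] <-]; split; first exact: converges_translate.
  by apply: product_diverges_translate => //; [case: xC | case: zC].
move=> [yC xy]; have gV := generatedV gS.
exists (fun i => g^-1 * y i)%g; last first.
  by apply/funext => i; rewrite mulVKg.
split; first exact: converges_translate.
have xE : x = (fun i => g^-1 * (g * x i))%g by apply/funext => i; rewrite mulKg.
rewrite xE; apply: product_diverges_translate => //; last by case: yC.
by move=> i; apply: generatedM => //; case: xC.
Qed.

(* Points of the Gromov boundary of the group generated by S: equivalence
   classes of sequences converging at infinity. *)
Definition is_boundary_class S (p : set (nat -> gT)) : bool :=
  `[< exists2 x, converges_at_infinity S x & p = boundary_class S x >].

Record gromov_boundary S := BoundaryPoint {
  boundary_seqs :> set (nat -> gT);
  boundary_seqsP : is_boundary_class S boundary_seqs }.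

HB.instance Definition _ S := [isSub for @boundary_seqs S].
HB.instance Definition _ S := [Choice of gromov_boundary S by <:].

(* The sets of those q with liminf (x_i | y_j) >= r for some x in p, y in q;
   they form a neighbourhood basis at p when S generates a hyperbolic group. *)
Definition boundary_shadow S (p : gromov_boundary S) (r : nat) :
    set (gromov_boundary S) :=
  [set q | exists x y : nat -> gT, [/\ boundary_seqs p x, boundary_seqs q y
     & exists N : nat, forall i j : nat, (N <= i)%N -> (N <= j)%N ->
         r%:R <= gromov_product S 1%g (x i) (y j)]].

Definition boundary_open S (U : set (gromov_boundary S)) :=
  forall p, U p -> exists r, boundary_shadow p r `<=` U.

Lemma boundary_shadowS S (p : gromov_boundary S) r t : (r <= t)%N ->
  boundary_shadow p t `<=` boundary_shadow p r.
Proof.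
move=> rt q [x [y [px qy [N NP]]]]; exists x, y; split=> //.
by exists N => i j Ni Nj; apply: le_trans (NP i j Ni Nj); rewrite ler_nat.
Qed.

Fact boundary_openT S : @boundary_open S setT.
Proof. by move=> p _; exists 0%N. Qed.

Fact boundary_openI S : setI_closed (@boundary_open S).
Proof.
move=> U V oU oV p [/oU[r rU] /oV[t tV]]; exists (maxn r t) => q qp.
split; [apply: rU | apply: tV]; apply: boundary_shadowS qp.
  exact: leq_maxl.
exact: leq_maxr.
Qed.

Fact boundary_open_bigU S (I : Type) (f : I -> set (gromov_boundary S)) :
  (forall i, boundary_open (f i)) -> boundary_open (\bigcup_i f i).
Proof.
by move=> fo p [i _ /(fo i)[r rf]]; exists r => q /rf fq; exists i.
Qed.

HB.instance Definition _ S := isOpenTopological.Build (gromov_boundary S)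
  (@boundary_openT S) (@boundary_openI S) (@boundary_open_bigU S).

(* The default value is never reached for g in the group: see
   boundary_actE. *)
Definition boundary_act S g (p : gromov_boundary S) : gromov_boundary S :=
  insubd p (translate g (boundary_seqs p)).

Lemma boundary_actE S g (p : gromov_boundary S) : generated S g ->
  boundary_seqs (boundary_act g p) = translate g (boundary_seqs p).
Proof.
move=> gS; rewrite [LHS]val_insubd ifT //.
have /asboolP[x xC ->] := boundary_seqsP p.
apply/asboolP; exists (fun i => g * x i)%g; first exact: converges_translate.
exact: translate_class.
Qed.

(* Restriction to the vertices of a geodesic of the Cayley graph between two
   vertices; the other points are within 1/2 of these. *)
Definition geodesic S (m : nat) (p : nat -> gT) :=
  forall i j : nat, (i <= j)%N -> (j <= m)%N ->
    word_dist S (p i) (p j) = (j - i)%N.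

(* The Cayley graph of a presentation only depends on its generators, and
   hyperbolic groups are finitely presented over every finite generating set. *)
Definition quasiconvex (H G : set gT) :=
  exists S, finite_generating_set S G /\
  exists2 C : nat, (0 < C)%N &
    forall (m : nat) (p : nat -> gT),
      (forall i, (i <= m)%N -> G (p i)) -> geodesic S m p ->
      H (p 0%N) -> H (p m) ->
      forall i, (i <= m)%N -> exists2 h, H h & (word_dist S (p i) h <= C)%N.

End GroupsAndWords.

Section WeylChamber.
Variables (R : realType) (d : nat).

Fact root_snd_subproof (k : 'I_d.-1) : (k.+1 < d)%N.
Proof. by case: d k => [[]//|n] k /=; rewrite ltnS. Qed.

(* Roots and weights are indexed from 0: k : 'I_d.-1 stands for alpha_{k+1},
   whose flag components have dimension k+1. *)
Definition root_fst (k : 'I_d.-1) : 'I_d := widen_ord (leq_pred d) k.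
Definition root_snd (k : 'I_d.-1) : 'I_d := Ordinal (root_snd_subproof k).

Definition simple_root (k : 'I_d.-1) (a : 'rV[R]_d) : R^o :=
  a 0 (root_fst k) - a 0 (root_snd k).

Definition fund_weight (k : 'I_d.-1) (a : 'rV[R]_d) : R^o :=
  \sum_(i < d | (i <= k)%N) a 0 i.

Definition coord_sum (a : 'rV[R]_d) : R^o := \sum_(i < d) a 0 i.

Fact simple_root_linear k : linear (simple_root k).
Proof.
move=> c u v; rewrite /simple_root !mxE /GRing.scale /= mulrBr opprD.
by rewrite -!addrA; congr (_ + _); rewrite addrCA.
Qed.

HB.instance Definition _ k :=
  GRing.isLinear.Build R 'rV[R]_d R^o _ (simple_root k) (simple_root_linear k).

Fact coord_sum_linear : linear coord_sum.
Proof.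
move=> c u v; rewrite /coord_sum scaler_sumr -big_split /=.
by apply: eq_bigr => i _; rewrite !mxE.
Qed.

HB.instance Definition _ :=
  GRing.isLinear.Build R 'rV[R]_d R^o _ coord_sum coord_sum_linear.

Definition symmetric_roots (theta : {set 'I_d.-1}) :=
  forall k, (k \in theta) = (rev_ord k \in theta).

Definition a_theta (theta : {set 'I_d.-1}) : {vspace 'rV[R]_d} :=
  (lker (linfun coord_sum) :&:
   \bigcap_(k | k \notin theta) lker (linfun (simple_root k)))%VS.

Lemma mem_a_theta (theta : {set 'I_d.-1}) (a : 'rV[R]_d) :
  a \in a_theta theta <->
  \sum_(i < d) a 0 i = 0 /\
  (forall k, k \notin theta -> a 0 (root_fst k) = a 0 (root_snd k)).
Proof.
rewrite /a_theta memv_cap memv_ker lfunE /=; split.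
  move=> /andP[/eqP s0 aI]; split=> // k kt.
  move: aI; rewrite memvE => /subv_bigcapP/(_ k kt).
  by rewrite -memvE memv_ker lfunE /= subr_eq0 => /eqP.
move=> [s0 ak]; apply/andP; split; first exact/eqP.
rewrite memvE; apply/subv_bigcapP => k kt.
by rewrite -memvE memv_ker lfunE /= /simple_root ak // subrr.
Qed.

End WeylChamber.

Arguments a_theta R {d} theta.

Section Flags.
Variables (K : numFieldType) (d : nat) (theta : {set 'I_d.-1}).

Local Notation theta_idx := {k : 'I_d.-1 | k \in theta}.

Definition is_flag
    (F : {ffun theta_idx -> {vspace 'cV[K]_d}}) : bool :=
  [forall k : theta_idx, \dim (F k) == (val k).+1] &&
  [forall k : theta_idx, forall l : theta_idx, (val k <= val l)%N ==> (F k <= F l)%VS].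

Record flag := Flag {
  flag_part :> {ffun theta_idx -> {vspace 'cV[K]_d}};
  flagP : is_flag flag_part }.

HB.instance Definition _ := [isSub for flag_part].
HB.instance Definition _ := [Choice of flag by <:].

Definition transverse_flags (F G : flag) :=
  forall k l : theta_idx, ((val k).+1 + (val l).+1)%N = d ->
    (F k + G l = fullv)%VS /\ directv (F k + G l).

Definition first_columns (A : 'M[K]_d) (k : nat) : {vspace 'cV[K]_d} :=
  <<[seq col i A | i : 'I_d <- enum 'I_d & (i <= k)%N]>>%VS.

(* A is a basis of K^d adapted to F, i.e. F = A . (standard flag). *)
Definition adapted_frame (A : 'M[K]_d) (F : flag) :=
  A \in unitmx /\ forall k, F k = first_columns A (val k).

Lemma span_columns (A : 'M[K]_d) : A \in unitmx ->
  <<[seq col i A | i : 'I_d <- enum 'I_d]>>%VS = fullv.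
Proof.
move=> uA; apply/eqP; rewrite eqEsubv subvf; apply/subvP => v _.
have -> : v = \sum_(i < d) (invmx A *m v) i 0 *: col i A.
  rewrite -[LHS](mulKVmx uA); apply/matrixP => i j.
  rewrite !mxE summxE; apply: eq_bigr => l _.
  by rewrite !mxE mulrC (ord1 j).
apply: memv_suml => i _; apply/memvZ/memv_span/map_f.
by rewrite mem_enum.
Qed.

Lemma dim_first_columns (A : 'M[K]_d) (k : nat) : A \in unitmx -> (k < d)%N ->
  \dim (first_columns A k) = k.+1.
Proof.
move=> uA kd; set X := [seq col i A | i : 'I_d <- enum 'I_d].
have frX : free X.
  rewrite /free span_columns // dimvf size_map size_enum_ord.
  by rewrite /dim /= muln1.
have sz : size [seq i : 'I_d <- enum 'I_d | (i <= k)%N] = k.+1.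
  rewrite -(size_map val) -(filter_map val (fun i => (i <= k)%N)) val_enum_ord.
  by have /= -> := @filter_iota_leq d 0 k kd; rewrite /= size_iota.
have frY : free [seq col i A | i : 'I_d <- enum 'I_d & (i <= k)%N].
  apply: (@catl_free _ _ [seq col i A | i : 'I_d <- enum 'I_d & ~~ (i <= k)%N]).
  rewrite -map_cat; rewrite (@perm_free _ _ _ X) //.
  by apply/perm_map/permPl/perm_filterC.
by rewrite /first_columns (eqP frY) size_map sz.
Qed.

Lemma adapted_frame_exists (A : 'M[K]_d) : A \in unitmx ->
  exists F : flag, adapted_frame A F.
Proof.
move=> uA; have kd (k : 'I_d.-1) : (k < d)%N.
  exact: leq_trans (ltn_ord k) (leq_pred d).
pose F := [ffun k : theta_idx => first_columns A (val k)].
have FP : is_flag F.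
  apply/andP; split.
    by apply/forallP => k; rewrite ffunE dim_first_columns.
  apply/forallP => k; apply/forallP => l; apply/implyP => kl; rewrite !ffunE.
  apply: sub_span => v vX; have [i ik ->] := mapP vX.
  apply: map_f; move: ik; rewrite mem_filter => /andP[ik iE].
  by rewrite mem_filter iE (leq_trans ik kl).
by exists (Flag FP); split=> // k; rewrite ffunE.
Qed.

Lemma adapted_frame_inj (A : 'M[K]_d) (F G : flag) :
  adapted_frame A F -> adapted_frame A G -> F = G.
Proof.
move=> [_ AF] [_ AG]; apply/val_inj/ffunP => k.
by rewrite [LHS]AF [RHS]AG.
Qed.

Definition frames_over (U : set flag) : set 'M[K]_d :=
  [set A | exists2 F, adapted_frame A F & U F].

Lemma frames_overT : frames_over setT = [set A | A \in unitmx].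
Proof.
apply/seteqP; split=> A /=; first by move=> [F [uA _] _].
by move=> uA; have [F AF] := adapted_frame_exists uA; exists F.
Qed.

Lemma frames_overI U V : frames_over (U `&` V) = frames_over U `&` frames_over V.
Proof.
apply/seteqP; split=> A /=; first by move=> [F AF [UF VF]]; split; exists F.
move=> [[F AF UF] [G AG VG]]; exists F => //; split=> //.
by rewrite (adapted_frame_inj AF AG).
Qed.

Lemma frames_over_bigcup (I : Type) (f : I -> set flag) :
  frames_over (\bigcup_i f i) = \bigcup_i frames_over (f i).
Proof.
apply/seteqP; split=> A /=.
  by move=> [F AF [i _ fF]]; exists i => //; exists F.
by move=> [i _ [F AF fF]]; exists F => //; exists i.
Qed.

(* The manifold topology: the quotient topology of GL(d, K) -> F_theta. *)
Definition flag_open (U : set flag) :=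
  open (frames_over U : set (subspace [set A : 'M[K]_d | A \in unitmx])).

Fact flag_openT : flag_open setT.
Proof. rewrite /flag_open frames_overT; exact: open_subspaceT. Qed.

Fact flag_openI : setI_closed flag_open.
Proof. move=> U V oU oV; rewrite /flag_open frames_overI; exact: openI. Qed.

Fact flag_open_bigU (I : Type) (f : I -> set flag) :
  (forall i, flag_open (f i)) -> flag_open (\bigcup_i f i).
Proof.
move=> fo; rewrite /flag_open frames_over_bigcup.
by apply: bigcup_open => i _; exact: fo.
Qed.

HB.instance Definition _ :=
  isOpenTopological.Build flag flag_openT flag_openI flag_open_bigU.

End Flags.

Section TransverseGroups.
Variables (R : realType) (b : base_field) (d : nat).

Local Notation K := (scalars R b).
Local Notation PSLd := (PSL K d).

Definition is_unitary (k : 'M[K]_d) := k *m (map_mx (@scalar_conj R b) k)^T = 1%:M.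

Definition real_diag (s : 'rV[R]_d) : 'M[K]_d :=
  diag_mx (map_mx (@scalar_of_real R b) s).

Definition is_svd (A k : 'M[K]_d) (s : 'rV[R]_d) (l : 'M[K]_d) :=
  [/\ is_unitary k, is_unitary l,
      (forall i, 0 <= s 0 i),
      (forall i j : 'I_d, (i <= j)%N -> s 0 j <= s 0 i)
    & A = k *m real_diag s *m l].

(* Existence and uniqueness of s: singular value decomposition. *)
Definition singular_values (A : 'M[K]_d) : 'rV[R]_d :=
  xget 0 [set s | exists k l, is_svd A k s l].

Definition cartan_proj (g : PSLd) : 'rV[R]_d :=
  map_mx (@ln R) (singular_values (lift g)).

(* Existence and uniqueness of v: the restrictions of the fundamental weights
   of theta form a basis of the dual of a_theta. *)
Definition partial_cartan_proj (theta : {set 'I_d.-1}) (g : PSLd) :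
    subvs_of (a_theta R theta) :=
  xget 0 [set v | forall k, k \in theta ->
                    fund_weight k (vsval v) = fund_weight k (cartan_proj g)].

Definition poincare_series (theta : {set 'I_d.-1})
    (phi : 'Hom(subvs_of (a_theta R theta), R^o)) (Gamma : set PSLd) (s : R) :
    \bar R :=
  \esum_(g in Gamma) (expR (- s * phi (partial_cartan_proj theta g)))%:E.

Definition critical_exponent (theta : {set 'I_d.-1})
    (phi : 'Hom(subvs_of (a_theta R theta), R^o)) (Gamma : set PSLd) : \bar R :=
  ereal_inf [set s%:E | s in [set s : R |
    0 < s /\ (poincare_series phi Gamma s < +oo)%E]].

Section Theta.
Variable theta : {set 'I_d.-1}.

Definition divergent (Gamma : set PSLd) :=
  forall gamma : nat -> PSLd, injective gamma -> (forall m, Gamma (gamma m)) ->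
    (fun m => \big[Order.min/+oo%E]_(k in theta)
                (simple_root k (cartan_proj (gamma m)))%:E) @ \oo --> +oo%E.

(* F = U_theta(g); the relation holds for no F unless g has gaps at theta. *)
Definition is_attracting_flag (g : PSLd) (F : flag K theta) :=
  (forall k, k \in theta -> 0 < simple_root k (cartan_proj g)) /\
  exists k l : 'M[K]_d,
    is_svd (lift g) k (map_mx expR (cartan_proj g)) l /\ adapted_frame k F.

Definition limit_set (Gamma : set PSLd) : set (flag K theta) :=
  [set F | exists (gamma : nat -> PSLd) (U : nat -> flag K theta),
     [/\ injective gamma, (forall m, Gamma (gamma m)),
         (forall m, is_attracting_flag (gamma m) (U m))
       & U @ \oo --> F]].

Definition transverse_subgroup (Gamma : set PSLd) :=
  divergent Gamma /\
  forall F G, limit_set Gamma F -> limit_set Gamma G -> F <> G ->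
    transverse_flags F G.

Definition non_elementary (Gamma : set PSLd) := infinite_set (limit_set Gamma).

(* Scalars fix every subspace, so the choice of lift is immaterial. *)
Definition act_subspace (g : PSLd) (V : {vspace 'cV[K]_d}) : {vspace 'cV[K]_d} :=
  (linfun (mulmx (lift g : 'M[K]_d)) @: V)%VS.

Definition homeomorphism_onto (X Y : topologicalType) (f : X -> Y) (L : set Y) :=
  [/\ injective f, range f = L, continuous f
    & forall U, open U -> exists2 V, open V & f @` U = V `&` L].

Definition anosov (Gamma : set PSLd) :=
  transverse_subgroup Gamma /\
  exists S : set PSLd,
    [/\ finite_generating_set S Gamma, gromov_hyperbolic S
      & exists xi : gromov_boundary S -> flag K theta,
          homeomorphism_onto xi (limit_set Gamma) /\
          forall g p, Gamma g ->
            forall k, xi (boundary_act g p) k = act_subspace g (xi p k)].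

End Theta.

End TransverseGroups.

(* Main.v *)
(* In the word metric, call a product gh reduced up to D when |g| + |h| - |gh|
   is at most D.  Along reduced products the transverse limit flags keep the
   singular value decompositions of g and h in general position, so the norms
   of exterior powers are multiplicative up to a bounded factor, and
   phi (kappa_theta (gh)) = phi (kappa_theta g) + phi (kappa_theta h) + O(1).

   Let c be the critical exponent of G.  If c > 0 then the series of G diverges
   at c: by quasiconvexity, elements of G can be cut inside G at a prescribed
   distance m from 1, and the resulting recursion between sums over balls shows
   that convergence at some s > 0 implies convergence at some s' < s.  As G has
   infinite index, some element a of the group makes all products
   g_1 a g_2 a ... g_n a with g_i in a separated subset of G reduced, so that
   the elements g a freely generate a semigroup.  By divergence, finitely many
   of them have weights exp (- s (phi + C)) summing to at least 2 at s = c, hence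
   to at least 1 up to s = c + eps; summing over all words, the series of the
   whole group diverges at c + eps.  If c = 0, any free semigroup on two
   generators does the same. *)
Require Import Defs.
From HB Require Import structures.
From mathcomp Require Import all_boot all_order all_algebra.
From mathcomp Require Import all_classical all_reals all_analysis.
From mathcomp Require Import complex perm.
From mathcomp Require Import lra zify ring.
Import Defs.

Set Implicit Arguments.
Unset Strict Implicit.
Unset Printing Implicit Defensive.

Import Order.TTheory GRing.Theory Num.Theory.
Import numFieldNormedType.Exports.

Local Open Scope classical_set_scope.
Local Open Scope nat_scope.

(** * Hyperbolic word metrics *)

(** Two word norms are carried along: hyperbolicity is given for one finite generating set and
    quasiconvexity for another, so geodesics of the two norms have to be compared before either
    hypothesis can be used with the other. The functional [phi] may have coefficients of either sign
    on the fundamental weights, so submultiplicativity of norms alone bounds nothing; a matching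
    lower bound is required, and this is where transversality enters. The delicate point is the
    order of the constants. The loss per letter in a free semigroup depends on the allowed
    cancellation [D], and the finite set of letters must be large enough to beat that loss. Hence
    every construction of long elements below produces its cancellation constant first, uniformly in
    the lengths and in the number of elements chosen afterwards. *)

Record word_norm (T : groupType) (l : T -> nat) : Prop := WordNorm {
  norm_one : l 1%g = 0;
  norm_inv : forall x, l (x^-1)%g = l x;
  norm_mul : forall x y, l (x * y)%g <= l x + l y;
  norm_ball : forall n, finite_set [set x | l x <= n];
  norm_geodesic : forall x, exists p : nat -> T,
    [/\ p 0 = 1%g, p (l x) = x &
        forall i j, i <= j -> j <= l x -> l ((p i)^-1 * p j)%g = j - i] }.

Definition ndist (T : groupType) (l : T -> nat) (x y : T) := l (x^-1 * y)%g.

(* The four-point condition; [delta] is twice the usual hyperbolicity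
   constant, so that everything stays in [nat]. *)
Definition four_point (T : groupType) (l : T -> nat) (delta : nat) :=
  forall w x y z : T,
    ndist l x z + ndist l w y <= ndist l x y + ndist l w z + delta \/
    ndist l x z + ndist l w y <= ndist l y z + ndist l w x + delta.

Section Distance.
Variables (T : groupType) (l : T -> nat).
Hypothesis ln : word_norm l.
Local Notation d := (ndist l).

Lemma dist1x x : d 1%g x = l x.
Proof. by rewrite /ndist invg1 mul1g. Qed.

Lemma distxx x : d x x = 0.
Proof. by rewrite /ndist mulVg (norm_one ln). Qed.

Lemma distC x y : d x y = d y x.
Proof. by rewrite /ndist -(norm_inv ln) invgM invgK. Qed.

Lemma distx1 x : d x 1%g = l x.
Proof. by rewrite distC dist1x. Qed.

Lemma dist_mul g x y : d (g * x)%g (g * y)%g = d x y.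
Proof. by rewrite /ndist invgM -mulgA mulKg. Qed.

Lemma distE x y : d x y = l (x^-1 * y)%g. Proof. by []. Qed.

Lemma dist_mulV g x : d g (g * x)%g = l x.
Proof. by rewrite /ndist mulKg. Qed.

Lemma dist_tri y x z : d x z <= d x y + d y z.
Proof.
rewrite /ndist; have -> : (x^-1 * z = (x^-1 * y) * (y^-1 * z))%g.
  by rewrite -mulgA mulVKg.
exact: norm_mul.
Qed.

End Distance.

Lemma geodesic_concat (T : groupType) (l : T -> nat) (y z : T) : word_norm l ->
  l (y * z)%g = l y + l z -> exists p : nat -> T,
  [/\ p 0 = 1%g, p (l y) = y, p (l (y * z)%g) = (y * z)%g &
      forall i j, i <= j -> j <= l (y * z)%g -> ndist l (p i) (p j) = j - i].
Proof.
move=> ln yz; set g := (y * z)%g in yz *.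
have [p1 [p10 p1n p1d]] := norm_geodesic ln y.
have [p2 [p20 p2n p2d]] := norm_geodesic ln z.
pose p i := if i <= l y then p1 i else (y * p2 (i - l y))%g.
have p0 : p 0 = 1%g by rewrite /p p10.
have py : p (l y) = y by rewrite /p leqnn.
have pg : p (l g) = g.
  rewrite /p yz; case: leqP => [z0|_]; last by rewrite addKn p2n.
  have zz : l z = 0 by lia.
  by rewrite zz addn0 p1n /g -p2n zz p20 mulg1.
exists p; split=> //.
have le a b : a <= b -> b <= l g -> ndist l (p a) (p b) <= b - a.
  move=> ab bg; rewrite /p; case: (leqP a) => ay; case: (leqP b) => bY; try lia.
  - by rewrite /ndist p1d.
  - apply: leq_trans (dist_tri ln y _ _) _.
    rewrite -{2}(mulg1 y) dist_mul // -{1}p1n -p20 /ndist p1d // p2d; lia.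
  - by rewrite dist_mul /ndist // p2d; lia.
move=> i j ij jg; apply/eqP; rewrite eqn_leq le //=.
have := le 0 i; have := le j (l g); rewrite p0 pg => H1 H2.
have := H1 jg (leqnn _); have := H2 isT (leq_trans ij jg).
have := dist_tri ln (p i) 1%g g; have := dist_tri ln (p j) (p i) g.
by rewrite !dist1x; lia.
Qed.

(** * Stability of quasigeodesics under a change of word norm *)

Section Morse.
Variables (T : groupType) (l l' : T -> nat) (delta lambda : nat).
Hypotheses (ln : word_norm l) (ln' : word_norm l') (hyp : four_point l delta).
Hypotheses (le_l : forall x, l x <= lambda * l' x)
           (le_l' : forall x, l' x <= lambda * l x).
Local Notation d := (ndist l).
Local Notation d' := (ndist l').

(** The hypothesis bounds from below twice the Gromov product at [w] of consecutive points. Each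
    halving of the chain costs one [delta] by the four-point condition, so a chain of at most
    [2 ^ k] steps loses only [k * delta]. *)
Lemma chain_product (k : nat) (p : nat -> T) (w : T) (C m n : nat) :
  m < n -> n <= m + 2 ^ k ->
  (forall i, m <= i < n -> C + d (p i) (p i.+1) <= d w (p i) + d w (p i.+1)) ->
  C + d (p m) (p n) <= d w (p m) + d w (p n) + k * delta.
Proof.
elim: k m n => [|k IH] m n mn nk Cp.
  have -> : n = m.+1 by rewrite expn0 in nk; lia.
  by rewrite mul0n addn0; apply: Cp; lia.
case: (leqP n (m + 2 ^ k)) => nk'.
  by have := IH _ _ mn nk' Cp; lia.
have k0 : 0 < 2 ^ k by rewrite expn_gt0.
rewrite expnS in nk; have [r rE] : exists r, r = m + 2 ^ k by exists (m + 2 ^ k).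
have mr : m < r by lia.
have rk : r <= m + 2 ^ k by lia.
have rn : r < n by lia.
have nr : n <= r + 2 ^ k by lia.
have H1 := IH m r mr rk (fun i hi => ltac:(apply: Cp; lia)).
have H2 := IH r n rn nr (fun i hi => ltac:(apply: Cp; lia)).
by have := hyp w (p m) (p r) (p n); lia.
Qed.

Lemma exp_beats_linear (a b : nat) :
  exists k0, forall k, k0 <= k -> a + b * k <= 2 ^ k.-1.
Proof.
pose m := a + 3 * b + 3; exists (2 * m).+1 => k.
elim: k => [|k IH]; first by lia.
rewrite leq_eqVlt => /orP[/eqP <-|]; last first.
  rewrite ltnS => km; have := IH km; rewrite /= in km *.
  have -> : 2 ^ k = 2 * 2 ^ k.-1 by rewrite -expnS; congr (_ ^ _); lia.
  have : b <= b * k by rewrite leq_pmulr //; lia.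
  by lia.
rewrite [_.-1]/= [X in 2 ^ X]mulnC expnM; have := ltn_expl m (isT : 1 < 2).
have mE : m = a + 3 * b + 3 by [].
by move: (2 ^ m) => X HX; rewrite -mulnn; clear -HX mE; nia.
Qed.

Lemma geodesic_near_quasigeodesic : exists D0, forall g p q,
  p 0 = 1%g -> p (l' g) = g ->
  (forall i j, i <= j -> j <= l' g -> d' (p i) (p j) = j - i) ->
  q 0 = 1%g -> q (l g) = g ->
  (forall i j, i <= j -> j <= l g -> d (q i) (q j) = j - i) ->
  forall t, t <= l g -> exists2 i, i <= l' g & d (q t) (p i) <= D0.
Proof.
(* These coefficients contradict the two final estimates [2 ^ k.-1 <= m + 2 <= 6 * lambda * D + 2]
   and [2 * D <= lambda + k * delta]. *)
have [k0 k0P] := exp_beats_linear (3 * lambda * lambda + 3) (3 * lambda * delta).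
exists (lambda + k0 * delta) => g p q p0 pn pd q0 qn qd.
pose P D := `[< forall t, t <= l g -> exists2 i, i <= l' g & d (q t) (p i) <= D >].
have exP : exists D, P D.
  exists (l g); apply/asboolP => t tg; exists 0 => //.
  by rewrite p0 -q0 distC // qd //; lia.
have [D /asboolP PD Dmin] := ex_minnP exP.
suff DD : D <= lambda + k0 * delta.
  by move=> t tg; have [i ii id] := PD t tg; exists i => //; lia.
have [->//|Dpos] := posnP D.
have [t0 t0g far] : exists2 t0, t0 <= l g & forall i, i <= l' g -> D <= d (q t0) (p i).
  apply: contrapT => nt; have : P D.-1.
    apply/asboolP => t tg; apply: contrapT => ni; apply: nt; exists t => // i ig.
    by rewrite leqNgt; apply/negP => lt; apply: ni; exists i => //; lia.
  by move/Dmin; lia.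
(* The detour leaves [q] at distance [2 * D] on either side of [w], or at an end, and follows [p] in
   between. It stays far from [w] and has a number of steps linear in [D], so the chain estimate
   bounds [D] by a multiple of the logarithm of [D]. *)
set w := q t0 in far.
pose tu := t0 - 2 * D; pose tv := minn (t0 + 2 * D) (l g).
have [i [ig iu ciu]] : exists i, [/\ i <= l' g, d (q tu) (p i) <= D &
    2 * D + d (q tu) (p i) <= d w (q tu) + d w (p i)].
  case: (leqP (2 * D) t0) => Dt.
    have [i ig id] := PD tu ltac:(lia); exists i; split => //.
    have := far i ig; have : d w (q tu) = 2 * D by rewrite distC // qd /tu; lia.
    by lia.
  have tu0 : tu = 0 by lia.
  exists 0; split => //; rewrite tu0 q0 p0 distxx //.
  by have := far 0 isT; rewrite p0; lia.
have [j [jg jv cjv]] : exists j, [/\ j <= l' g, d (q tv) (p j) <= D &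
    2 * D + d (p j) (q tv) <= d w (p j) + d w (q tv)].
  case: (leqP (t0 + 2 * D) (l g)) => Dt.
    have tvE : tv = t0 + 2 * D by lia.
    have [j jg jd] := PD tv ltac:(lia); exists j; split => //.
    have := far j jg; have : d w (q tv) = 2 * D by rewrite qd tvE; lia.
    by rewrite (distC ln (p j)); lia.
  have tvE : tv = l g by lia.
  exists (l' g); split => //; rewrite tvE qn pn distxx //.
  by have := far (l' g) (leqnn _); rewrite pn; lia.
have uv : d w (q tu) + d w (q tv) = d (q tu) (q tv).
  by rewrite (distC ln w (q tu)) !qd /tu /tv; lia.
have uvD : d (q tu) (q tv) <= 4 * D by rewrite qd /tu /tv; lia.
pose r t := if i <= j then i + t else i - t.
pose m := (i - j) + (j - i).
have rg t : t <= m -> r t <= l' g by rewrite /r /m; case: (leqP i j); lia.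
have ijD : m <= lambda * (6 * D).
  have -> : m = d' (p i) (p j).
    case: (leqP i j) => ij; first by rewrite pd; lia.
    by rewrite distC // pd; lia.
  apply: leq_trans (le_l' _) _; rewrite leq_mul2l -distE.
  have := dist_tri ln (q tu) (p i) (p j); have := dist_tri ln (q tv) (q tu) (p j).
  by rewrite (distC ln (p i) (q tu)); lia.
pose c s := if s is s'.+1 then (if s' <= m then p (r s') else q tv) else q tu.
pose k := trunc_log 2 (m + 2) + 1.
have mk : m + 2 <= 2 ^ k.
  by rewrite /k addn1; apply/ltnW/trunc_log_ltn.
have km : 2 ^ k.-1 <= m + 2.
  by rewrite /k addn1 /=; apply: trunc_logP => //; lia.
have step s : s < m -> d (p (r s)) (p (r s.+1)) <= lambda.
  move=> sm; apply: leq_trans (le_l _) _; rewrite -distE.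
  suff -> : d' (p (r s)) (p (r s.+1)) = 1 by rewrite muln1.
  have := rg s ltac:(lia); have := rg s.+1 ltac:(lia).
  rewrite /r /m in sm *; case: (leqP i j) => ij; first by rewrite pd; lia.
  by move=> *; rewrite distC // pd; lia.
have r0 : r 0 = i by rewrite /r; case: (leqP i j); lia.
have rm : r m = j by rewrite /r /m; case: (leqP i j); lia.
have := @chain_product k c w (2 * D - lambda) 0 m.+2 ltac:(lia) ltac:(lia).
have -> : c m.+2 = q tv by rewrite /= ltnn.
rewrite [c 0]/= uv => H.
have {}H : 2 * D <= lambda + k * delta.
  suff : 2 * D - lambda + d (q tu) (q tv) <= d (q tu) (q tv) + k * delta by lia.
  apply: H => s /andP[_]; case: s => [_|s sm]; first by rewrite /= r0; lia.
  rewrite /=; case: ltnP => sm'.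
    rewrite (ltnW sm'); have := far _ (rg s (ltnW sm')); have := far _ (rg _ sm').
    have := step _ sm'; have := dist_tri ln w (p (r s)) (p (r s.+1)).
    by rewrite (distC ln (p _) w); lia.
  have -> : s = m by lia.
  by rewrite leqnn rm; lia.
case: (leqP k0 k) => k0k; last first.
  have : k * delta <= k0 * delta by rewrite leq_mul2r ltnW ?orbT.
  by lia.
have kP := k0P k k0k.
have lD : lambda * (2 * D) <= lambda * (lambda + k * delta) by rewrite leq_mul2l H orbT.
exfalso; clear -kP lD km ijD; move: (2 ^ k.-1) kP km => X; nia.
Qed.

(** A connectedness argument: at the first time [t] when the [l]-geodesic is near the part of the
    [l']-geodesic beyond [y], it was one step earlier near the part before [y]. These two parts are
    close to each other only around [y], so the [l]-geodesic passes near [y]. *)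
Lemma quasigeodesic_near_geodesic : exists D0, forall y z,
  l' (y * z)%g = l' y + l' z -> l y + l z <= l (y * z)%g + D0.
Proof.
have [D0 D0P] := geodesic_near_quasigeodesic.
exists (2 * (lambda * (lambda * (2 * D0 + 1)) + D0)) => y z yz.
set g := (y * z)%g in yz *.
have [p [p0 py pg pd]] := geodesic_concat ln' yz.
rewrite -/g in pg pd.
have [q [q0 qn qd']] := norm_geodesic ln g.
have qd i j : i <= j -> j <= l g -> d (q i) (q j) = j - i := qd' i j.
pose P t := `[< exists c, [/\ l' y <= c, c <= l' g & d (q t) (p c) <= D0] >].
have exP : exists t, P t.
  by exists (l g); apply/asboolP; exists (l' g); rewrite pg qn distxx //; split; lia.
have [t /asboolP[c [yc cg tc]] tmin] := ex_minnP exP.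
have tg : t <= l g.
  by apply: tmin; apply/asboolP; exists (l' g); rewrite pg qn distxx //; split; lia.
have [c' [cy cc']] : exists c', c' <= l' y /\ d (p c') (p c) <= 2 * D0 + 1.
  have [t0|tpos] := posnP t.
    exists 0; split=> //; rewrite p0 -q0 -t0; lia.
  have [c' c'g tc'] := D0P g p q p0 pg pd q0 qn qd t.-1 ltac:(lia).
  exists c'; split.
    rewrite leqNgt; apply/negP => lt; have : P t.-1.
      by apply/asboolP; exists c'; split => //; lia.
    by move/tmin; lia.
  have := dist_tri ln (q t.-1) (p c') (p c); have := dist_tri ln (q t) (q t.-1) (p c).
  by rewrite (distC ln (p c') (q t.-1)) [d (q t.-1) (q t)]qd; lia.
have cl : c - l' y <= lambda * (2 * D0 + 1).
  apply: (@leq_trans (c - c')); first by lia.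
  rewrite -(pd c' c); [|lia|lia].
  by apply: leq_trans (le_l' _) _; rewrite leq_mul2l -distE cc' orbT.
have dyc : d y (p c) <= lambda * (lambda * (2 * D0 + 1)).
  apply: leq_trans (le_l _) _; rewrite leq_mul2l -distE -{1}py pd ?cl ?orbT //.
have dyt := dist_tri ln (p c) y (q t).
have Hz : l z = d y g by rewrite /g dist_mulV.
rewrite Hz -(dist1x l y).
have := dist_tri ln (q t) 1%g y; have := dist_tri ln (q t) y g.
have -> : d 1%g (q t) = t by rewrite -q0 qd //; lia.
have -> : d (q t) g = l g - t by rewrite -qn qd // qn; lia.
rewrite (distC ln (q t) y) dist1x.
rewrite (distC ln (p c)) in dyt.
by lia.
Qed.

End Morse.

(** * Extraction of subsequences; boundary points as convergent sequences *)

Definition subseq_index (phi : nat -> nat) := forall i, phi i < phi i.+1.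

Lemma subseq_index_ge phi : subseq_index phi -> forall i, i <= phi i.
Proof. by move=> inc; elim=> // i IH; apply: leq_ltn_trans IH _. Qed.

Lemma subseq_index_comp phi psi : subseq_index phi ->
  subseq_index psi -> subseq_index (phi \o psi).
Proof.
move=> ip iq i; rewrite /=.
have mono m n : m < n -> phi m < phi n.
  elim: n => // n IH; rewrite ltnS leq_eqVlt => /orP[/eqP ->|/IH mn]; first exact: ip.
  exact: ltn_trans mn (ip n).
exact: mono.
Qed.

(* The witnesses are read off a nonprincipal ultrafilter on [nat]. *)
Lemma diagonal_subsequence (I : countType) (c : I -> nat -> nat) (B : I -> nat) :
  (forall t i, c t i < B t) ->
  exists2 phi, subseq_index phi & forall t, exists N, forall i j,
    N <= i -> N <= j -> c t (phi i) = c t (phi j).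
Proof.
move=> cB; have [U [UU oU]] := ultraFilterLemma (eventually_filter : ProperFilter \oo).
have tail N : U [set i | N <= i] by apply: oU; exists N.
have col t : exists v, U [set i | c t i = v].
  suff H b : U [set i | c t i < b] -> exists v, U [set i | c t i = v].
    by apply: (H (B t)); apply: filterS (tail 0) => i _; exact: cB.
  elim: b => [|b IH] Ub.
    have : U set0 by apply: filterS Ub => i.
    by move/filter_not_empty.
  have [|Uc] := in_ultra_setVsetC [set i | c t i = b] UU; first by exists b.
  apply: IH; apply: filterS (filterI Ub Uc) => i [/= ib ic].
  by rewrite ltn_neqAle -ltnS ib andbT; apply/eqP.
have [v vP] := choice col.
have UV n : U [set i | forall t, pickle t < n -> c t i = v t].
  elim: n => [|n IH]; first by apply: filterS (tail 0).
  case E : (@unpickle I n) => [t|].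
    apply: filterS (filterI IH (vP t)) => i [/= ih ct] s.
    rewrite ltnS leq_eqVlt => /orP[/eqP sn|/ih//].
    by move: E; rewrite -sn pickleK => -[->].
  apply: filterS IH => i ih s.
  rewrite ltnS leq_eqVlt => /orP[/eqP sn|/ih//].
  by move: E; rewrite -sn pickleK.
have next n m : exists i, m < i /\ forall t, pickle t < n -> c t i = v t.
  have /filter_ex[i [/= mi ii]] : U ([set i | m < i] `&`
      [set i | forall t, pickle t < n -> c t i = v t]).
    by apply: filterI; [exact: tail | exact: UV].
  by exists i.
have [nx nxP] := choice (fun nm : nat * nat => next nm.1 nm.2).
pose fix phi n := if n is n'.+1 then nx (n, phi n') else nx (0, 0).
have phiP n t : pickle t < n -> c t (phi n) = v t.
  by case: n => // n; have [_] := nxP (n.+1, phi n); apply.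
exists phi; first by move=> n; have [] := nxP (n.+1, phi n).
move=> t; exists (pickle t).+1 => i j it jt.
by rewrite !phiP.
Qed.

Section Balls.
Variables (T : groupType) (l : T -> nat).
Hypothesis ln : word_norm l.
Local Notation d := (ndist l).

Lemma ball_seq n : exists s : seq T, uniq s /\ forall x, (x \in s) = (l x <= n).
Proof.
have /finite_seqP[s sE] := norm_ball ln n.
exists (undup s); rewrite undup_uniq; split=> // x; rewrite mem_undup.
have H : [set` s] x = (l x <= n) :> Prop by rewrite -sE.
by apply/idP/idP => hx; [rewrite -H | have := hx; rewrite -H].
Qed.

Definition nball n : seq T := sval (cid (ball_seq n)).

Lemma nball_uniq n : uniq (nball n).
Proof. by have [] := svalP (cid (ball_seq n)). Qed.

Lemma mem_nball n x : (x \in nball n) = (l x <= n).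
Proof. by have [] := svalP (cid (ball_seq n)). Qed.

Lemma geodesics : exists p : T -> nat -> T, forall x,
  [/\ p x 0 = 1%g, p x (l x) = x &
      forall i j, i <= j -> j <= l x -> d (p x i) (p x j) = j - i].
Proof. by have [p pP] := choice (norm_geodesic ln); exists p. Qed.

Lemma geodesic_point x n : n <= l x -> exists y, l y = n /\ l (y^-1 * x)%g = l x - n.
Proof.
move=> nx; have [p [p0 px pd]] := norm_geodesic ln x; exists (p n); split.
  by have := pd 0 n isT nx; rewrite p0 invg1 mul1g subn0.
by have := pd n (l x) nx (leqnn _); rewrite px.
Qed.

End Balls.

(** Twice the Gromov product at 1 of [x i] and [y j] tends to infinity. Thus [asymp x x] says that
    [x] converges to a boundary point, and for two such sequences [asymp x y] says that the limits
    agree. *)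
Definition asymp (T : groupType) (l : T -> nat) (x y : nat -> T) :=
  forall M, exists N, forall i j, N <= i -> N <= j ->
    ndist l (x i) (y j) + M <= l (x i) + l (y j).

Section Boundary.
Variables (T : groupType) (l : T -> nat) (delta : nat).
Hypotheses (ln : word_norm l) (hyp : four_point l delta).
Local Notation d := (ndist l).
Local Notation asymp := (asymp l).
Local Notation nball := (nball ln).

(** Balls are finite, so the point at distance [M] on a geodesic to [x a i] takes finitely many
    values. A diagonal subsequence makes all these points eventually constant, and elements whose
    geodesics share the point at distance [M] have Gromov product at least [M]. *)
Lemma asymp_subsequence (I : countType) (x : I -> nat -> T) :
  (forall a M, exists N, forall i, N <= i -> M <= l (x a i)) ->
  exists2 phi, subseq_index phi & forall a, asymp (x a \o phi) (x a \o phi).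
Proof.
move=> xinf; have [p pP] := geodesics ln.
pose c (am : I * nat) i := index (p (x am.1 i) (minn am.2 (l (x am.1 i)))) (nball am.2).
have [|phi phi_inc phiP] := @diagonal_subsequence _ c (fun am => (size (nball am.2)).+1).
  by move=> am i; rewrite ltnS index_size.
exists phi => // a M.
have [N1 N1P] := phiP (a, M); have [N2 N2P] := xinf a M.
exists (maxn N1 N2) => i j; rewrite !geq_max => /andP[i1 i2] /andP[j1 j2].
have li : M <= l (x a (phi i)).
  by apply/N2P/(leq_trans i2)/subseq_index_ge.
have lj : M <= l (x a (phi j)).
  by apply/N2P/(leq_trans j2)/subseq_index_ge.
have := N1P i j i1 j1; rewrite /c /= (minn_idPl li) (minn_idPl lj).
have [pi0 pie pid] := pP (x a (phi i)); have [pj0 pje pjd] := pP (x a (phi j)).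
have bi : p (x a (phi i)) M \in nball M.
  by rewrite mem_nball -dist1x -pi0 pid // subn0.
have bj : p (x a (phi j)) M \in nball M.
  by rewrite mem_nball -dist1x -pj0 pjd // subn0.
move=> ij; have pij : p (x a (phi i)) M = p (x a (phi j)) M.
  by rewrite -(nth_index 1%g bi) ij nth_index.
have := dist_tri ln (p (x a (phi i)) M) (x a (phi i)) (x a (phi j)).
have := pid M _ li (leqnn _); have := pjd M _ lj (leqnn _).
rewrite pie pje -pij (distC ln (x a (phi i)) (p _ _)) /=; lia.
Qed.

Lemma asymp_norm x M : asymp x x -> exists N, forall i, N <= i -> M <= l (x i).
Proof.
move=> xx; have [N NP] := xx (2 * M); exists N => i Ni.
by have := NP i i Ni Ni; rewrite distxx //; lia.
Qed.

Lemma asymp_sub x y phi psi : (forall i, i <= phi i) -> (forall i, i <= psi i) ->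
  asymp x y -> asymp (x \o phi) (y \o psi).
Proof.
move=> ip iq xy M; have [N NP] := xy M; exists N => i j Ni Nj.
by apply: NP; [apply: leq_trans (ip i) | apply: leq_trans (iq j)].
Qed.

Lemma asympC x y : asymp x y -> asymp y x.
Proof.
move=> xy M; have [N NP] := xy M; exists N => i j Ni Nj.
by rewrite distC // (addnC (l _)); apply: NP.
Qed.

Lemma asymp_mul g x y : asymp x y -> asymp (fun i => g * x i)%g (fun i => g * y i)%g.
Proof.
move=> xy M; have [N NP] := xy (M + 2 * l g); exists N => i j Ni Nj.
have := NP i j Ni Nj; rewrite dist_mul.
have := norm_mul ln g^-1 (g * x i); have := norm_mul ln g^-1 (g * y j).
by rewrite !mulKg norm_inv //; lia.
Qed.

Lemma asymp_trans y x z : asymp x y -> asymp y z -> asymp x z.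
Proof.
move=> xy yz M; have [N1 N1P] := xy (M + delta); have [N2 N2P] := yz (M + delta).
exists (maxn N1 N2) => i j; rewrite !geq_max => /andP[i1 i2] /andP[j1 j2].
pose k := maxn N1 N2.
have := N1P i k i1 (leq_maxl _ _); have := N2P k j (leq_maxr _ _) j2.
by have := hyp 1%g (x i) (y k) (z j); rewrite !dist1x; lia.
Qed.

(** Failure of [asymp] only yields one pair beyond each rank with small Gromov product; convergence
    of [x] and of [y] spreads the bound to all later pairs at the cost of [2 * delta]. *)
Lemma nasymp_bound x y : asymp x x -> asymp y y -> ~ asymp x y ->
  exists M N, forall i j, N <= i -> N <= j -> l (x i) + l (y j) <= d (x i) (y j) + M.
Proof.
move=> xx yy /existsNP[M /forallNP nM].
have [N1 N1P] := xx (M + 2 * delta); have [N2 N2P] := yy (M + 2 * delta).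
exists (M + 2 * delta), (maxn N1 N2) => i j.
rewrite !geq_max => /andP[i1 i2] /andP[j1 j2].
have /existsNP[i' /existsNP[j' /not_implyP[Ni' /not_implyP[Nj' /negP nij]]]] :=
  nM (maxn N1 N2).
rewrite !geq_max in Ni' Nj'; case/andP: Ni' => i1' i2'; case/andP: Nj' => j1' j2'.
have := N1P i' i i1' i1; have := N2P j j' j2 j2'; rewrite -ltnNge in nij.
have := hyp 1%g (x i') (x i) (y j'); have := hyp 1%g (x i) (y j) (y j').
by rewrite !dist1x; lia.
Qed.

End Boundary.

Definition infinite_boundary (T : groupType) (l : T -> nat) :=
  forall n, exists X : nat -> nat -> T,
    (forall a, a < n -> asymp l (X a) (X a)) /\
    (forall a b, a < n -> b < n -> a <> b -> ~ asymp l (X a) (X b)).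

Lemma uniform_bound (n : nat) (P : nat -> nat -> Prop) :
  (forall a, a < n -> exists N, P a N) ->
  (forall a N N', N <= N' -> P a N -> P a N') ->
  exists N, forall a, a < n -> P a N.
Proof.
move=> ex mono; elim: n ex => [|n IH] ex; first by exists 0.
have [N NP] := IH (fun a an => ex a (ltnW an)); have [N' N'P] := ex n (ltnSn n).
exists (maxn N N') => a; rewrite ltnS leq_eqVlt => /orP[/eqP ->|an].
  by apply: mono N'P; exact: leq_maxr.
by apply: mono (NP a an); exact: leq_maxl.
Qed.

Section Orbits.
Variables (T : groupType) (l : T -> nat) (delta : nat).
Hypotheses (ln : word_norm l) (hyp : four_point l delta).
Hypothesis infb : infinite_boundary l.
Local Notation d := (ndist l).
Local Notation asymp := (asymp l).
Local Notation nball := (nball ln).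

(** Geodesics towards [n] distinct boundary points share no point beyond a radius bounding their
    Gromov products, and each contributes one point to every larger sphere. Growth faster than any
    linear rate is what [orbit_avoids] plays against. *)
Lemma ball_growth n : exists R0, forall R, n * (R - R0) <= size (nball R).
Proof.
have [X [XX Xab]] := infb n; have [p pP] := geodesics ln.
have [M MP] : exists M, forall a, a < n -> forall b, b < n -> a <> b ->
    exists N, forall i j, N <= i -> N <= j -> l (X a i) + l (X b j) <= d (X a i) (X b j) + M.
  apply: uniform_bound => [a an|a M M' MM' H b bn ab]; last first.
    have [N NP] := H b bn ab; exists N => i j Ni Nj.
    by apply: leq_trans (NP i j Ni Nj) _; rewrite leq_add2l.
  apply: (@uniform_bound n (fun b M => a <> b -> _)) => [b bn|b M M' MM' H ab].
    case: (eqVneq a b) => [ab|/eqP ab]; first by exists 0.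
    have [M [N NP]] := nasymp_bound hyp (XX a an) (XX b bn) (Xab a b an bn ab).
    by exists M => _; exists N.
  have [N NP] := H ab; exists N => i j Ni Nj.
  by apply: leq_trans (NP i j Ni Nj) _; rewrite leq_add2l.
have [N NP] : exists N, forall a, a < n -> forall b, b < n -> a <> b ->
    forall i j, N <= i -> N <= j -> l (X a i) + l (X b j) <= d (X a i) (X b j) + M.
  apply: uniform_bound => [a an|a N N' NN' H b bn ab i j Ni Nj]; last first.
    by apply: H => //; apply: leq_trans NN' _.
  apply: (@uniform_bound n (fun b N => a <> b -> _)) => [b bn|b N N' NN' H ab i j Ni Nj].
    case: (eqVneq a b) => [ab|/eqP ab]; first by exists 0.
    by have [N NP] := MP a an b bn ab; exists N.
  by apply: H => //; apply: leq_trans NN' _.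
exists M => R.
have [m mP] : exists m, forall a, a < n -> N <= m /\ R <= l (X a m).
  have [N' N'P] : exists N', forall a, a < n -> forall i, N' <= i -> R <= l (X a i).
    apply: uniform_bound => [a an|a N1 N2 N12 H i Ni]; first exact/asymp_norm/XX.
    by apply: H; apply: leq_trans Ni.
  exists (maxn N N') => a an; rewrite leq_maxl; split=> //.
  by apply: N'P => //; exact: leq_maxr.
pose q (a t : nat) := p (X a m) t.
have qP a t : a < n -> t <= R -> l (q a t) = t /\ d (q a t) (X a m) = l (X a m) - t.
  move=> an tR; have [_ Rm] := mP a an; have tm := leq_trans tR Rm.
  have [p0 pe pd] := pP (X a m); split.
    by rewrite -dist1x -p0 /q pd ?subn0.
  by have := pd t _ tm (leqnn _); rewrite pe.
pose s := [seq q a t | a <- iota 0 n, t <- iota M.+1 (R - M)].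
have <- : size s = n * (R - M) by rewrite size_allpairs !size_iota.
apply: uniq_leq_size; last first.
  move=> x /allpairsP[[a t] /= [+ + ->]]; rewrite !mem_iota add0n mem_nball => an tM.
  by have [-> _] := qP a t ltac:(lia) ltac:(lia); lia.
apply: allpairs_uniq; rewrite ?iota_uniq // => -[a t] [b t'] /=.
move=> /allpairsP[[a1 t1] /= [+ + [-> ->]]] /allpairsP[[b1 t1'] /= [+ + [-> ->]]].
rewrite !mem_iota => an tM bn tM' E.
have [a1n b1n t1R t1R'] : [/\ a1 < n, b1 < n, t1 <= R & t1' <= R] by split; lia.
have [la da] := qP a1 t1 a1n t1R; have [lb db] := qP b1 t1' b1n t1R'.
have tt : t1 = t1' by rewrite -la -lb E.
case: (eqVneq a1 b1) => [->|/eqP ab]; first by rewrite tt.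
have [Nm Ra] := mP a1 a1n; have [_ Rb] := mP b1 b1n.
have := NP a1 a1n b1 b1n ab m m Nm Nm.
have := dist_tri ln (q a1 t1) (X a1 m) (X b1 m); rewrite {2}E (distC ln (X a1 m) (q _ _)).
by rewrite da db; lia.
Qed.

(* If [z x] and [Y] have the same limit then [z] maps the point at distance
   [t] from [1] on a geodesic to [x i] close to a geodesic from [1] to [Y i]. *)
Lemma translate_near_geodesic R t (z u x y r : T) : l z <= R -> R + delta < t ->
  l u = t -> d u x + t = l x -> d (z * x)%g y + (2 * (t + R) + delta).+1 <= l (z * x)%g + l y ->
  l r = l (z * u)%g -> d r y + l r = l y -> d (z * u)%g r <= 3 * delta.
Proof.
move=> zR Rt lu ux xy lr ry.
have zu : d z (z * u)%g = t by rewrite dist_mulV.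
have zx : d z (z * x)%g = l x by rewrite dist_mulV.
have uzx : d (z * u)%g (z * x)%g + t = l x by rewrite dist_mul.
have H1 := hyp (z * u)%g z 1%g (z * x)%g.
have H2 := hyp (z * u)%g 1%g y (z * x)%g.
have H3 := hyp (z * u)%g 1%g r y.
have H4 := dist_tri ln (z * u)%g 1%g y.
have luR := dist_tri ln z 1%g (z * u)%g.
rewrite !dist1x !distx1 // in H1 H2 H3 H4 luR.
have e1 := distC ln (z * u)%g z; have e2 := distC ln y (z * x)%g.
by lia.
Qed.

(** If every translate of the limit of [x] were among the [k] limits, each [z] in the ball of radius
    [R] would send one fixed point [u] within [3 * delta] of one of [k] geodesics, at a position
    known up to [2 * R]. As [z] is determined by [z * u], balls would grow linearly. *)
Lemma orbit_avoids k (x : nat -> T) (Y : nat -> nat -> T) : asymp x x ->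
  (forall a, a < k -> asymp (Y a) (Y a)) ->
  exists z, forall a, a < k -> ~ asymp (fun i => z * x i)%g (Y a).
Proof.
move=> xx YY; apply: contrapT => nz.
have {}nz z : exists a, a < k /\ asymp (fun i => z * x i)%g (Y a).
  apply: contrapT => na; apply: nz; exists z => a ak za; apply: na; by exists a.
have [a aP] := choice nz.
have [p pP] := geodesics ln.
pose B := size (nball (3 * delta)).
have upper R : size (nball R) <= k * (2 * R + 1) * B.
  have [t tE] : exists t, t = (R + delta).+1 by exists (R + delta).+1.
  have [N1 N1P] := asymp_norm ln t xx.
  have [N2 N2P] : exists N, forall b, b < k -> forall i, N <= i -> t + R <= l (Y b i).
    apply: uniform_bound => [b bk|b N N' NN' H i Ni]; first exact/asymp_norm/YY.
    by apply: H; apply: leq_trans Ni.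
  have [N3 N3P] : exists N, forall j, j < size (nball R) -> let z := nth 1%g (nball R) j in
      forall i, N <= i -> d (z * x i)%g (Y (a z) i) + (2 * (t + R) + delta).+1 <=
        l (z * x i)%g + l (Y (a z) i).
    apply: uniform_bound => [j js|b N N' NN' H z i Ni]; last first.
      by apply: H; apply: leq_trans Ni.
    have [_ /(_ (2 * (t + R) + delta).+1)[N NP]] := aP (nth 1%g (nball R) j).
    by exists N => z i Ni; apply: NP.
  have [m [m1 m2 m3]] : exists m, [/\ N1 <= m, N2 <= m & N3 <= m].
    by exists (maxn N1 (maxn N2 N3)); split; lia.
  have tx : t <= l (x m) := N1P m m1.
  have [u [lu ux]] := geodesic_point ln tx.
  (* The positions [l (z * u)] lie between [t - R], which is [delta + 1], and [t + R]. *)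
  pose C := [seq (b, s) | b <- iota 0 k, s <- iota delta.+1 (2 * R + 1)].
  pose F := [seq (p (Y c.1 m) c.2 * e)%g | c <- C, e <- nball (3 * delta)].
  have <- : size F = k * (2 * R + 1) * B by rewrite !size_allpairs !size_iota.
  rewrite -(size_map (fun z => z * u)%g (nball R)); apply: uniq_leq_size.
    by rewrite map_inj_uniq ?nball_uniq // => z1 z2; exact: mulIg.
  move=> _ /mapP[z0 z0R ->]; have [z [zz zR]] : exists z : T, z = z0 /\ z \in nball R by exists z0.
  rewrite -zz; have [ak _] := aP z.
  have lz : l z <= R by rewrite mem_nball in zR.
  have jz : index z (nball R) < size (nball R) by rewrite index_mem.
  have := N3P _ jz m m3; rewrite nth_index // => zxY.
  have Yl := N2P _ ak m m2.
  have luz1 := norm_mul ln z u; have luz2 := norm_mul ln z^-1%g (z * u)%g.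
  rewrite mulKg norm_inv // lu in luz2; rewrite lu in luz1.
  have [p0 pe pd] := pP (Y (a z) m).
  have zuY : l (z * u)%g <= l (Y (a z) m) by lia.
  set r := p (Y (a z) m) (l (z * u)%g).
  have lr : l r = l (z * u)%g by rewrite -dist1x -p0 pd // subn0.
  have ry : d r (Y (a z) m) + l r = l (Y (a z) m).
    have := pd _ _ zuY (leqnn _); rewrite pe lr => ->; lia.
  have := @translate_near_geodesic R t z u (x m) (Y (a z) m) r lz ltac:(lia) lu.
  rewrite [d u (x m)]ux (subnK tx) => /(_ erefl zxY lr ry) ur.
  apply/allpairsP; exists ((a z, l (z * u)%g), (r^-1 * (z * u))%g); split=> /=.
  - apply/allpairsP; exists (a z, l (z * u)%g); split=> //=; rewrite mem_iota; lia.
  - by rewrite mem_nball -distE distC.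
  - by rewrite mulVKg.
have [R0 R0P] := ball_growth (2 * k * B).+1.
pose R := (2 * k * B).+1 * R0 + (k * B).+1.
have := leq_trans (R0P R) (upper R); rewrite mulnBr leq_subLR.
suff : (2 * k * B).+1 * R0 + k * (2 * R + 1) * B < (2 * k * B).+1 * R by lia.
have -> : k * (2 * R + 1) * B = 2 * k * B * R + k * B by lia.
by rewrite (mulSn _ R) {2}/R; lia.
Qed.

End Orbits.

(** * Free semigroups in hyperbolic groups *)

Section FreeSemigroup.
Variables (T : groupType) (l : T -> nat) (delta : nat).
Hypotheses (ln : word_norm l) (hyp : four_point l delta).
Local Notation d := (ndist l).

(* [l b + l b' - l (b * b')] is twice the Gromov product of [b^-1] and [b'];
   the last condition says that no element of [A] is nearly a prefix of another. *)
Definition free_basis (A : set T) (D : nat) :=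
  [/\ forall b, A b -> D + delta < l b,
      forall b b', A b -> A b' -> l b + l b' <= l (b * b')%g + D &
      forall b b', A b -> A b' -> b <> b' ->
        l b' + D + 2 * delta < l b + d b b'].

Variables (A : set T) (D : nat).
Hypothesis bas : free_basis A D.

Lemma free_basis_product (s : seq T) b : (forall x, x \in s -> A x) -> A b ->
  l b + l (\prod_(x <- s) x)%g <= l (b * \prod_(x <- s) x)%g + (D + delta).
Proof.
have [Al Ad _] := bas; elim: s b => [|b2 s IH] b As Ab.
  by rewrite big_nil mulg1 norm_one //; lia.
have A2 : A b2 by apply: As; exact: mem_head.
have := IH b2 (fun x xs => As x (@mem_behead _ (b2 :: s) x xs)) A2.
rewrite big_cons; set v' := (\prod_(x <- s) x)%g; set v := (b2 * v')%g => H.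
have := hyp 1%g b^-1%g v b2; rewrite !dist1x norm_inv //.
have -> : d b^-1%g b2 = l (b * b2)%g by rewrite /ndist invgK.
have -> : d b^-1%g v = l (b * v)%g by rewrite /ndist invgK.
have -> : d v b2 = l v' by rewrite distC // /v dist_mulV.
by have := Al _ A2; have := Ad _ _ Ab A2; lia.
Qed.

(** The first letter can be read off: two distinct letters beginning the same product would both be
    nearly prefixes of it, hence one would be nearly a prefix of the other. *)
Lemma free_basis_inj (s t : seq T) : (forall x, x \in s -> A x) ->
  (forall x, x \in t -> A x) ->
  (\prod_(x <- s) x)%g = (\prod_(x <- t) x)%g -> s = t.
Proof.
have [Al Ad Ap] := bas.
have ne b u : (forall x, x \in b :: u -> A x) -> (\prod_(x <- b :: u) x)%g <> 1%g.
  move=> Au u1; have Ab : A b by apply: Au; exact: mem_head.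
  have := free_basis_product (fun x xs => Au x (@mem_behead _ (b :: u) x xs)) Ab.
  by rewrite big_cons in u1; rewrite u1 norm_one //; have := Al _ Ab; lia.
elim: s t => [|b s IH] [|b' t] As At //.
- by rewrite big_nil => /esym /ne.
- by rewrite big_nil => /ne.
rewrite !big_cons => E.
have Ab : A b by apply: As; exact: mem_head.
have Ab' : A b' by apply: At; exact: mem_head.
have {}As x : x \in s -> A x by move=> xs; apply: As; rewrite inE xs orbT.
have {}At x : x \in t -> A x by move=> xs; apply: At; rewrite inE xs orbT.
have bb : b = b'.
  apply: contrapT => bb.
  have := free_basis_product As Ab; have := free_basis_product At Ab'.
  move: E; set v := (\prod_(x <- s) x)%g; set v' := (\prod_(x <- t) x)%g => E.
  have := hyp 1%g b (b * v)%g b'; rewrite !dist1x dist_mulV.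
  have -> : d (b * v)%g b' = l v' by rewrite E distC // dist_mulV.
  have := Ap _ _ Ab Ab' bb; have := Ap _ _ Ab' Ab (nesym bb).
  by rewrite (distC ln b' b) -E; lia.
by congr (_ :: _) => //; apply: IH => //; apply: (mulgI b); rewrite E bb.
Qed.

End FreeSemigroup.

(** * Long elements in general position: ping-pong pairs and cosets of a quasiconvex subgroup *)

Section Elements.
Variables (T : groupType) (l : T -> nat) (delta : nat).
Hypotheses (ln : word_norm l) (hyp : four_point l delta).
Hypothesis infb : infinite_boundary l.
Local Notation d := (ndist l).
Local Notation asymp := (asymp l).

Lemma asymp_mulr x g : asymp x x -> asymp x (fun i => x i * g)%g.
Proof.
move=> xx M; have [N NP] := xx (M + 2 * l g); exists N => i j Ni Nj.
have := NP i j Ni Nj; have := dist_tri ln (x j) (x i) (x j * g)%g.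
have := norm_mul ln (x j * g)%g g^-1%g; rewrite mulgK norm_inv //.
by rewrite dist_mulV; lia.
Qed.

Lemma asymp_mulrr x g : asymp x x -> asymp (fun i => x i * g)%g (fun i => x i * g)%g.
Proof.
move=> xx; apply: (asymp_trans hyp (y := x)); last exact: asymp_mulr.
by apply: asympC => //; exact: asymp_mulr.
Qed.

(** The elements [b a i] converge to two distinct boundary points, and the correction by [(q a)^-1]
    moves the limits of their inverses off both. All products then have bounded cancellation. [M]
    precedes [L], so the lengths can be made large compared with the cancellation. *)
Lemma free_pair : exists M, forall L, exists b c, [/\ L <= l b, L <= l c,
  l b + l c <= d b c + M &
  forall x y, x = b \/ x = c -> y = b \/ y = c -> l x + l y <= l (x * y)%g + M].
Proof.
have [X0 [XX0 Xab0]] := infb 2.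
have Xinf (eps : bool) a M : exists N, forall i, N <= i ->
    M <= l (if eps then X0 (a : 'I_2) i else (X0 (a : 'I_2) i)^-1%g).
  have [N NP] := asymp_norm ln M (XX0 a (ltn_ord a)); exists N => i /NP.
  by case: eps => //; rewrite norm_inv.
have [phi iphi phiP] := @asymp_subsequence _ _ ln (bool * 'I_2)%type
  (fun ea i => if ea.1 then X0 ea.2 i else (X0 ea.2 i)^-1%g)
  (fun ea M => Xinf ea.1 ea.2 M).
pose X a i := X0 a (phi i).
have XX a : a < 2 -> asymp (X a) (X a) by move=> a2; exact: (phiP (true, Ordinal a2)).
have XV a : a < 2 -> asymp (fun i => (X a i)^-1)%g (fun i => (X a i)^-1)%g.
  by move=> a2; exact: (phiP (false, Ordinal a2)).
have X01 : ~ asymp (X 0) (X 1).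
  move=> X01; apply: (@Xab0 0 1) => //.
  have sub a : a < 2 -> asymp (X0 a) (X a).
    move=> a2; apply: (@asymp_sub _ _ (X0 a) (X0 a) id phi) => //; last exact: XX0.
    exact: subseq_index_ge.
  apply: (asymp_trans hyp) (sub 0 isT) _; apply: (asymp_trans hyp) X01 _.
  by apply: asympC => //; exact: sub.
have qex a : a < 2 -> exists q, forall b, b < 2 ->
    ~ asymp (fun i => q * (X a i)^-1)%g (X b).
  by move=> a2; exact: (orbit_avoids ln hyp infb (XV a a2) XX).
have [q0 q0P] := qex 0 isT; have [q1 q1P] := qex 1 isT.
pose q a := if a == 0 then q0 else q1.
pose b a i : T := (X a i * (q a)^-1)%g.
have qP a c : a < 2 -> c < 2 -> ~ asymp (fun i => q a * (X a i)^-1)%g (X c).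
  by case: a => [|[|]] // _; [exact: q0P | exact: q1P].
have bX a : a < 2 -> asymp (X a) (b a) by move=> a2; apply/asymp_mulr/XX.
have bb a : a < 2 -> asymp (b a) (b a) by move=> a2; apply/asymp_mulrr/XX.
have bV a : a < 2 -> asymp (fun i => (b a i)^-1)%g (fun i => (b a i)^-1)%g.
  move=> a2; rewrite /b; under eq_fun do rewrite invgM invgK.
  exact/asymp_mul/XV.
have nbV a c : a < 2 -> c < 2 -> ~ asymp (fun i => (b a i)^-1)%g (b c).
  move=> a2 c2; rewrite {1}/b; under [X in asymp X _]eq_fun do rewrite invgM invgK.
  move=> H; apply: (qP a c a2 c2); apply: (asymp_trans hyp) H _.
  by apply: asympC => //; exact: bX.
have nb : ~ asymp (b 0) (b 1).
  move=> H; apply: X01; apply: (asymp_trans hyp) (bX 0 isT) _.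
  by apply: (asymp_trans hyp) H _; apply: asympC => //; exact: bX.

have bd a c : a < 2 -> c < 2 -> exists M N, forall i j, N <= i -> N <= j ->
    l (b a i)^-1%g + l (b c j) <= d (b a i)^-1%g (b c j) + M.
  by move=> a2 c2; apply: (nasymp_bound hyp (bV a a2) (bb c c2)); exact: nbV.
have [M1 [N1 P1]] := bd 0 0 isT isT; have [M2 [N2 P2]] := bd 0 1 isT isT.
have [M3 [N3 P3]] := bd 1 0 isT isT; have [M4 [N4 P4]] := bd 1 1 isT isT.
have [M5 [N5 P5]] := nasymp_bound hyp (bb 0 isT) (bb 1 isT) nb.
exists (M1 + M2 + M3 + M4 + M5) => L.
have [N6 P6] := asymp_norm ln L (bb 0 isT); have [N7 P7] := asymp_norm ln L (bb 1 isT).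
have [N NE] : exists N, N = N1 + N2 + N3 + N4 + N5 + N6 + N7 by eexists.
exists (b 0 N), (b 1 N); split; [apply: P6; lia | apply: P7; lia | |].
  by have := P5 N N ltac:(lia) ltac:(lia); lia.
have dE (x y : T) : d x^-1%g y = l (x * y)%g by rewrite /ndist invgK.
move=> x y [->|->] [->|->].
- by have := P1 N N ltac:(lia) ltac:(lia); rewrite dE norm_inv //; lia.
- by have := P2 N N ltac:(lia) ltac:(lia); rewrite dE norm_inv //; lia.
- by have := P3 N N ltac:(lia) ltac:(lia); rewrite dE norm_inv //; lia.
- by have := P4 N N ltac:(lia) ltac:(lia); rewrite dE norm_inv //; lia.
Qed.

Lemma free_pair_basis : exists b c D, b <> c /\
  free_basis l delta (fun x => x = b \/ x = c) D.
Proof.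
have [M MP] := free_pair; have [b [c [bL cL bc pr]]] := MP (2 * (M + delta).+1).
exists b, c, M; split.
  by move=> E; move: bc; rewrite E distxx //; lia.
split=> [x [->|->]|x y|x y]; [lia|lia|exact: pr|].
by move=> [->|->] [->|->] // _; rewrite ?(distC ln c b); lia.
Qed.

Variables (G : set T) (K : nat).
Hypotheses (sG : is_subgroup G) (iiG : infinite_index G setT).
Hypothesis qcG : forall g w, G g -> l w + l (w^-1 * g)%g = l g ->
  exists2 h, G h & d w h <= K.

(** If the Gromov product of [g] and [x] exceeded [K + delta + 1], the point at that distance on a
    geodesic to [g] would be close to some [h] in [G], and [h^-1 * x] would be shorter than [x]. *)
Lemma shortest_projection x g : (forall h, G h -> l x <= l (h * x)%g) -> G g ->
  l g + l x <= l (g^-1 * x)%g + 2 * (K + delta).+1.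
Proof.
move=> xmin Gg; have [G1 GM GV] := sG; rewrite leqNgt; apply/negP => big.
pose t := (K + delta).+1.
have gx : l x <= l g + l (g^-1 * x)%g by have := norm_mul ln g (g^-1 * x)%g; rewrite mulVKg.
have xg := xmin _ (GV _ Gg).
have tg : t <= l g by rewrite /t; lia.
have [w [lw wg]] := geodesic_point ln tg.
have lwg : l w + l (w^-1 * g)%g = l g by rewrite lw wg subnKC.
have [h Gh wh] := qcG Gg lwg.
have := hyp 1%g w g x; rewrite !dist1x lw.
have -> : d w g = l g - t by [].
have -> : d g x = l (g^-1 * x)%g by [].
have := xmin _ (GV _ Gh); have := dist_tri ln w h x; rewrite (distC ln h w).
rewrite -/(ndist l h x) /t in tg *.
by lia.
Qed.

(** Otherwise each coset [G * y^-1] has a shortest element of length at most [L]; after inversion, a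
    ball meets every coset [y * G], and the index is finite. *)
Lemma long_shortest L : exists2 x, L <= l x & forall h, G h -> l x <= l (h * x)%g.
Proof.
have [G1 GM GV] := sG; apply: contrapT => nx; apply: iiG.
apply: (@sub_finite_set _ _ ((fun y => [set (y * h)%g | h in G]) @` [set y | l y <= L])).
  move=> _ [y _ <-]; pose P n := `[< exists2 g, G g & l (g * y^-1)%g = n >].
  have exP : exists n, P n by exists (l y); apply/asboolP; exists 1%g; rewrite // mul1g norm_inv.
  have [n /asboolP[g Gg gn] nmin] := ex_minnP exP.
  exists (y * g^-1)%g => /=.
    rewrite -(norm_inv ln) invgM invgK leqNgt; apply/negP => Lg; apply: nx.
    exists (g * y^-1)%g; first exact: ltnW.
    move=> h Gh; rewrite gn; apply: nmin; apply/asboolP; exists (h * g)%g; first exact: GM.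
    by rewrite mulgA.
  apply/seteqP; split=> z [h Gh <-].
    by exists (g^-1 * h)%g; [apply: GM => //; exact: GV | rewrite mulgA].
  by exists (g * h)%g; [exact: GM | rewrite mulgA mulgVK].
exact/finite_image/(norm_ball ln).
Qed.

(** The element is [a = y * z * y^-1], with [y] long and shortest in [G * y], and [z] moving the
    limit of the elements [y^-1] off itself so that the product is nearly reduced. Then [a] and
    [a^-1] both start along [y], and [shortest_projection] bounds their cancellation against [G],
    uniformly in [L]. *)
Lemma avoiding_element : exists C, forall L, exists a : T, [/\ L <= l a,
  forall g : T, G g -> l g + l a <= l (g * a)%g + C &
  forall g : T, G g -> l g + l a <= l (a * g)%g + C].
Proof.
have [G1 GM GV] := sG.
have [x0 x0P] := choice (fun L => let: ex_intro2 x xL xm := long_shortest L in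
  ex_intro (fun x => L <= l x /\ forall h, G h -> l x <= l (h * x)%g) x (conj xL xm)).
have xinf (a : unit) M : exists N, forall i, N <= i -> M <= l (x0 i)^-1%g.
  exists M => i Mi; rewrite norm_inv //; apply: leq_trans Mi _; by case: (x0P i).
have [phi iphi /(_ tt) xx] := asymp_subsequence ln xinf.
pose x i : T := x0 (phi i).
have {xx} xx : asymp (fun i => (x i)^-1)%g (fun i => (x i)^-1)%g by [].
have [z zP] := orbit_avoids (k := 1) ln hyp infb xx (Y := fun _ i => (x i)^-1%g) (fun _ _ => xx).
have {zP} zP := zP 0 isT.
have [M [N NP]] := nasymp_bound hyp (asymp_mul ln z xx) xx zP.
pose C0 := 2 * (K + delta).+1.
exists (C0 + delta) => L.
(* Long enough for the Gromov products of [y] with [a] and [a^-1] to dominate [C0 + delta], and for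
   [l a] to reach [L]. *)
pose P := M + C0 + delta + 2 * l z + L.
have [N' N'P] := asymp_norm ln P xx.
have [i [Ni Ni']] : exists i, N <= i /\ N' <= i by exists (maxn N N'); lia.
have xP : P < (l (x i)).+1 by rewrite -(norm_inv ln (x i)); have := N'P i Ni'; lia.
have xG g : G g -> l g + l (x i) <= l (g^-1 * x i)%g + C0.
  by apply: shortest_projection; case: (x0P (phi i)).
have := NP i i Ni Ni; rewrite {NP}.
set y := x i in xP xG *.
have lzy : l (z * y^-1)%g <= l z + l y by have := norm_mul ln z y^-1%g; rewrite norm_inv.
have lzy' : l y <= l z + l (z * y^-1)%g.
  by have := norm_mul ln z^-1%g (z * y^-1)%g; rewrite mulKg !norm_inv.
have -> : d (z * y^-1)%g y^-1%g = l (y * z * y^-1)%g.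
  by rewrite distC // /ndist invgK mulgA.
rewrite norm_inv //; set a := (y * z * y^-1)%g => ya.
have ay : l (y^-1 * a)%g = l (z * y^-1)%g by rewrite /a -mulgA mulKg.
have ya' : l (a * y)%g = l (y * z)%g by rewrite /a mulgVK.
have aVy : l (y^-1 * a^-1)%g = l (z^-1 * y^-1)%g by rewrite /a !invgM invgK mulKg.
have lzy2 : l (z^-1 * y^-1)%g = l (y * z)%g by rewrite -invgM norm_inv.
have lyz : l (y * z)%g <= l y + l z by exact: norm_mul.
have core (a' g : T) : G g -> l a' = l a -> l (y^-1 * a')%g <= l y + l z ->
    l g + l a' <= l (g^-1 * a')%g + (C0 + delta).
  move=> Gg la yza; have := hyp 1%g g a' y; rewrite !dist1x.
  have := xG _ Gg; rewrite (distC ln a' y) -(distE l g y) -(distE l g a') /P in xP *.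
  rewrite -(distE l y a') in yza.
  by lia.
exists a; split.
- by rewrite /P in xP; lia.
- by move=> g Gg; have := core a _ (GV _ Gg) erefl; rewrite ay invgK norm_inv // (addnC (l y)); apply.
move=> g Gg; have := core a^-1%g _ Gg (norm_inv ln a); rewrite aVy lzy2 => /(_ lyz).
by rewrite -invgM !norm_inv.
Qed.

(** The element [a] is taken much longer than all cancellations, so it shields consecutive elements
    of [G] from each other. For distinct [g], [h] in [G'] the quotient [g^-1 * h] is a long element
    of [G], against which [a] barely cancels; this separates [g * a] from [h * a]. *)
Lemma coset_free_basis : exists a D L, forall G' : set T, G' `<=` G ->
  (forall g, G' g -> L <= l g) ->
  (forall g h, G' g -> G' h -> g <> h -> L <= d g h) ->
  free_basis l delta [set (g * a)%g | g in G'] D.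
Proof.
have [G1 GM GV] := sG.
have [C CP] := avoiding_element.
pose D := C + 2 * delta; pose E := D + 2 * delta.
have [a [aL aG aG']] := CP (2 * (C + D + E + delta).+1).
exists a, D, (C + delta).+1 => G' G'G G'L G'sep.
have lga g : G g -> l g <= l (g * a)%g + l a.
  by move=> _; have := norm_mul ln (g * a)%g a^-1%g; rewrite mulgK norm_inv.
have key0 (g : T) : G' g -> D + delta < l (g * a)%g.
  by move=> /G'G Gg; have := aG g Gg; have := norm_mul ln g a; lia.
have key1 (g h : T) : G' g -> G' h ->
    l (g * a)%g + l (h * a)%g <= l (g * a * (h * a))%g + D.
  move=> G'g G'h; have Gg := G'G _ G'g; have Gh := G'G _ G'h.
  have H1 := hyp 1%g a^-1%g (h * a)%g h.
  have H2 := hyp 1%g a^-1%g (g * a)^-1%g (h * a)%g.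
  move: H1 H2; rewrite !dist1x !(norm_inv ln) (distC ln (h * a)%g) dist_mulV.
  have -> : d a^-1%g h = l (a * h)%g by rewrite /ndist invgK.
  have -> : d a^-1%g (h * a)%g = l (a * h * a)%g by rewrite /ndist invgK mulgA.
  have -> : d (g * a)^-1%g (h * a)%g = l (g * a * (h * a))%g by rewrite /ndist invgK.
  have -> : d a^-1%g (g * a)^-1%g = l g by rewrite distC // /ndist invgK mulgK.
  have := aG _ Gg; have := aG _ Gh; have := aG' _ Gh; have := G'L _ G'h.
  by rewrite /E /D in aL *; lia.
have key2 (g h : T) : G' g -> G' h -> g <> h ->
    l (h * a)%g + D + 2 * delta < l (g * a)%g + d (g * a)%g (h * a)%g.
  move=> G'g G'h gh; have Gg := G'G _ G'g; have Gh := G'G _ G'h.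
  have [u uE] : exists u : T, u = (g^-1 * h)%g by eexists.
  have Gu : G u by rewrite uE; apply: GM => //; exact: GV.
  have lu : C + delta < l u by rewrite uE; exact: G'sep.
  have H1 := hyp a g^-1%g 1%g (u * a)%g.
  have H2 := hyp 1%g a (u * a)%g u.
  move: H1 H2; rewrite !dist1x !distx1 // (norm_inv ln g).
  have -> : d a g^-1%g = l (g * a)%g by rewrite distC // /ndist invgK.
  have -> : d g^-1%g (u * a)%g = l (h * a)%g by rewrite /ndist invgK uE mulgA mulVKg.
  have aGu : l u + l a <= d a u + C.
    by rewrite -(norm_inv ln u) (distC ln a); exact: (aG _ (GV _ Gu)).
  have -> : d (u * a)%g u = l a by rewrite distC // dist_mulV.
  have -> : d (g * a)%g (h * a)%g = d a (u * a)%g.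
    by rewrite -(dist_mul l g a) uE mulgA mulVKg.
  have := aG _ Gu; have := aG _ Gg.
  by rewrite /E /D in aL *; lia.
split.
- by move=> _ [g G'g <-]; exact: key0.
- by move=> _ _ [g G'g <-] [h G'h <-]; exact: key1.
move=> _ _ [g G'g <-] [h G'h <-] gh; apply: key2 => // ghE.
by apply: gh; rewrite ghE.
Qed.

End Elements.

(** * Subgroups and the Gromov boundary *)

Section SubgroupType.
Variables (gT : groupType) (H : set gT).

(** The proof [sH] is a parameter so that the group structure belongs to the type itself, and the
    preceding theory, stated for a whole group, applies to a subgroup. *)
Definition subgroup_of (sH : is_subgroup H) := {x : gT | `[< H x >]}.

Variable sH : is_subgroup H.
Local Notation T := (subgroup_of sH).

HB.instance Definition _ := Choice.on T.

Definition to_sub (x : gT) (Hx : H x) : T := exist _ x (asboolT Hx).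

Lemma in_subgroup (x : T) : H (sval x).
Proof. exact/asboolP/(svalP x). Qed.

Definition sub_mul (x y : T) : T :=
  to_sub (let: And3 _ M _ := sH in M _ _ (in_subgroup x) (in_subgroup y)).
Definition sub_one : T := to_sub (let: And3 H1 _ _ := sH in H1).
Definition sub_inv (x : T) : T := to_sub (let: And3 _ _ V := sH in V _ (in_subgroup x)).

Fact sub_mulA : associative sub_mul.
Proof. by move=> x y z; apply: val_inj; rewrite /= mulgA. Qed.
Fact sub_mul1 : left_id sub_one sub_mul.
Proof. by move=> x; apply: val_inj; rewrite /= mul1g. Qed.
Fact sub_mulr1 : right_id sub_one sub_mul.
Proof. by move=> x; apply: val_inj; rewrite /= mulg1. Qed.
Fact sub_mulV : left_inverse sub_one sub_inv sub_mul.
Proof. by move=> x; apply: val_inj; rewrite /= mulVg. Qed.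
Fact sub_mulrV : right_inverse sub_one sub_inv sub_mul.
Proof. by move=> x; apply: val_inj; rewrite /= mulgV. Qed.

HB.instance Definition _ := isGroup.Build T
  sub_mulA sub_mul1 sub_mulr1 sub_mulV sub_mulrV.

Lemma svalM (x y : T) : sval (x * y)%g = (sval x * sval y)%g. Proof. by []. Qed.
Lemma svalV (x : T) : sval (x^-1)%g = (sval x)^-1%g. Proof. by []. Qed.
Lemma sval1 : sval (1%g : T) = 1%g. Proof. by []. Qed.

End SubgroupType.

Section WordNorm.
Variables (gT : groupType) (H : set gT) (sH : is_subgroup H) (S : set gT).
Hypothesis gen : finite_generating_set S H.
Local Notation T := (subgroup_of sH).

Definition sub_length (x : T) : nat := word_length S (sval x).

Lemma sub_generated (x : T) : generated S (sval x).
Proof. by have [_ ->] := gen; exact: in_subgroup. Qed.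

Lemma word_distE (x y : T) : word_dist S (sval x) (sval y) = ndist sub_length x y.
Proof. by []. Qed.

Lemma generator_mem s : S s \/ S (s^-1)%g -> H s.
Proof.
have [_ <-] := gen => Ss; exists [:: s]; last by rewrite big_seq1.
by move=> x; rewrite inE => /eqP ->.
Qed.

Lemma word_length_le (s : seq gT) : is_word S s ->
  word_length S (\prod_(x <- s) x)%g <= size s.
Proof.
move=> Ss; have [_] := word_lengthP (ex_intro2 _ _ s Ss erefl).
exact.
Qed.

Lemma sub_length_inv (x : T) : sub_length (x^-1)%g = sub_length x.
Proof.
have le (y : T) : sub_length (y^-1)%g <= sub_length y.
  have [[s [Ss sz sy]] _] := word_lengthP (sub_generated y).
  rewrite {2}/sub_length -sz -(size_rev s) -(size_map (fun x => x^-1)%g).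
  rewrite /sub_length svalV -sy -prod_rev; apply: word_length_le.
  exact: is_word_rev.
by apply/eqP; rewrite eqn_leq le -{1}(invgK x) le.
Qed.

Lemma sub_word_norm : word_norm sub_length.
Proof.
split.
- by apply/eqP; rewrite -leqn0; have := @word_length_le [::]; rewrite big_nil; apply.
- exact: sub_length_inv.
- by move=> x y; apply: word_lengthM; exact: sub_generated.
- have [finS genS] := gen.
  pose B n := [set g | generated S g /\ word_length S g <= n].
  have finB n : finite_set (B n).
    elim: n => [|n IH].
      apply: (@sub_finite_set _ _ [set 1%g]) => // g [gg].
      rewrite leqn0 => /eqP g0; have [[s [_ sz <-]] _] := word_lengthP gg.
      by rewrite g0 in sz; rewrite (size0nil sz) big_nil.
    pose S' := S `|` (fun x => x^-1)%g @` S.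
    have finS' : finite_set S' by rewrite finite_setU; split=> //; exact: finite_image.
    apply: (@sub_finite_set _ _ (B n `|` [set (x.1 * x.2)%g | x in S' `*` B n])).
      move=> g [gg gn]; have [[s [Ss sz sg]] smin] := word_lengthP gg.
      case: s Ss sz sg => [|a s] Ss sz sg.
        by left; split=> //; rewrite -sz.
      right; exists (a, (\prod_(x <- s) x)%g); last by rewrite -sg big_cons.
      have Ss' : is_word S s by move=> x xs; apply: Ss; rewrite inE xs orbT.
      split=> /=.
        by case: (Ss a (mem_head _ _)) => Sa; [left | right; exists a^-1%g; rewrite ?invgK].
      split; first by exists s.
      by apply: leq_trans (word_length_le Ss') _; rewrite -ltnS (leq_trans _ gn) // -sz.
    rewrite finite_setU; split=> //; apply: finite_image.
    exact: finite_setX.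
  move=> n; apply: (@sub_finite_set _ _ (sval @^-1` B n)).
    by move=> x xn; split=> //; exact: sub_generated.
  by apply: finite_preimage (finB n) => x y _ _; exact: val_inj.
move=> x; have [[s [Ss sz sx]] smin] := word_lengthP (sub_generated x).
have subw (r : seq gT) : {subset r <= s} -> is_word S r by move=> rs y /rs; exact: Ss.
have takeH i : H (\prod_(y <- take i s) y)%g.
  by have [_ <-] := gen; exists (take i s) => //; apply: subw => y; exact: mem_take.
exists (fun i => to_sub sH (takeH i)); split.
- by apply: val_inj; rewrite /= take0 big_nil.
- by apply: val_inj; rewrite /= /sub_length -sz take_size.
move=> i j ij; rewrite /sub_length -sz => js.
rewrite svalM svalV /=.
have tj : take j s = take i s ++ drop i (take j s).
  by rewrite -{1}(cat_take_drop i (take j s)) take_takel.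
set r := drop i (take j s) in tj.
have rs : {subset r <= s} by move=> y /mem_drop/mem_take.
rewrite tj big_cat /= mulKg; apply/eqP; rewrite eqn_leq.
have szr : size r = j - i by rewrite size_drop size_take_min (minn_idPl js).
rewrite -{1}szr word_length_le; last exact: subw.
(* A word for the infix [r] shorter than [r] would shorten the minimal word [s]. *)
have [t [St szt tr]] := (word_lengthP (ex_intro2 _ _ r (subw _ rs) erefl)).1.
have w : is_word S (take i s ++ t ++ drop j s).
  apply: is_word_cat; first by apply: subw => y; exact: mem_take.
  by apply: is_word_cat => //; apply: subw => y; exact: mem_drop.
have := smin _ w; rewrite -sz !size_cat size_take_min size_drop szt.
rewrite (minn_idPl (leq_trans ij js)) !big_cat /= tr => h.
have {}h := h _.
have E : (\prod_(y <- take i s) y *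
    (\prod_(y <- r) y * \prod_(y <- drop j s) y))%g = sval x.
  by rewrite mulgA -big_cat -tj -big_cat cat_take_drop.
have {}h := h E; rewrite -szt in h.
have : j - i <= size t by lia.
by rewrite szt.
Qed.

Lemma gromov_four_point : gromov_hyperbolic S -> exists delta, four_point sub_length delta.
Proof.
(* Doubling clears the halves in [gromov_product]; rounding up moves the constant to [nat]. *)
move=> [e eP]; exists (Num.bound (2%:R * `|e|)%R) => w x y z.
have gx (u : T) := sub_generated u.
have := eP _ _ _ _ (gx w) (gx x) (gx y) (gx z).
have := archi_boundP (mulr_ge0 (ler0n rat 2) (normr_ge0 e)).
have arith (a c p q s r B : rat) : (2%:R * `|e| < B ->
    (a + c - p) / 2%:R <= (q + s - r) / 2%:R + e -> r + a + c <= p + q + s + B)%R.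
  by have := ler_norm e; clear; move: `|e|%R => E; lra.
rewrite /gromov_product !word_distE -!(ler_nat rat) !natrD => be.
rewrite lerBlDr ge_min => /orP[h|h]; [left | right].
  by have {}h := arith _ _ _ _ _ _ _ be h; clear -h; lra.
by have {}h := arith _ _ _ _ _ _ _ be h; clear -h; lra.
Qed.

Lemma asymp_product_diverges (x y : nat -> T) :
  asymp sub_length x y <-> product_diverges S (sval \o x) (sval \o y).
Proof.
have ln := sub_word_norm.
have E (u v : T) (M : nat) : (M%:R <= gromov_product S 1%g (sval u) (sval v))%R =
    (ndist sub_length u v + 2 * M <= sub_length u + sub_length v).
  rewrite /gromov_product -(sval1 sH) !word_distE !dist1x // ler_pdivlMr //.
  by rewrite lerBrDr -!(natrM, natrD) ler_nat mulnC addnC.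
split=> xy M.
  have [N NP] := xy (2 * M); exists N => i j Ni Nj; rewrite /= E; exact: NP.
have [N NP] := xy M; exists N => i j Ni Nj; have := NP i j Ni Nj.
by rewrite /= E; lia.
Qed.

End WordNorm.

Lemma sub_length_lipschitz (gT : groupType) (H : set gT) (sH : is_subgroup H)
    (S S' : set gT) : finite_generating_set S H -> finite_generating_set S' H ->
  exists lam, forall x : subgroup_of sH, sub_length S x <= lam * sub_length S' x.
Proof.
move=> gen gen'; have [finS' _] := gen'; have ln := sub_word_norm sH gen.
have [/finite_seqP[r rE]] := (finS', I).
exists (\max_(y <- r) word_length S y) => x.
rewrite /sub_length; have [[s [Ss <- <-]] _] := word_lengthP (sub_generated gen' x).
move: (\max_(y <- r) _) (fun y (yr : y \in r) =>
  @leq_bigmax_seq _ r xpredT (word_length S) y yr isT) => lam lamP {x}.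
elim: s Ss => [|a s IH] Ss.
  by rewrite big_nil /= muln0; have := norm_one ln; rewrite /sub_length sval1 => ->.
have Ss' : is_word S' s by move=> y ys; apply: Ss; rewrite inE ys orbT.
have Ha : H a by apply: (generator_mem gen'); apply: Ss; exact: mem_head.
have Hs : H (\prod_(y <- s) y)%g by have [_ <-] := gen'; exists s.
have gS y : H y -> generated S y by have [_ ->] := gen.
rewrite big_cons /= mulnS; apply: leq_trans (word_lengthM (gS _ Ha) (gS _ Hs)) _.
apply: leq_add; last exact: IH.
case: (Ss a (mem_head _ _)) => Sa.
  by apply: lamP; have : [set` r] a by rewrite -rE.
have := norm_inv ln (to_sub sH Ha); rewrite /sub_length svalV /= => <-.
by apply: lamP; have : [set` r] a^-1%g by rewrite -rE.
Qed.

(** * Boundary points through representing sequences, and the action on them *)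

Section BoundaryPoints.
Variables (gT : groupType) (H : set gT) (sH : is_subgroup H) (S : set gT) (delta : nat).
Hypothesis gen : finite_generating_set S H.
Local Notation T := (subgroup_of sH).
Local Notation l := (@sub_length gT H sH S).
Hypothesis hyp : four_point l delta.
Let ln : word_norm l := sub_word_norm sH gen.
Local Notation asymp := (asymp l).
Local Notation apd := (@asymp_product_diverges gT H sH S gen).

Definition represents (p : gromov_boundary S) (x : nat -> T) :=
  asymp x x /\ boundary_seqs p (sval \o x).

Lemma converges_asymp (x : nat -> T) : converges_at_infinity S (sval \o x) <-> asymp x x.
Proof.
split=> [[_ xx]|xx]; first exact/apd.
by split; [move=> i; exact: sub_generated | exact/apd].
Qed.

Lemma lift_seq (u : nat -> gT) : (forall i, generated S (u i)) ->
  exists x : nat -> T, u = sval \o x.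
Proof.
move=> uS; have uH i : H (u i) by have [_ <-] := gen.
by exists (fun i => to_sub sH (uH i)).
Qed.

Lemma point_class (p : gromov_boundary S) : exists2 z : nat -> T, asymp z z &
  boundary_seqs p = boundary_class S (sval \o z).
Proof.
have /asboolP[u uC ->] := boundary_seqsP p; have [uS _] := uC.
have [z zE] := lift_seq uS; exists z; last by rewrite zE.
by apply/converges_asymp; rewrite -zE.
Qed.

Lemma represented (p : gromov_boundary S) : exists x, represents p x.
Proof.
have [z zz pE] := point_class p; exists z; split=> //; rewrite pE.
by split; [exact/converges_asymp | exact/apd].
Qed.

Lemma represents_exists x : asymp x x -> exists p, represents p x.
Proof.
move=> xx; have pP : is_boundary_class S (boundary_class S (sval \o x)).
  by apply/asboolP; exists (sval \o x) => //; exact/converges_asymp.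
exists (BoundaryPoint pP); split=> //=.
by split; [exact/converges_asymp | exact/apd].
Qed.

Lemma represents_eq p q x y : represents p x -> represents q y -> (p = q <-> asymp x y).
Proof.
move=> [xx px] [yy qy].
have [z zz pE] := point_class p; have [w ww qE] := point_class q.
have zx : asymp z x by move: px; rewrite pE => -[_] /apd.
have wy : asymp w y by move: qy; rewrite qE => -[_] /apd.
split=> [pq|xy].
  have : boundary_seqs p (sval \o y) by rewrite pq.
  rewrite pE => -[_] /apd zy; apply: (asymp_trans hyp) zy; exact: asympC.
apply: val_inj; rewrite /= pE qE; apply/seteqP.
have zw : asymp z w.
  apply: (asymp_trans hyp) zx _; apply: (asymp_trans hyp) xy _; exact: asympC.
split=> u [uC zu]; split=> //; have [v vE] := lift_seq uC.1; rewrite vE in zu *.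
  by apply/apd; apply: (asymp_trans hyp) (asympC ln zw) _; exact/apd.
by apply/apd; apply: (asymp_trans hyp) zw _; exact/apd.
Qed.

Lemma represents_act p x (g : T) : represents p x ->
  represents (boundary_act (sval g) p) (fun i => g * x i)%g.
Proof.
move=> [xx px]; split; first exact: (asymp_mul ln).
rewrite boundary_actE; last exact: sub_generated.
by exists (sval \o x).
Qed.


(** North-south dynamics: as the limits of [h^-1] and [x] differ, the products [h n * x j] are
    reduced up to a constant uniform in [j]. So [h n] is nearly a prefix of [h n * x j], which is
    thereby carried to the limit of [h]. *)
Lemma boundary_act_cvg (h x : nat -> T) p q :
  asymp (fun n => (h n)^-1)%g (fun n => (h n)^-1)%g -> represents q h ->
  represents p x -> ~ asymp (fun n => (h n)^-1)%g x ->
  (fun n => boundary_act (sval (h n)) p) @ \oo --> q.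
Proof.
move=> hV qh px nhx V; rewrite nbhsE => -[U [oU Uq] UV].
have [r rU] := oU q Uq; have [hh qh2] := qh; have [xx _] := px.
have [M [N NP]] := nasymp_bound hyp hV xx nhx.
have [N1 N1P] := hh (2 * r + delta).
have [N2 N2P] := asymp_norm ln (M + 2 * r + delta) hh.
exists (N + N1 + N2) => // n /= Nn; apply: UV; apply: rU.
have [yy py] := represents_act (h n) px.
exists (sval \o h), (sval \o (fun i => h n * x i)%g); split=> //.
exists (N + N1 + N2) => i j Ni Nj.
have := NP n j ltac:(lia) ltac:(lia); have := N1P i n ltac:(lia) ltac:(lia).
have := N2P n ltac:(lia).
have := hyp 1%g (h i) (h n) (h n * x j)%g.
have -> : ndist l (h n)^-1%g (x j) = l (h n * x j)%g by rewrite /ndist invgK.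
rewrite !dist1x (norm_inv ln) dist_mulV => H1 H2 H3 H4.
rewrite /gromov_product -(sval1 sH) !(word_distE S) !dist1x ler_pdivlMr //.
rewrite lerBrDr -!(natrM, natrD) ler_nat.
rewrite -/(ndist l (h i) (h n * x j)%g).
by lia.
Qed.

Lemma infinite_boundary_points : infinite_set [set: gromov_boundary S] -> infinite_boundary l.
Proof.
move=> inf n; have [A _ cA] := infinite_set_fset n inf.
have [X XP] := choice represented.
have p0 (a : nat) : a < n -> gromov_boundary S.
  move=> an; have : 0 < size (finmap.enum_fset A) by apply: leq_trans cA; apply: leq_ltn_trans an.
  by case: (finmap.enum_fset A) => // p.
case: n cA p0 => [|n] cA p0; first by exists (fun _ _ => 1%g).
pose pt a := nth (p0 0 isT) (finmap.enum_fset A) a.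
exists (fun a => X (pt a)); split=> [a _|a c an cn ac]; first by case: (XP (pt a)).
move=> /(represents_eq (XP (pt a)) (XP (pt c))) /eqP.
rewrite /pt nth_uniq ?finmap.fset_uniq //; first by move=> /eqP.
  exact: leq_trans an cA.
exact: leq_trans cn cA.
Qed.

End BoundaryPoints.

(** * Divergence of exponential series *)

Local Open Scope ring_scope.

Section Sums.
Variable R : realType.

Lemma ler_sum_seq (I : eqType) (s : seq I) (F H : I -> R) :
  (forall i, i \in s -> F i <= H i) -> \sum_(i <- s) F i <= \sum_(i <- s) H i.
Proof.
by move=> FH; rewrite big_seq [leRHS]big_seq; apply: ler_sum => i /FH.
Qed.

Lemma ler_sum_inj (I J : eqType) (s : seq I) (t : seq J) (h : I -> J) (F : J -> R) :
  uniq s -> {in s &, injective h} -> (forall i, i \in s -> h i \in t) ->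
  (forall j, 0 <= F j) -> \sum_(i <- s) F (h i) <= \sum_(j <- t) F j.
Proof.
move=> us hinj hst F0; rewrite -(big_map h xpredT).
have ums : uniq (map h s) by rewrite map_inj_in_uniq.
have sub : {subset map h s <= t} by move=> _ /mapP[i si ->]; exact: hst.
move: (map h s) ums sub => {s us hinj hst} s us st.
elim: s t us st => [|x s IH] t /= us st.
  by rewrite big_nil; apply: sumr_ge0.
case/andP: us => xs us; have xt : x \in t by apply: st; exact: mem_head.
rewrite big_cons (perm_big _ (perm_to_rem xt)) big_cons lerD2l.
apply: IH => // y ys; have yt : y \in t by apply: st; rewrite inE ys orbT.
have := perm_mem (perm_to_rem xt) y; rewrite yt inE => /esym/orP[/eqP yx|//].
by move: xs; rewrite -yx ys.
Qed.

(** Since [A] bounds every [|x|], a change of the exponent by at most [ln 2 / A] multiplies each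
    term by at most 2. *)
Lemma exp_sum_perturb (r : seq R) : exists2 eta : R, 0 < eta &
  forall s s', `|s - s'| <= eta ->
    \sum_(x <- r) expR (s * x) <= 2 * \sum_(x <- r) expR (s' * x).
Proof.
pose A := \sum_(x <- r) `|x| + 1.
have A0 : 0 < A by rewrite ltr_wpDl // sumr_ge0.
exists (ln 2 / A); first by rewrite divr_gt0 // ln_gt0 // ltr1n.
move=> s s' sE; rewrite mulr_sumr; apply: ler_sum_seq => x xr.
have -> : s * x = s' * x + (s - s') * x by rewrite mulrBl addrC subrK.
rewrite expRD mulrC ler_wpM2r ?expR_ge0 // -[leRHS]lnK ?posrE ?ltr0n // ler_expR.
apply: le_trans (ler_norm _) _; rewrite normrM.
have xA : `|x| <= A.
  rewrite /A (perm_big _ (perm_to_rem xr)) big_cons -addrA lerDl addr_ge0 //.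
  exact: sumr_ge0.
apply: le_trans (ler_pM _ _ sE xA) _ => //.
by rewrite divfK // gt_eqF.
Qed.

End Sums.

Definition converges_at (R : realType) (T : eqType) (f : T -> R) (A : set T) (s : R) :=
  exists M : R, forall L : seq T, uniq L -> (forall x, x \in L -> A x) ->
    \sum_(x <- L) expR (- s * f x) <= M.

Definition quasi_additive (R : realType) (T : groupType) (l : T -> nat) (f : T -> R) :=
  forall D : nat, exists C : R, forall g h : T, (l g + l h <= l (g * h)%g + D)%N ->
    `|f (g * h)%g - f g - f h| <= C.

Section Divergence.
Variables (R : realType) (T : groupType) (l : T -> nat) (delta : nat) (f : T -> R).
Hypotheses (ln : word_norm l) (hyp : four_point l delta).
Hypothesis qa : quasi_additive l f.
Local Notation d := (ndist l).

Lemma quasi_additive_short (L : nat) : exists C : R, forall g h : T,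
  (l h <= L)%N -> `|f (g * h)%g - f g| <= C.
Proof.
have [C CP] := qa (2 * L).
exists (C + \sum_(h <- nball ln L) `|f h|) => g h hL.
have -> : f (g * h)%g - f g = (f (g * h)%g - f g - f h) + f h by rewrite subrK.
apply: le_trans (ler_normD _ _) _; apply: lerD.
  apply: CP; have := norm_mul ln (g * h)%g h^-1%g; rewrite mulgK (norm_inv ln); lia.
have hb : h \in nball ln L by rewrite mem_nball.
by rewrite (perm_big _ (perm_to_rem hb)) big_cons lerDl sumr_ge0.
Qed.

(* The sum over words of length [n] in [A] dominates the [n]-th power of the
   sum over [A], weighted by [exp (- s C)] per letter. *)
Lemma free_basis_diverges (D : nat) : exists C : R, forall (A : seq T) s, uniq A ->
  free_basis l delta [set x | x \in A] D -> 0 <= s ->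
  1 <= \sum_(b <- A) expR (- s * (f b + C)) -> ~ converges_at f setT s.
Proof.
have [C CP] := qa (D + delta); exists C => A s uA bas s0 A1 [M MP].
pose fix words n : seq (seq T) :=
  if n is n'.+1 then [seq b :: v | b <- A, v <- words n'] else [:: [::]].
have wsize n w : w \in words n -> size w = n.
  elim: n w => [|n IH] w /=; first by rewrite inE => /eqP ->.
  by move=> /allpairsP[[b v] /= [_ /IH <- ->]].
have wA n w : w \in words n -> forall x, x \in w -> x \in A.
  elim: n w => [|n IH] w /=; first by rewrite inE => /eqP ->.
  move=> /allpairsP[[b v] /= [bA /IH vA ->]] x; rewrite inE => /orP[/eqP ->//|].
  exact: vA.
have wuniq n : uniq (words n).
  elim: n => [//|n IH] /=; apply: allpairs_uniq => //.
  by move=> [b v] [b' v'] /= _ _ [-> ->].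
pose P (w : seq T) := (\prod_(x <- w) x)%g.
have Sn n : expR (- s * f 1%g) <= \sum_(w <- words n) expR (- s * f (P w)).
  elim: n => [|n IH]; first by rewrite /= big_seq1 /P big_nil.
  apply: le_trans IH _; rewrite [words n.+1]/= big_allpairs_dep /=.
  apply: (@le_trans _ _ (\sum_(b <- A) \sum_(v <- words n)
      expR (- s * (f b + C)) * expR (- s * f (P v)))).
    under [leRHS]eq_bigr do rewrite -mulr_sumr.
    rewrite -mulr_suml ler_peMl // sumr_ge0 // => v _; exact: expR_ge0.
  apply: ler_sum_seq => b bA; apply: ler_sum_seq => v vn.
  rewrite -expRD ler_expR -mulrDr !mulNr lerN2 ler_wpM2l // /P big_cons.
  have := CP b (P v) (free_basis_product ln hyp bas (wA n v vn) bA).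
  by rewrite ler_norml => /andP[_]; rewrite /P; lra.
pose fix all_words n := if n is n'.+1 then all_words n' ++ words n' else [::].
have awP n w : w \in all_words n -> (size w < n)%N /\ forall x, x \in w -> x \in A.
  elim: n => [//|n IH] /=; rewrite mem_cat => /orP[/IH[sw wa]|wn].
    by split=> //; exact: ltnW.
  by rewrite (wsize _ _ wn); split=> //; exact: wA wn.
have awu n : uniq (all_words n).
  elim: n => [//|n IH] /=; rewrite cat_uniq IH wuniq andbT /=.
  apply/hasPn => w /= wn; apply/negP => /awP[]; by rewrite (wsize _ _ wn) ltnn.
(* Every word length contributes at least the same positive constant, and distinct words have
   distinct products, so the partial sums over the group are unbounded. *)
have big n : n%:R * expR (- s * f 1%g) <= \sum_(w <- all_words n) expR (- s * f (P w)).
  elim: n => [|n IH] /=; first by rewrite mul0r big_nil.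
  by rewrite big_cat /= -addn1 natrD mulrDl mul1r lerD.
have e0 : 0 < expR (- s * f 1%g) by exact: expR_gt0.
have [n nM] : exists n : nat, M / expR (- s * f 1%g) < n%:R.
  exists (Num.bound `|M / expR (- s * f 1%g)|).
  exact: le_lt_trans (ler_norm _) (archi_boundP (normr_ge0 _)).
have SM : \sum_(w <- all_words n) expR (- s * f (P w)) <= M.
  rewrite -(big_map P xpredT (fun x => expR (- s * f x))); apply: MP => //.
  rewrite map_inj_in_uniq // => w w' /awP[_ wa] /awP[_ wa'].
  exact: (free_basis_inj ln hyp bas).
by have := le_trans (big n) SM; rewrite leNgt -ltr_pdivrMr // nM.
Qed.

Variables (G : set T) (l' : T -> nat) (K : nat).
Hypotheses (ln' : word_norm l') (sG : is_subgroup G).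
Hypothesis cutG : forall (g : T) m, G g -> (m <= l' g)%N -> exists h : T,
  [/\ G h, (l' h <= m + K)%N, (m <= l' h + K)%N,
      (l' (h^-1 * g)%g + m <= l' g + K)%N & (l h + l (h^-1 * g)%g <= l g + K)%N].

(* Cutting every long element of [G] near distance [m] bounds the partial sum
   over the ball of radius [N.+1] by that over the ball of radius [N]. *)
Lemma converges_at_left s : 0 < s -> converges_at f G s ->
  exists2 s', 0 < s' < s & converges_at f G s'.
Proof.
move=> s0 [M MP]; have [G1 GM GV] := sG.
have [C0 C0P] := qa K; pose C := `|C0|.
pose H m := [seq h <- nball ln' (m + K) | `[< G h >] && (m <= l' h + K)%N].
have HG m h : (h \in H m) = [&& `[< G h >], (m <= l' h + K)%N & (l' h <= m + K)%N].
  by rewrite mem_filter mem_nball -andbA.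
(* The annuli [H (w i)] have half-width [K] and radii spaced by [2 * K + 1], hence are disjoint; if
   all had weight above [eps], the partial sums over [G] would be unbounded. *)
have [m mK Sm] : exists2 m, (K < m)%N &
    \sum_(h <- H m) expR (- s * f h) <= expR (- s * C) / 4.
  apply: contrapT => nm.
  have eps0 : 0 < expR (- s * C) / 4 by rewrite divr_gt0 // expR_gt0.
  set eps := expR (- s * C) / 4 in eps0 nm.
  pose w i := (K.+1 + i * (2 * K).+1)%N.
  pose fix L n := if n is n'.+1 then L n' ++ H (w n') else [::].
  have LP n h : h \in L n -> G h /\ (l' h + K < w n)%N.
    elim: n => [//|n IH] /=; rewrite mem_cat => /orP[/IH[Gh lh]|].
      by split=> //; apply: leq_trans lh _; rewrite /w; lia.
    by rewrite HG => /and3P[/asboolP Gh _ lh]; split=> //; move: lh; rewrite /w; lia.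
  have Lu n : uniq (L n).
    elim: n => [//|n IH] /=; rewrite cat_uniq IH filter_uniq ?nball_uniq // andbT /=.
    apply/hasPn => h /=; rewrite HG => /and3P[_ lh _]; apply/negP => /LP[_].
    by lia.
  have big n : n%:R * eps <= \sum_(h <- L n) expR (- s * f h).
    elim: n => [|n IH] /=; first by rewrite mul0r big_nil.
    rewrite big_cat /= -addn1 natrD mulrDl mul1r lerD // leNgt; apply/negP => lt.
    by apply: nm; exists (w n); [rewrite /w; lia | exact: ltW].
  have [n nM] : exists n : nat, M / eps < n%:R.
    exists (Num.bound `|M / eps|).
    exact: le_lt_trans (ler_norm _) (archi_boundP (normr_ge0 _)).
  have := le_trans (big n) (MP _ (Lu n) (fun x xL => (LP n x xL).1)).
  by rewrite leNgt -ltr_pdivrMr // nM.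
have [eta eta0 etaP] := exp_sum_perturb [seq C - f h | h <- H m].
pose s' := Num.max (s - eta) (s / 2).
have s'0 : 0 < s' by rewrite lt_max divr_gt0 ?orbT.
have s's : s' < s by rewrite gt_max; apply/andP; split; lra.
have s'eta : `|s' - s| <= eta.
  have d0 : 0 <= s - s' by rewrite subr_ge0 ltW.
  rewrite distrC (ger0_norm d0) lerBlDr -lerBlDl.
  by rewrite /s' le_max lexx.
(* The bound [1 / 4] built into the choice of [m] absorbs the factor 2 lost between [s] and [s']. *)
have half : \sum_(h <- H m) expR (s' * (C - f h)) <= 1 / 2.
  have := etaP _ _ s'eta; rewrite !big_map => H1; apply: le_trans H1 _.
  have -> : \sum_(h <- H m) expR (s * (C - f h)) =
      expR (s * C) * \sum_(h <- H m) expR (- s * f h).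
    rewrite mulr_sumr; apply: eq_bigr => h _; rewrite -expRD; congr expR.
    by rewrite mulrBr mulNr.
  have e4 : expR (s * C) * (expR (- s * C) / 4) = 1 / 4.
    by rewrite mulrA -expRD mulNr subrr expR0.
  by have := ler_wpM2l (expR_ge0 (s * C)) Sm; rewrite e4; lra.
exists s'; first by rewrite s'0.
pose B n := [seq g <- nball ln' n | `[< G g >]].
have BP n g : (g \in B n) = `[< G g >] && (l' g <= n)%N by rewrite mem_filter mem_nball.
pose F g := expR (- s' * f g); have F0 g : 0 <= F g by exact: expR_ge0.
pose S n := \sum_(g <- B n) F g.
have Bu n : uniq (B n) by rewrite filter_uniq // nball_uniq.
have Smono n n' : (n <= n')%N -> S n <= S n'.
  move=> nn; apply: (@ler_sum_inj _ _ _ (B n) (B n') id) => // g.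
  by rewrite !BP => /andP[-> lg]; exact: leq_trans nn.
have S0 n : 0 <= S n by exact: sumr_ge0.
(* Since [K < m], cutting off [h] moves [g] from the ball of radius [n.+1] into that of radius [n];
   the factor [1 / 2] keeps the recursion bounded. *)
have step n : S n.+1 <= S m + 1 / 2 * S n.
  rewrite /S (bigID (fun g => (l' g <= m)%N)) /=; apply: lerD.
    rewrite -big_filter; apply: (@ler_sum_inj _ _ _ _ (B m) id) => //.
      by rewrite filter_uniq.
    by move=> g; rewrite mem_filter !BP => /and3P[-> -> _].
  apply: (@le_trans _ _ (\sum_(g <- B n.+1) \sum_(h <- H m | (h^-1 * g)%g \in B n)
      expR (s' * (C - f h)) * F (h^-1 * g)%g)).
    rewrite big_mkcond /=; apply: ler_sum_seq => g; rewrite BP => /andP[/asboolP Gg gn].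
    have R0 : 0 <= \sum_(h <- H m | (h^-1 * g)%g \in B n)
        expR (s' * (C - f h)) * F (h^-1 * g)%g.
      by apply: sumr_ge0 => h _; rewrite mulr_ge0 // expR_ge0.
    case: ifPn => //; rewrite -ltnNge => mg.
    have [h [Gh lh1 lh2 lh3 lh4]] := cutG Gg (ltnW mg).
    have hH : h \in H m by rewrite HG; apply/and3P; split=> //; apply/asboolP.
    have kB : (h^-1 * g)%g \in B n.
      rewrite BP; apply/andP; split; last by lia.
      by apply/asboolP/GM => //; exact: GV.
    rewrite (perm_big _ (perm_to_rem hH)) big_cons kB.
    apply: (@le_trans _ _ (expR (s' * (C - f h)) * F (h^-1 * g)%g)); last first.
      by rewrite lerDl; apply: sumr_ge0 => x _; rewrite mulr_ge0 // expR_ge0.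
    rewrite /F -expRD ler_expR mulNr mulNr -mulrBr -mulrN ler_pM2l //.
    have hg : (l h + l (h^-1 * g)%g <= l (h * (h^-1 * g))%g + K)%N by rewrite mulVKg.
    have := C0P _ _ hg; rewrite mulVKg ler_norml => /andP[+ _].
    by have := ler_norm C0; rewrite -/C; lra.
  rewrite (exchange_big_dep xpredT) //=.
  apply: (@le_trans _ _ (\sum_(h <- H m) expR (s' * (C - f h)) * S n)).
    apply: ler_sum_seq => h _; rewrite -mulr_sumr ler_wpM2l ?expR_ge0 //.
    rewrite -big_filter; apply: (@ler_sum_inj _ _ _ _ (B n) (fun g => h^-1 * g)%g) => //.
    - by rewrite filter_uniq.
    - by move=> x y _ _; exact: mulgI.
    - by move=> g; rewrite mem_filter => /andP[].
  by rewrite -mulr_suml ler_wpM2r.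
have bound n : S n <= 2 * S m.
  elim: n => [|n IH]; first by have := Smono 0%N m isT; have := S0 m; lra.
  by have := step n; lra.
exists (2 * S m) => L uL LG; apply: le_trans (bound (\max_(x <- L) l' x)%N).
apply: (@ler_sum_inj _ _ _ L _ id (fun x => F x)) => // g gL; rewrite BP.
by apply/andP; split; [exact/asboolP/LG | exact: leq_bigmax_seq].
Qed.

End Divergence.

(** Greedy choice: an element is kept only when far from those already kept, so a discarded one is
    near a kept one. *)
Lemma separated_sublist (T : groupType) (l : T -> nat) (L : nat) (X : seq T) :
  word_norm l -> exists Y : seq T, [/\ uniq Y, {subset Y <= X},
    forall y z : T, y \in Y -> z \in Y -> y <> z -> (L <= ndist l y z)%N &
    forall x : T, x \in X -> exists2 y : T, y \in Y & (ndist l y x <= L)%N].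
Proof.
move=> ln; elim: X => [|x X [Y [uY YX Ysep Ynet]]]; first by exists [::].
have [[y yY yx]|far] := pselect (exists2 y : T, y \in Y & (ndist l y x <= L)%N).
  exists Y; split=> // [z zY|z]; first by rewrite inE YX ?orbT.
  by rewrite inE => /orP[/eqP ->|/Ynet//]; exists y.
have {}far y : y \in Y -> (L < ndist l y x)%N.
  by move=> yY; rewrite ltnNge; apply/negP => yx; apply: far; exists y.
exists (x :: Y); split=> [|z|y z|z].
- by rewrite /= uY andbT; apply/negP => /far; rewrite distxx.
- by rewrite !inE => /orP[->//|/YX ->]; rewrite orbT.
- rewrite !inE => /orP[/eqP ->|yY] /orP[/eqP ->|zY] // yz; last exact: Ysep.
    by rewrite distC //; exact/ltnW/far.
  exact/ltnW/far.
rewrite inE => /orP[/eqP ->|/Ynet[y yY yz]].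
  by exists x; [exact: mem_head | rewrite distxx].
by exists y => //; rewrite inE yY orbT.
Qed.

(** * The gap in growth, for a hyperbolic norm [l] and a norm [l'] in which [G] is quasiconvex *)

Section Gap.
Variables (R : realType) (T : groupType) (l l' : T -> nat) (delta lambda : nat).
Variable f : T -> R.
Hypotheses (ln : word_norm l) (ln' : word_norm l') (hyp : four_point l delta).
Hypotheses (le_l : forall x, (l x <= lambda * l' x)%N)
           (le_l' : forall x, (l' x <= lambda * l x)%N).
Hypothesis infb : infinite_boundary l.
Hypothesis qa : quasi_additive l f.
Variables (G : set T) (C : nat).
Hypotheses (sG : is_subgroup G) (iiG : infinite_index G setT).
Hypothesis qcG : forall m (p : nat -> T),
  (forall i j, (i <= j)%N -> (j <= m)%N -> ndist l' (p i) (p j) = (j - i)%N) ->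
  G (p 0%N) -> G (p m) -> forall i, (i <= m)%N ->
  exists2 h, G h & (ndist l' (p i) h <= C)%N.
Local Notation d := (ndist l).
Local Notation d' := (ndist l').
Local Notation nball := (nball ln).

Let G1 : G 1%g. Proof. by have [] := sG. Qed.

(** Quasiconvexity is given along [l']-geodesics; an [l]-geodesic stays near one with the same
    endpoints. *)
Lemma quasiconvex_hyperbolic : exists K : nat, forall g w : T, G g ->
  (l w + l (w^-1 * g)%g)%N = l g -> exists2 h : T, G h & (d w h <= K)%N.
Proof.
have [D0 D0P] := geodesic_near_quasigeodesic ln ln' hyp le_l le_l'.
exists (D0 + lambda * C)%N => g w Gg wg.
have [p [p0 pg pd]] := norm_geodesic ln' g.
have wE : g = (w * (w^-1 * g))%g by rewrite mulVKg.
have [q [q0 qw qg qd]] : exists q : nat -> T, [/\ q 0%N = 1%g, q (l w) = w, q (l g) = g &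
    forall i j, (i <= j)%N -> (j <= l g)%N -> d (q i) (q j) = (j - i)%N].
  by rewrite wE; apply: geodesic_concat => //; rewrite mulVKg.
have [i ig iw] := D0P g p q p0 pg pd q0 qg qd (l w) ltac:(lia).
have [h Gh ih] := qcG pd (eq_ind_r G G1 p0) (eq_ind_r G Gg pg) ig.
exists h => //; rewrite qw in iw.
have := dist_tri ln (p i) w h; have : (d (p i) h <= lambda * d' (p i) h)%N by exact: le_l.
by have : (lambda * d' (p i) h <= lambda * C)%N by [rewrite leq_mul2l ih orbT]; lia.
Qed.

(** The cut is made on an [l']-geodesic, where quasiconvexity is available; stability makes it
    nearly reduced for [l] too, the norm in which [f] is quasi-additive. *)
Lemma quasiconvex_cut : exists K : nat, forall (g : T) m, G g -> (m <= l' g)%N -> exists h : T,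
  [/\ G h, (l' h <= m + K)%N, (m <= l' h + K)%N,
      (l' (h^-1 * g)%g + m <= l' g + K)%N & (l h + l (h^-1 * g)%g <= l g + K)%N].
Proof.
have [D0 D0P] := quasigeodesic_near_geodesic ln ln' hyp le_l le_l'.
exists (C + D0 + 2 * (lambda * C))%N => g m Gg mg.
have [p [p0 pg pd]] := norm_geodesic ln' g.
have [h Gh ih] := qcG pd (eq_ind_r G G1 p0) (eq_ind_r G Gg pg) mg.
set y := p m in ih.
have ly : l' y = m by rewrite -(dist1x l') -p0 /ndist pd // subn0.
have lyg : d' y g = (l' g - m)%N by have := pd m _ mg (leqnn _); rewrite pg.
have ihl : (d y h <= lambda * C)%N.
  by apply: leq_trans (le_l _) _; rewrite leq_mul2l ih orbT.
have := D0P y (y^-1 * g)%g; rewrite mulVKg ly -(distE l' y g) lyg subnKC // => /(_ erefl) cut.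
exists h; split=> //.
- by have := dist_tri ln' y 1%g h; rewrite !dist1x ly; lia.
- by have := dist_tri ln' h 1%g y; rewrite !dist1x ly (distC ln' h); lia.
- suff : (d' h g + m <= l' g + (C + D0 + 2 * (lambda * C)))%N by [].
  by have := dist_tri ln' y h g; rewrite (distC ln' h y); lia.
suff : (l h + d h g <= l g + (C + D0 + 2 * (lambda * C)))%N by [].
rewrite -(distE l y g) in cut.
have := dist_tri ln y 1%g h; have := dist_tri ln y h g.
by rewrite !dist1x (distC ln h y); lia.
Qed.

(** [D] comes before [M] because [M] will have to beat a loss per letter that depends on [D]. A
    large partial sum over [G] is thinned to a separated set of long elements and multiplied by [a],
    each operation costing a fixed factor or a fixed summand. *)
Lemma divergent_free_basis s : 0 <= s -> ~ converges_at f G s -> exists D : nat,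
  forall M : R, exists A : seq T, [/\ uniq A, free_basis l delta [set x | x \in A] D &
    M <= \sum_(x <- A) expR (- s * f x)].
Proof.
move=> s0 Gdiv; have [K KP] := quasiconvex_hyperbolic.
have [a [D [L aP]]] := coset_free_basis ln hyp infb sG iiG KP.
exists D => M.
have [C1 C1P] := quasi_additive_short ln qa L.
have [C2 C2P] := quasi_additive_short ln qa (l a).
pose B := (size (nball L))%:R : R.
pose S0 := \sum_(x <- nball L) expR (- s * f x).
have e1 : 0 < expR (s * C1) by exact: expR_gt0.
(* [S0] pays for removing the ball of radius [L], [B * expR (s * C1)] for passing to a separated
   set, and [expR (s * C2)] for multiplying by [a]. *)
pose M' := B * expR (s * C1) * (`|M| * expR (s * C2)) + S0.
have [X [uX XG XM]] : exists X : seq T, [/\ uniq X, forall x, x \in X -> G x &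
    M' < \sum_(x <- X) expR (- s * f x)].
  apply: contrapT => nX; apply: Gdiv; exists M' => X uX XG.
  by rewrite leNgt; apply/negP => lt; apply: nX; exists X.
pose X' := [seq x <- X | (L < l x)%N].
have XM' : M' - S0 <= \sum_(x <- X') expR (- s * f x).
  rewrite lerBlDr; apply: le_trans (ltW XM) _.
  rewrite (bigID (fun x => (L < l x)%N)) /= big_filter lerD2l -big_filter.
  apply: (@ler_sum_inj _ _ _ _ (nball L) id) => //; first by rewrite filter_uniq.
    by move=> x; rewrite mem_filter mem_nball -leqNgt => /andP[].
have [Y [uY YX Ysep Ynet]] := @separated_sublist T l L X' ln.
have YG y : y \in Y -> G y by move=> /YX; rewrite mem_filter => /andP[_ /XG].
have Yl y : y \in Y -> (L <= l y)%N.
  by move=> /YX; rewrite mem_filter => /andP[/ltnW].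
have bas := aP [set y | y \in Y] YG Yl Ysep.
exists [seq (y * a)%g | y <- Y]; split.
- by rewrite map_inj_uniq // => x y; exact: mulIg.
- suff -> : [set x | x \in [seq (y * a)%g | y <- Y]] = [set (g * a)%g | g in [set y | y \in Y]] by [].
  apply/seteqP; split=> x /=; first by move=> /mapP[y yY ->]; exists y.
  by move=> [y yY <-]; exact: map_f.
have X'Y : \sum_(x <- X') expR (- s * f x) <=
    B * expR (s * C1) * \sum_(y <- Y) expR (- s * f y).
  apply: (@le_trans _ _ (\sum_(y <- Y) \sum_(e <- nball L) expR (- s * f (y * e)%g))).
    apply: (@le_trans _ _ (\sum_(y <- Y) \sum_(x <- X' | (d y x <= L)%N) expR (- s * f x))).
      rewrite (exchange_big_dep xpredT) //=; apply: ler_sum_seq => x xX.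
      have [y yY yx] := Ynet x xX.
      rewrite (perm_big _ (perm_to_rem yY)) big_cons yx lerDl.
      by apply: sumr_ge0 => z _; exact: expR_ge0.
    apply: ler_sum_seq => y yY; rewrite -big_filter.
    under eq_bigr => x _ do rewrite -[in f x](mulVKg y x).
    apply: (@ler_sum_inj _ _ _ _ (nball L) (fun x => y^-1 * x)%g
      (fun e => expR (- s * f (y * e)%g))).
    - by rewrite !filter_uniq.
    - by move=> x z _ _; exact: mulgI.
    - by move=> x; rewrite mem_filter mem_nball => /andP[].
    - by move=> x; exact: expR_ge0.
  rewrite mulr_sumr; apply: ler_sum_seq => y yY.
  apply: (@le_trans _ _ (\sum_(e <- nball L) expR (s * C1) * expR (- s * f y))).
    apply: ler_sum_seq => e; rewrite mem_nball => eL.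
    rewrite -expRD ler_expR mulNr mulNr -mulrBr -mulrN ler_wpM2l //.
    by have := C1P y e eL; rewrite ler_norml => /andP[+ _]; lra.
  by rewrite big_const_seq count_predT iter_addr_0 -mulrA mulr_natl.
have Ya : expR (- s * C2) * \sum_(y <- Y) expR (- s * f y) <=
    \sum_(x <- [seq (y * a)%g | y <- Y]) expR (- s * f x).
  rewrite big_map mulr_sumr; apply: ler_sum_seq => y yY.
  rewrite -expRD ler_expR -mulrDr !mulNr lerN2 ler_wpM2l //.
  by have := C2P y a (leqnn _); rewrite ler_norml => /andP[_]; lra.
apply: le_trans Ya.
have B0 : 0 < B.
  rewrite /B ltr0n lt0n; apply/eqP => /size0nil E.
  by have := mem_nball ln L 1%g; rewrite E norm_one.
have := le_trans XM' X'Y; rewrite /M' addrK ler_pM2l ?mulr_gt0 // => MY.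
apply: le_trans (ler_norm _) _; rewrite mulrC -ler_pdivrMr ?expR_gt0 //.
by rewrite mulNr expRN invrK.
Qed.

Lemma growth_gap (dG : R) : 0 <= dG ->
  (forall s, 0 < s -> s < dG -> ~ converges_at f G s) ->
  exists2 eps : R, 0 < eps & forall s, 0 < s -> s <= dG + eps -> ~ converges_at f setT s.
Proof.
move=> dG0 Gdiv.
have [A [D [C0 [uA bas CP A2]]]] : exists (A : seq T) D C0, [/\ uniq A,
    free_basis l delta [set x | x \in A] D,
    forall s, 0 <= s -> 1 <= \sum_(b <- A) expR (- s * (f b + C0)) ->
       ~ converges_at f setT s &
    2 <= \sum_(b <- A) expR (- dG * (f b + C0))].
  have [dG00|dGn0] := eqVneq dG 0.
    (* At exponent 0 every weight is 1, so two free generators already sum to 2. *)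
    have [b [c [D [bc bas]]]] := free_pair_basis ln hyp infb.
    have [C0 CP] := free_basis_diverges ln hyp qa D.
    have ub : uniq [:: b; c] by rewrite /= inE andbT; apply/eqP.
    have {}bas : free_basis l delta [set x | x \in [:: b; c]] D.
      suff <- : [set x | x = b \/ x = c] = [set x | x \in [:: b; c]] by [].
      apply/seteqP; split=> x /=; rewrite !inE.
        by move=> [->|->]; rewrite eqxx ?orbT.
      by move=> /orP[/eqP|/eqP]; [left | right].
    exists [:: b; c], D, C0; split=> // [s s0|]; first exact: CP.
    by rewrite dG00 !big_cons big_nil oppr0 !mul0r expR0 addr0.
  have dGpos : 0 < dG by rewrite lt_neqAle eq_sym dGn0.
  have nG : ~ converges_at f G dG.
    have [K KP] := quasiconvex_cut.
    move=> /(converges_at_left qa ln' sG KP dGpos)[s /andP[s0 sG']].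
    exact: Gdiv.
  have [D DP] := divergent_free_basis dG0 nG.
  have [C0 CP] := free_basis_diverges ln hyp qa D.
  have [A [uA bas AM]] := DP (2 * expR (dG * C0)).
  exists A, D, C0; split=> // [s s0|]; first exact: CP.
  under eq_bigr do rewrite mulrDr expRD.
  by rewrite -mulr_suml mulNr expRN ler_pdivlMr ?expR_gt0.
have [eta eta0 etaP] := exp_sum_perturb [seq - (f b + C0) | b <- A].
exists eta => // s s0 sd.
(* Below [dG] the partial sums over [G] alone are unbounded; the free semigroup takes over from [dG]
   on. *)
have [sdG|dGs] := ltP s dG.
  move=> [M MP]; apply: (Gdiv s s0 sdG); exists M => L uL LG; exact: MP.
apply: CP; first exact: ltW.
have sE : `|dG - s| <= eta by rewrite distrC ger0_norm ?subr_ge0 // lerBlDl.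
have := etaP dG s sE; rewrite !big_map.
under eq_bigr do rewrite mulrN -mulNr.
under [X in _ <= 2 * X -> _]eq_bigr do rewrite mulrN -mulNr.
by lra.
Qed.

End Gap.

(** * Norms of exterior powers *)

Section Scalars.
Variables (R : realType) (b : base_field).
Local Notation K := (scalars R b).
Local Notation sor := (@scalar_of_real R b).
Local Notation conj := (@scalar_conj R b).

(** The norm of [K] takes its values in [K], so over the complex field its real part is taken to
    obtain a real modulus. *)
Definition absv : K -> R :=
  match b return scalars R b -> R with
  | RealField => fun x => `|x|
  | ComplexField => fun x : R[i] => complex.Re `|x|
  end.

Lemma scalar_absv x : sor (absv x) = `|x|.
Proof.
by rewrite /absv; move: x; case: b.
Qed.

Lemma scalar_inj : injective sor.
Proof. by case: b => //= x y []. Qed.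

Lemma scalar0 : sor 0 = 0. Proof. by case: b. Qed.

Lemma scalar1 : sor 1 = 1. Proof. by case: b. Qed.

Lemma scalarM x y : sor (x * y) = sor x * sor y.
Proof. by case: b => //=; rewrite rmorphM. Qed.

Lemma scalarD x y : sor (x + y) = sor x + sor y.
Proof. by case: b => //=; rewrite rmorphD. Qed.

Lemma scalar_le x y : (sor x <= sor y) = (x <= y).
Proof. by case: b => //=; rewrite lecE /= eqxx. Qed.

Lemma scalar_lt x y : (sor x < sor y) = (x < y).
Proof. by rewrite !lt_neqAle scalar_le (inj_eq scalar_inj). Qed.

Lemma scalar_norm x : `|sor x| = sor `|x|.
Proof.
case: (leP 0 x) => x0.
  by rewrite !ger0_norm // -scalar0 scalar_le.
have xN : sor (- x) = - sor x.
  by apply/eqP; rewrite -addr_eq0 -scalarD addNr scalar0.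
by rewrite ltr0_norm -?scalar0 ?scalar_lt // ltr0_norm // xN.
Qed.

Lemma absv_scalar x : absv (sor x) = `|x|.
Proof. by apply: scalar_inj; rewrite scalar_absv scalar_norm. Qed.

Lemma absvM x y : absv (x * y) = absv x * absv y.
Proof. by apply: scalar_inj; rewrite scalarM !scalar_absv normrM. Qed.

Lemma absvD x y : absv (x + y) <= absv x + absv y.
Proof. by rewrite -scalar_le scalarD !scalar_absv ler_normD. Qed.

Lemma absvN x : absv (- x) = absv x.
Proof. by apply: scalar_inj; rewrite !scalar_absv normrN. Qed.

Lemma absv_distC x y : absv (x - y) = absv (y - x).
Proof. by rewrite -absvN opprB. Qed.

Lemma absv0 : absv 0 = 0.
Proof. by rewrite -scalar0 absv_scalar normr0. Qed.

Lemma absv1 : absv 1 = 1.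
Proof. by rewrite -scalar1 absv_scalar normr1. Qed.

Lemma absv_ge0 x : 0 <= absv x.
Proof. by rewrite -scalar_le scalar_absv scalar0. Qed.

Lemma absv_eq0 x : (absv x == 0) = (x == 0).
Proof. by rewrite -(inj_eq scalar_inj) scalar_absv scalar0 normr_eq0. Qed.

Lemma absv_gt0 x : (0 < absv x) = (x != 0).
Proof. by rewrite lt_neqAle absv_ge0 andbT eq_sym absv_eq0. Qed.

Lemma absv_conj x : absv (conj x) = absv x.
Proof.
rewrite /absv; move: x; case: b => // x.
exact: (congr1 (@complex.Re R) (normcJ x)).
Qed.

Lemma mul_conj x : x * conj x = sor (absv x ^+ 2).
Proof.
rewrite expr2 scalarM scalar_absv; move: x; case: b => /= x.
  by rewrite -normrM ger0_norm // -expr2 sqr_ge0.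
by rewrite -sqr_normc expr2.
Qed.

Lemma absv_prod (I : Type) (r : seq I) (P : pred I) (F : I -> K) :
  absv (\prod_(i <- r | P i) F i) = \prod_(i <- r | P i) absv (F i).
Proof. exact: (big_morph _ absvM absv1). Qed.

Lemma absv_sum (I : Type) (r : seq I) (P : pred I) (F : I -> K) :
  absv (\sum_(i <- r | P i) F i) <= \sum_(i <- r | P i) absv (F i).
Proof.
elim/big_ind2: _ => [|x1 x2 y1 y2 h1 h2|//]; first by rewrite absv0.
by apply: le_trans (absvD _ _) _; exact: lerD.
Qed.

Lemma scalar_sum (I : Type) (r : seq I) (P : pred I) (F : I -> R) :
  sor (\sum_(i <- r | P i) F i) = \sum_(i <- r | P i) sor (F i).
Proof. exact: (big_morph _ scalarD scalar0). Qed.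

Lemma scalar_prod (I : Type) (r : seq I) (P : pred I) (F : I -> R) :
  sor (\prod_(i <- r | P i) F i) = \prod_(i <- r | P i) sor (F i).
Proof. exact: (big_morph _ scalarM scalar1). Qed.

Lemma absv_sign (s : bool) : absv ((-1) ^+ s) = 1.
Proof. by case: s; rewrite ?expr1 ?absvN ?expr0 absv1. Qed.

Lemma absvX x n : absv (x ^+ n) = absv x ^+ n.
Proof. by elim: n => [|n IH]; rewrite ?expr0 ?absv1 // !exprS absvM IH. Qed.

Lemma absv_det_le n (A : 'M[K]_n) (B : R) : (forall i j, absv (A i j) <= B) ->
  absv (\det A) <= n`!%:R * B ^+ n.
Proof.
move=> AB; apply: le_trans (absv_sum _ _ _) _.
have -> : n`!%:R * B ^+ n = \sum_(s : 'S_n) B ^+ n.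
  by rewrite sumr_const card_Sn mulr_natl.
apply: ler_sum => s _; rewrite absvM absv_sign mul1r absv_prod.
have -> : B ^+ n = \prod_(i < n) B by rewrite prodr_const card_ord.
by apply: ler_prod => i _; rewrite absv_ge0 AB.
Qed.

End Scalars.

Lemma absv_complex (R : realType) (z : R[i]) : @absv R ComplexField z =
  Num.sqrt (complex.Re z ^+ 2 + complex.Im z ^+ 2).
Proof. by rewrite /absv normc_def. Qed.

Section CauchyBinet.
Variables (F : comNzRingType) (j d : nat).

Lemma det_mul_rect (X : 'M[F]_(j, d)) (Y : 'M[F]_(d, j)) :
  \det (X *m Y) = \sum_(f : {ffun 'I_j -> 'I_d})
    (\prod_i X i (f i)) * \det (\matrix_(i, k) Y (f i) k).
Proof.
rewrite /determinant.
under eq_bigr => s _ do under eq_bigr => i _ do rewrite mxE.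
under eq_bigr => s _ do rewrite bigA_distr_bigA mulr_sumr.
rewrite exchange_big; apply: eq_bigr => f _; rewrite mulr_sumr.
apply: eq_bigr => s _; rewrite big_split /= mulrCA; congr (_ * (_ * _)).
by apply: eq_bigr => i _; rewrite mxE.
Qed.

(* Cauchy-Binet, summed over all maps instead of increasing ones. *)
Lemma cauchy_binet (X : 'M[F]_(j, d)) (Y : 'M[F]_(d, j)) :
  j`!%:R * \det (X *m Y) = \sum_(f : {ffun 'I_j -> 'I_d})
    \det (\matrix_(i, k) X i (f k)) * \det (\matrix_(i, k) Y (f i) k).
Proof.
have perm_det (f : {ffun 'I_j -> 'I_d}) (s : 'S_j) :
    \det (\matrix_(i, k) Y ([ffun x => f (s x)] i) k) =
    (-1) ^+ s * \det (\matrix_(i, k) Y (f i) k).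
  rewrite -det_perm -det_mulmx -row_permE; congr (\det _).
  by apply/matrixP => i k; rewrite !mxE ffunE.
have -> : j`!%:R * \det (X *m Y) = \sum_(s : 'S_j) \det (X *m Y).
  by rewrite sumr_const card_Sn mulr_natl.
under eq_bigr do rewrite det_mul_rect.
(* Replacing [f] by [f \o s] in the copy indexed by [s] makes the sum over [s] the Leibniz expansion
   of the other minor. *)
transitivity (\sum_(s : 'S_j) \sum_(f : {ffun 'I_j -> 'I_d})
    (\prod_i X i (f (s i))) * ((-1) ^+ s * \det (\matrix_(i, k) Y (f i) k))).
  apply: eq_bigr => s _.
  rewrite (reindex (fun f : {ffun 'I_j -> 'I_d} => [ffun x => f (s x)])) /=.
    apply: eq_bigr => f _; rewrite perm_det; congr (_ * _).
    by apply: eq_bigr => i _; rewrite ffunE.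
  exists (fun f : {ffun 'I_j -> 'I_d} => [ffun x => f (s^-1%g x)]) => f _.
    by apply/ffunP => x; rewrite !ffunE permKV.
  by apply/ffunP => x; rewrite !ffunE permK.
rewrite exchange_big; apply: eq_bigr => f _; rewrite [X in _ = X * _]/determinant.
rewrite mulr_suml; apply: eq_bigr => s _; rewrite mulrCA mulrA; congr (_ * _ * _).
by apply: eq_bigr => i _; rewrite mxE.
Qed.

End CauchyBinet.

Section Minors.
Variables (R : realType) (b : base_field) (d j : nat).
Local Notation K := (scalars R b).
Local Notation sor := (@scalar_of_real R b).
Implicit Types (A B : 'M[K]_d) (r c : {ffun 'I_j -> 'I_d}) (s : 'rV[R]_d).

Definition minor A r c : K := \det (\matrix_(i < j, k < j) A (r i) (c k)).

(** Rows and columns range over all maps, so this is the square of [j!] times the sum of the moduli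
    of the entries of the [j]-th exterior power. *)
Definition minor_norm A : R := \sum_r \sum_c absv (minor A r c).

Lemma minor_mul A B r c :
  j`!%:R * minor (A *m B) r c = \sum_f minor A r f * minor B f c.
Proof.
rewrite /minor.
have -> : \matrix_(i, k) (A *m B) (r i) (c k) =
    (\matrix_(i, k) A (r i) k) *m (\matrix_(i, k) B i (c k)).
  by apply/matrixP => i k; rewrite !mxE; apply: eq_bigr => l _; rewrite !mxE.
rewrite cauchy_binet; apply: eq_bigr => f _; congr (_ * _); congr determinant;
  by apply/matrixP => i k; rewrite !mxE.
Qed.

Lemma minor_norm_ge0 A : 0 <= minor_norm A.
Proof. by apply: sumr_ge0 => r _; apply: sumr_ge0 => c _; exact: absv_ge0. Qed.

Lemma absv_minor_le A r c : absv (minor A r c) <= minor_norm A.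
Proof.
rewrite /minor_norm (bigD1 r) //= (bigD1 c) //= -addrA lerDl addr_ge0 //.
  by apply: sumr_ge0 => i _; exact: absv_ge0.
by apply: sumr_ge0 => r' _; apply: sumr_ge0 => c' _; exact: absv_ge0.
Qed.

Lemma minor_norm_mul A B : minor_norm (A *m B) <= minor_norm A * minor_norm B.
Proof.
have natK (n : nat) : n%:R = sor n%:R :> K.
  by elim: n => [|n IH]; rewrite ?scalar0 // -addn1 !natrD IH scalarD scalar1.
have step r c : absv (minor (A *m B) r c) <=
    \sum_f absv (minor A r f) * absv (minor B f c).
  have j1 : (1 : R) <= j`!%:R by rewrite ler1n fact_gt0.
  apply: (@le_trans _ _ (j`!%:R * absv (minor (A *m B) r c))).
    by rewrite ler_peMl ?absv_ge0.
  have -> : j`!%:R * absv (minor (A *m B) r c) = absv (j`!%:R * minor (A *m B) r c).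
    by rewrite absvM natK absv_scalar ger0_norm.
  rewrite minor_mul; apply: le_trans (absv_sum _ _ _) _.
  by apply: ler_sum => f _; rewrite absvM.
rewrite {1}/minor_norm.
apply: (@le_trans _ _ (\sum_r \sum_f absv (minor A r f) * \sum_c absv (minor B f c))).
  apply: ler_sum => r _; under [leRHS]eq_bigr do rewrite mulr_sumr.
  by rewrite exchange_big; apply: ler_sum => c _; exact: step.
rewrite /minor_norm mulr_suml; apply: ler_sum => r _; rewrite mulr_suml.
apply: ler_sum => f _; rewrite ler_wpM2l ?absv_ge0 //.
rewrite [leRHS](bigD1 f) //= lerDl; apply: sumr_ge0 => g _.
by apply: sumr_ge0 => c _; exact: absv_ge0.
Qed.

Definition unitary_bound : R :=
  \sum_(r : {ffun 'I_j -> 'I_d}) \sum_(c : {ffun 'I_j -> 'I_d}) j`!%:R.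

Lemma minor_norm_bounded A : (forall i k, absv (A i k) <= 1) ->
  minor_norm A <= unitary_bound.
Proof.
move=> A1; apply: ler_sum => r _; apply: ler_sum => c _.
by have := @absv_det_le R b j (\matrix_(i, k) A (r i) (c k)) 1; rewrite expr1n mulr1;
  apply => i k; rewrite mxE.
Qed.

Lemma minor_scale s (t : 'rV[R]_d) A r c :
  minor (real_diag b s *m A *m real_diag b t) r c =
  sor (\prod_i s 0 (r i)) * minor A r c * sor (\prod_i t 0 (c i)).
Proof.
rewrite /minor.
have -> : \matrix_(i < j, k < j) (real_diag b s *m A *m real_diag b t) (r i) (c k) =
    diag_mx (\row_i sor (s 0 (r i))) *m (\matrix_(i, k) A (r i) (c k)) *m
    diag_mx (\row_i sor (t 0 (c i))).
  by apply/matrixP => i k; rewrite /real_diag !mul_mx_diag !mul_diag_mx !mxE.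
rewrite !det_mulmx !det_diag !scalar_prod; congr (_ * _ * _);
  by apply: eq_bigr => i _; rewrite mxE.
Qed.

Definition top_product s : R := \prod_(i < d | (i < j)%N) s 0 i.

Hypotheses (j0 : (0 < j)%N) (jd : (j <= d)%N).

Definition top_index : {ffun 'I_j -> 'I_d} := [ffun i => widen_ord jd i].

Lemma top_indexE s : \prod_i s 0 (top_index i) = top_product s.
Proof.
rewrite /top_product (big_ord_narrow jd).
by apply: eq_bigr => i _; rewrite ffunE.
Qed.

(** The entries selected outside the first [j] are at most [t], the last of the first [j], while the
    missed ones among the first [j] are at least [t]; there are equally many of both. *)
Lemma prod_injective_le s (f : {ffun 'I_j -> 'I_d}) : injective f ->
  (forall i, 0 <= s 0 i) -> (forall i k : 'I_d, (i <= k)%N -> s 0 k <= s 0 i) ->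
  \prod_i s 0 (f i) <= top_product s.
Proof.
move=> finj s0 smono.
pose S := [set f i | i in 'I_j]%SET; pose J := [set i : 'I_d | (i < j)%N]%SET.
have cS : #|S| = j by rewrite card_imset // card_ord.
have cJ : #|J| = j.
  rewrite -[RHS]card_ord -(card_imset _ (_ : injective (widen_ord jd))).
    apply: eq_card => i; rewrite inE; apply/idP/imsetP => [ij|[k _ ->]]; last exact: (ltn_ord k).
    by exists (Ordinal ij) => //; exact: val_inj.
  by move=> x y [xy]; exact: val_inj.
have -> : \prod_i s 0 (f i) = \prod_(x in S) s 0 x.
  by rewrite big_imset //= => x y _ _; exact: finj.
have -> : top_product s = \prod_(x in J) s 0 x.
  by apply: eq_bigl => i; rewrite inE.
have tP : (j.-1 < d)%N by rewrite prednK.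
pose t := s 0 (Ordinal tP).
rewrite (big_setID J) [leRHS](big_setID S) /= finset.setIC; apply: ler_wpM2l.
  by apply: prodr_ge0.
apply: (@le_trans _ _ (t ^+ #|S :\: J|)).
  rewrite -prodr_const; apply: ler_prod => x; rewrite !inE -leqNgt => /andP[jx _].
  by rewrite s0 smono //= (leq_trans _ jx) // leq_pred.
have -> : #|S :\: J| = #|J :\: S|.
  by apply/eqP; rewrite -(eqn_add2l #|S :&: J|) cardsID finset.setIC cardsID cS cJ.
rewrite -prodr_const; apply: ler_prod => x; rewrite !inE => /andP[_ xj].
by rewrite s0 smono //= -ltnS prednK.
Qed.

Lemma minor_norm_diag_le s : (forall i, 0 <= s 0 i) ->
  (forall i k : 'I_d, (i <= k)%N -> s 0 k <= s 0 i) ->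
  minor_norm (real_diag b s) <= top_product s * minor_norm 1%:M.
Proof.
move=> s0 smono; rewrite /minor_norm mulr_sumr; apply: ler_sum => r _.
rewrite mulr_sumr; apply: ler_sum => c _.
have -> : minor (real_diag b s) r c = sor (\prod_i s 0 (r i)) * minor 1%:M r c.
  have := minor_scale s (const_mx 1) 1%:M r c.
  have -> : real_diag b (const_mx 1 : 'rV[R]_d) = 1%:M.
    by apply/matrixP => i k; rewrite !mxE scalar1.
  rewrite !mulmx1 => ->; rewrite [X in _ * _ X]big1 ?scalar1 ?mulr1 // => i _.
  by rewrite mxE.
rewrite absvM absv_scalar.
(* A repeated row kills the minor, so only injective selections of rows count. *)
have [rinj|/injectivePn[x [y xy rxy]]] := boolP (injectiveb r).
  rewrite ger0_norm ?prodr_ge0 // ler_wpM2r ?absv_ge0 //.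
  by apply: prod_injective_le => //; exact/injectiveP.
suff -> : minor 1%:M r c = 0 :> K by rewrite absv0 !mulr0.
by apply: (determinant_alternate xy) => k; rewrite !mxE rxy.
Qed.

Lemma minor_norm_scale_ge s (t : 'rV[R]_d) A : (forall i, 0 <= s 0 i) -> (forall i, 0 <= t 0 i) ->
  top_product s * absv (minor A top_index top_index) * top_product t <=
  minor_norm (real_diag b s *m A *m real_diag b t).
Proof.
move=> s0 t0; apply: le_trans (absv_minor_le _ top_index top_index).
rewrite minor_scale !absvM !absv_scalar !top_indexE !ger0_norm //;
  exact: prodr_ge0.
Qed.

End Minors.

(** * Sequential limits and compactness, uniformly over both fields *)

Section Limits.
Variables (R : realType) (b : base_field).
Local Notation K := (scalars R b).
Local Notation absv := (@absv R b).

Definition seq_lim (u : nat -> K) (a : K) := forall e : R, 0 < e ->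
  exists N, forall n, (N <= n)%N -> absv (u n - a) < e.

Lemma seq_lim_cst a : seq_lim (fun=> a) a.
Proof. by move=> e e0; exists 0%N => n _; rewrite subrr absv0. Qed.

Lemma seq_lim_sub u a phi : (forall i, i <= phi i)%N -> seq_lim u a -> seq_lim (u \o phi) a.
Proof.
move=> ip ua e /ua[N NP]; exists N => n Nn; apply: NP; exact: leq_trans (ip n).
Qed.

Lemma seq_limD u v a c : seq_lim u a -> seq_lim v c -> seq_lim (fun n => u n + v n) (a + c).
Proof.
move=> ua vc e e0; have e2 : 0 < e / 2 by rewrite divr_gt0.
have [N NP] := ua _ e2; have [N' NP'] := vc _ e2.
exists (maxn N N') => n; rewrite geq_max => /andP[n1 n2].
have -> : u n + v n - (a + c) = (u n - a) + (v n - c) by ring.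
apply: le_lt_trans (absvD _ _) _.
by have := NP n n1; have := NP' n n2; lra.
Qed.

Lemma seq_limM u v a c : seq_lim u a -> seq_lim v c -> seq_lim (fun n => u n * v n) (a * c).
Proof.
move=> ua vc e e0; pose M := absv a + absv c + 1.
have M0 : 0 < M by rewrite ltr_wpDl // addr_ge0 // absv_ge0.
have [e' [e'0 e'1 eM]] : exists e', [/\ 0 < e', e' <= 1 & e' * M <= e].
  exists (Num.min 1 (e / M)); rewrite lt_min ltr01 divr_gt0 // ge_min lexx; split=> //.
  by rewrite -ler_pdivlMr // ge_min lexx orbT.
have [N NP] := ua _ e'0; have [N' NP'] := vc _ e'0.
exists (maxn N N') => n; rewrite geq_max => /andP[n1 n2].
have -> : u n * v n - a * c = (u n - a) * (v n - c) + (u n - a) * c + a * (v n - c) by ring.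
apply: le_lt_trans (absvD _ _) _.
apply: le_lt_trans (lerD (absvD _ _) (lexx _)) _; rewrite !absvM.
apply: lt_le_trans eM; rewrite /M.
have := NP n n1; have := NP' n n2.
have := absv_ge0 (u n - a); have := absv_ge0 (v n - c).
have := absv_ge0 a; have := absv_ge0 c.
move: (absv (u n - a)) (absv (v n - c)) (absv a) (absv c) => x y p q.
move=> q0 p0 y0 x0 ye xe.
have xy : x * y < e'.
  apply: le_lt_trans (_ : x * 1 < e'); last by rewrite mulr1.
  by rewrite ler_wpM2l // (le_trans (ltW ye)).
have xq : x * q <= e' * q by rewrite ler_wpM2r // ltW.
have py : p * y <= p * e' by rewrite ler_wpM2l // ltW.
by lra.
Qed.

Lemma seq_lim_sum (I : Type) (r : seq I) (P : pred I) (u : I -> nat -> K) a :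
  (forall i, seq_lim (u i) (a i)) ->
  seq_lim (fun n => \sum_(i <- r | P i) u i n) (\sum_(i <- r | P i) a i).
Proof.
move=> ua; elim: r => [|i r IH].
  rewrite big_nil; under eq_fun do rewrite big_nil; exact: seq_lim_cst.
rewrite big_cons; under eq_fun do rewrite big_cons.
by case: ifP => // _; exact: seq_limD.
Qed.

Lemma seq_lim_prod (I : Type) (r : seq I) (P : pred I) (u : I -> nat -> K) a :
  (forall i, seq_lim (u i) (a i)) ->
  seq_lim (fun n => \prod_(i <- r | P i) u i n) (\prod_(i <- r | P i) a i).
Proof.
move=> ua; elim: r => [|i r IH].
  rewrite big_nil; under eq_fun do rewrite big_nil; exact: seq_lim_cst.
rewrite big_cons; under eq_fun do rewrite big_cons.
by case: ifP => // _; exact: seq_limM.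
Qed.

Lemma seq_lim_unique u a c : seq_lim u a -> seq_lim u c -> a = c.
Proof.
move=> ua uc; apply/eqP; rewrite -subr_eq0 -absv_eq0; apply/eqP/le_anti.
rewrite absv_ge0 andbT leNgt; apply/negP => e0.
have e2 : 0 < absv (a - c) / 2 by rewrite divr_gt0.
have [N NP] := ua _ e2; have [N' NP'] := uc _ e2.
have := NP _ (leq_maxl N N'); have := NP' _ (leq_maxr N N').
rewrite absv_distC; set x := u _ => H1 H2.
have : absv (a - c) <= absv (x - a) + absv (c - x).
  have -> : a - c = - ((x - a) + (c - x)) by ring.
  by rewrite absvN absvD.
by lra.
Qed.

Lemma seq_lim_conj u a : seq_lim u a ->
  seq_lim (fun n => scalar_conj (u n)) (scalar_conj a).
Proof.
move=> ua e /ua[N NP]; exists N => n /NP.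
suff -> : scalar_conj (u n) - scalar_conj a = scalar_conj (u n - a) by rewrite absv_conj.
by clear; move: (u n) a; case: b => //= x y; rewrite rmorphB.
Qed.

Lemma seq_lim_bounded u a : seq_lim u a ->
  exists2 B : R, 0 < B & exists N, forall n, (N <= n)%N -> absv (u n) <= B.
Proof.
move=> ua; have [N NP] := ua 1 ltr01; exists (absv a + 1).
  by rewrite ltr_wpDl ?absv_ge0.
exists N => n /NP; have : absv (u n) <= absv (u n - a) + absv a.
  by rewrite -{1}(subrK a (u n)) absvD.
by lra.
Qed.

Lemma seq_lim_away u a : seq_lim u a -> a != 0 ->
  exists2 c : R, 0 < c & exists N, forall n, (N <= n)%N -> c <= absv (u n).
Proof.
move=> ua a0; have c0 : 0 < absv a / 2 by rewrite divr_gt0 // absv_gt0.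
exists (absv a / 2) => //; have [N NP] := ua _ c0; exists N => n /NP.
have : absv a <= absv (u n) + absv (u n - a).
  have {1}-> : a = u n + - (u n - a) by ring.
  by rewrite -[absv (u n - a)]absvN absvD.
by lra.
Qed.

Definition mx_lim m n (A : nat -> 'M[K]_(m, n)) (A0 : 'M[K]_(m, n)) :=
  forall i j, seq_lim (fun k => A k i j) (A0 i j).

Lemma mx_lim_cst m n (A : 'M[K]_(m, n)) : mx_lim (fun=> A) A.
Proof. by move=> i j; exact: seq_lim_cst. Qed.

Lemma mx_lim_mul m n p (A : nat -> 'M[K]_(m, n)) (B : nat -> 'M[K]_(n, p)) A0 B0 :
  mx_lim A A0 -> mx_lim B B0 -> mx_lim (fun k => A k *m B k) (A0 *m B0).
Proof.
move=> AA BB i j; rewrite mxE; under eq_fun do rewrite mxE.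
by apply: seq_lim_sum => l; exact: seq_limM.
Qed.

Lemma mx_lim_unique m n (A : nat -> 'M[K]_(m, n)) A0 A1 :
  mx_lim A A0 -> mx_lim A A1 -> A0 = A1.
Proof. by move=> h0 h1; apply/matrixP => i j; exact: (seq_lim_unique (h0 i j) (h1 i j)). Qed.

Lemma seq_lim_det n (A : nat -> 'M[K]_n) A0 : mx_lim A A0 ->
  seq_lim (fun k => \det (A k)) (\det A0).
Proof.
move=> AA; apply: seq_lim_sum => s; apply: seq_limM; first exact: seq_lim_cst.
by apply: seq_lim_prod => i; exact: AA.
Qed.

Lemma mx_lim_adj n (A : nat -> 'M[K]_n) A0 : mx_lim A A0 ->
  mx_lim (fun k => \adj (A k)) (\adj A0).
Proof.
move=> AA i j; rewrite mxE; under eq_fun do rewrite mxE.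
apply: seq_limM; first exact: seq_lim_cst.
apply: seq_lim_det => x y; rewrite !mxE; under eq_fun do rewrite !mxE.
exact: AA.
Qed.

Lemma mx_lim_uniform m n (A : nat -> 'M[K]_(m, n)) A0 : mx_lim A A0 ->
  forall e : R, 0 < e -> exists N, forall k, (N <= k)%N -> forall i j, absv (A k i j - A0 i j) < e.
Proof.
move=> AA e e0.
have [N NP] := choice (fun ij : 'I_m * 'I_n => AA ij.1 ij.2 e e0).
exists (\max_ij N ij)%N => k Nk i j; apply: (NP (i, j)).
by apply: leq_trans Nk; exact: (leq_bigmax (i, j)).
Qed.

Lemma unitary_lim n (A : nat -> 'M[K]_n) A0 : (forall k, is_unitary (A k)) ->
  mx_lim A A0 -> is_unitary A0.
Proof.
move=> uA AA; apply: (@mx_lim_unique _ _ (fun k => A k *m (map_mx (@scalar_conj R b) (A k))^T)).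
  apply: mx_lim_mul => // i j; rewrite !mxE; under eq_fun do rewrite !mxE.
  exact: seq_lim_conj.
by under eq_fun do rewrite uA; exact: mx_lim_cst.
Qed.

End Limits.

Section Subsequences.
Variable R : realType.

(** The colour of level [m] is the integer part of [(u + 1) * 2 ^ m]; a subsequence along which
    every colour stabilises is Cauchy. *)
Lemma real_subsequence (I : countType) (u : I -> nat -> R) : (forall a n, `|u a n| <= 1) ->
  exists2 phi, subseq_index phi & forall a, exists x : R, forall e : R, 0 < e ->
    exists N, forall n, (N <= n)%N -> `|u a (phi n) - x| < e.
Proof.
move=> u1; pose c (am : I * nat) n := Num.truncn ((u am.1 n + 1) * (2 ^ am.2)%:R).
have u0 a n : 0 <= u a n + 1 by have := u1 a n; rewrite ler_norml => /andP[+ _]; lra.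
have c0 (am : I * nat) n : 0 <= (u am.1 n + 1) * (2 ^ am.2)%:R by rewrite mulr_ge0.
have [am n|phi iphi phiP] := @diagonal_subsequence _ c (fun am => (2 * 2 ^ am.2).+1).
  have /andP[+ _] := truncn_itv (c0 am n); rewrite -/(c am n) => cle.
  rewrite ltnS -(ler_nat R); apply: le_trans cle _; rewrite natrM ler_wpM2r //.
  by have := u1 am.1 n; rewrite ler_norml => /andP[_]; lra.
exists phi => // a.
have cau : cauchy ((u a \o phi) @ \oo).
  apply/cauchy_exP => e e0.
  have [m me] : exists m : nat, e^-1 < (2 ^ m)%:R.
    exists (Num.bound e^-1).
    have e1 : 0 <= e^-1 by rewrite invr_ge0 ltW.
    apply: lt_trans (archi_boundP e1) _; rewrite ltr_nat; exact: ltn_expl.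
  have [N NP] := phiP (a, m); exists (u a (phi N)).
  exists N => // n /= Nn; rewrite /ball /=.
  have := NP N n (leqnn _) Nn.
  have /andP[] := truncn_itv (c0 (a, m) (phi n)); have /andP[] := truncn_itv (c0 (a, m) (phi N)).
  rewrite /= -/(c (a, m) (phi n)) -/(c (a, m) (phi N)) => + + + + E; rewrite E.
  move: (c _ _) => t; rewrite -(addn1 t) natrD => h1 h2 h3 h4.
  have p0 : 0 < (2 ^ m)%:R :> R by rewrite ltr0n expn_gt0.
  have ep : 1 < e * (2 ^ m)%:R by rewrite -ltr_pdivrMl // mulr1.
  have : `|(u a (phi N) - u a (phi n)) * (2 ^ m)%:R| < 1 by rewrite ltr_norml; apply/andP; split; lra.
  rewrite normrM (gtr0_norm p0) => h; rewrite -(ltr_pM2r p0).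
  exact: lt_trans h ep.
have /cvg_ex[x xP] : cvg ((u a \o phi) @ \oo) by apply/cauchy_cvgP.
exists x => e e0; move/cvgrPdist_lt: xP => /(_ e e0)[N _ NP].
by exists N => n Nn; rewrite distrC; exact: (NP n Nn).
Qed.

Variable b : base_field.
Local Notation K := (scalars R b).
Local Notation absv := (@absv R b).

(** Coordinates with a zero imaginary part over the reals, so that one compactness argument serves
    both fields. *)
Lemma scalar_parts : exists (re im : K -> R) (mk : R -> R -> K), forall x y : K, forall r s : R,
  [/\ `|re x| <= absv x, `|im x| <= absv x &
      absv (x - mk r s) <= `|re x - r| + `|im x - s|].
Proof.
case: b.
  exists id, (fun=> 0), (fun r _ => r) => x _ r s; split=> //=.
    by rewrite normr0.
  by rewrite lerDl.
exists (@complex.Re R), (@complex.Im R), (@complex.Complex R) => x _ r s.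
rewrite !absv_complex; split.
- by rewrite -sqrtr_sqr ler_wsqrtr // lerDl sqr_ge0.
- by rewrite -sqrtr_sqr ler_wsqrtr // lerDr sqr_ge0.
case: x => x y /=.
have h0 : 0 <= `|x - r| + `|y - s| by rewrite addr_ge0.
rewrite -[leRHS]ger0_norm // -sqrtr_sqr ler_wsqrtr // [leRHS]sqrrD !real_normK ?num_real //.
by rewrite addrAC lerDl mulrn_wge0 // mulr_ge0.
Qed.

Lemma scalar_subsequence (I : countType) (u : I -> nat -> K) : (forall a n, absv (u a n) <= 1) ->
  exists2 phi, subseq_index phi & forall a, exists x : K, seq_lim (u a \o phi) x.
Proof.
move=> u1; have [re [im [mk mkP]]] := scalar_parts.
have [ac n|phi iphi phiP] := @real_subsequence (I * bool)%type
    (fun ac n => if ac.2 then re (u ac.1 n) else im (u ac.1 n)).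
  have [h1 h2 _] := mkP (u ac.1 n) 0 0 0.
  by case: ac.2; [apply: le_trans h1 _ | apply: le_trans h2 _].
exists phi => // a; have [r rP] := phiP (a, true); have [s sP] := phiP (a, false).
exists (mk r s) => e e0; have e2 : 0 < e / 2 by rewrite divr_gt0.
have [N NP] := rP _ e2; have [N' NP'] := sP _ e2.
exists (maxn N N') => n; rewrite geq_max => /andP[n1 n2].
have [_ _ h] := mkP (u a (phi n)) 0 r s; apply: le_lt_trans h _.
by have := NP n n1; have := NP' n n2; rewrite /=; lra.
Qed.

Lemma mx_subsequence (I : countType) d (A : I -> nat -> 'M[K]_d) :
  (forall a n i j, absv (A a n i j) <= 1) ->
  exists2 phi, subseq_index phi & forall a, exists A0, mx_lim (A a \o phi) A0.
Proof.
move=> A1; have [|phi iphi phiP] := @scalar_subsequence (I * ('I_d * 'I_d))%type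
  (fun t n => A t.1 n t.2.1 t.2.2); first by move=> *; exact: A1.
exists phi => // a; have [x xP] := choice (fun ij => phiP (a, ij)).
by exists (\matrix_(i, j) x (i, j)) => i j; rewrite mxE; exact: (xP (i, j)).
Qed.

Lemma unitary_absv_le d (A : 'M[K]_d) i j : is_unitary A -> absv (A i j) <= 1.
Proof.
move=> /matrixP/(_ i i); rewrite !mxE eqxx.
under eq_bigr => k _ do rewrite !mxE mul_conj.
rewrite -scalar_sum -[1%:R]scalar1 => /scalar_inj E.
have : absv (A i j) ^+ 2 <= 1.
  by rewrite -E (bigD1 j) //= lerDl sumr_ge0 // => k _; exact: sqr_ge0.
by rewrite -{1}(expr1n _ 2) ler_pXn2r // ?nnegrE ?absv_ge0.
Qed.

Lemma unitary_unitmx d (A : 'M[K]_d) : is_unitary A -> A \in unitmx.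
Proof. by move=> /mulmx1_unit[]. Qed.

Lemma open_GL_absv d (X : set 'M[K]_d) : X `<=` [set A | A \in unitmx] ->
  open (X : set (subspace [set A : 'M[K]_d | A \in unitmx])) <->
  forall A, X A -> exists2 e : R, 0 < e & forall B, B \in unitmx ->
    (forall i j, absv (B i j - A i j) < e) -> X B.
Proof.
move=> XGL; rewrite openE.
have nbE A : X A -> interior (X : set (subspace [set A : 'M[K]_d | A \in unitmx])) A =
    nbhs A [set B | B \in unitmx -> X B].
  by move=> /XGL/nbhs_subspace_in E; exact: (congr1 (fun F => F X) (esym E)).
split=> oX A XA; last first.
  have [e e0 eP] := oX A XA; rewrite (nbE A XA).
  apply/nbhs_ballP; exists (scalar_of_real b e).
    by rewrite /= -(scalar0 R b) scalar_lt.
  move=> B [_ AB] uB; apply: eP => // i j; rewrite -(scalar_lt b) scalar_absv distrC.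
  exact: AB.
have := oX A XA; rewrite (nbE A XA) => /nbhs_ballP[e /= e0 eP].
have [r re] : exists r : R, scalar_of_real b r = e.
  move: e e0 {eP}; case: b => /= e; first by exists e.
  rewrite ltcE /= => /andP[/eqP im0 _]; exists (complex.Re e).
  by case: e im0 => x y /= ->.
exists r; first by rewrite -(scalar_lt b) scalar0 re.
move=> B uB AB; apply: eP => //; split=> // i j.
rewrite /ball /= -re -scalar_absv scalar_lt absv_distC; exact: AB.
Qed.

End Subsequences.

(** * Flags and singular values *)

Section FirstColumns.
Variables (K : numFieldType) (d : nat).
Implicit Types (A B : 'M[K]_d) (k : nat).

Lemma mem_first_columns A k (v : 'cV[K]_d) : A \in unitmx ->
  v \in first_columns A k <-> forall i : 'I_d, (k < i)%N -> (invmx A *m v) i 0 = 0.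
Proof.
move=> uA; split=> [vA i ki|v0]; last first.
  have -> : v = \sum_(i < d | (i <= k)%N) (invmx A *m v) i 0 *: col i A.
    rewrite -[LHS](mulKVmx uA); apply/matrixP => i j.
    rewrite !mxE summxE (bigID (fun l : 'I_d => (l <= k)%N)) /= [X in _ + X]big1 ?addr0.
      by apply: eq_bigr => l _; rewrite !mxE mulrC (ord1 j).
    by move=> l; rewrite -ltnNge => kl; rewrite (ord1 j) v0 ?mulr0.
  apply: memv_suml => i ik; apply/memvZ/memv_span/map_f.
  by rewrite mem_filter ik mem_enum.
pose f : 'Hom('cV[K]_d, 'cV[K]_1) := linfun (fun u : 'cV[K]_d => row i (invmx A) *m u).
have fE u : f u = row i (invmx A) *m u by rewrite lfunE.
have : (first_columns A k <= lker f)%VS.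
  apply/span_subvP => _ /mapP[c + ->]; rewrite mem_filter => /andP[ck _].
  rewrite memv_ker fE -row_mul colE mulmxA mulVmx // mul1mx.
  apply/eqP/matrixP => x y; rewrite !mxE; case: eqP => // ic.
  by move: ck; rewrite -ic leqNgt ki.
move=> /subvP/(_ v vA); rewrite memv_ker fE => /eqP/matrixP/(_ 0 0).
by rewrite -row_mul !mxE.
Qed.

Lemma first_columns_sub A B k : A \in unitmx -> B \in unitmx ->
  (first_columns A k <= first_columns B k)%VS <->
  forall i c : 'I_d, (k < i)%N -> (c <= k)%N -> (invmx B *m A) i c = 0.
Proof.
move=> uA uB; split=> [AB i c ki ck|H].
  have cA : col c A \in first_columns A k.
    by apply/memv_span/map_f; rewrite mem_filter ck mem_enum.
  have /(mem_first_columns k _ uB)/(_ i ki) := subvP AB _ cA.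
  by rewrite colE mulmxA -colE mxE.
apply/span_subvP => _ /mapP[c + ->]; rewrite mem_filter => /andP[ck _].
apply/mem_first_columns => // i ki.
by rewrite colE mulmxA -colE mxE H.
Qed.

Lemma first_columns_eq A B k : A \in unitmx -> B \in unitmx -> (k < d)%N ->
  (forall i c : 'I_d, (k < i)%N -> (c <= k)%N -> (invmx B *m A) i c = 0) ->
  first_columns A k = first_columns B k.
Proof.
move=> uA uB kd /(first_columns_sub k uA uB) H.
by apply/eqP; rewrite eqEdim H /= !dim_first_columns.
Qed.

Lemma image_first_columns A B k :
  (linfun (mulmx A) @: first_columns B k)%VS = first_columns (A *m B) k.
Proof.
rewrite limg_span -map_comp; congr <<_>>%VS; apply: eq_map => i.
by rewrite /= lfunE /= !colE mulmxA.
Qed.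

End FirstColumns.

(** * The quotient topology on flags, expressed through frames *)

Section FlagTopology.
Variables (R : realType) (b : base_field) (d : nat) (theta : {set 'I_d.-1}).
Local Notation K := (scalars R b).
Local Notation absv := (@absv R b).
Local Notation flagT := (flag K theta).

Lemma theta_lt (k : 'I_d.-1) : (k < d)%N.
Proof. exact: leq_trans (ltn_ord k) (leq_pred d). Qed.

Lemma frames_over_sub (U : set flagT) : frames_over U `<=` [set A | A \in unitmx].
Proof. by move=> A [F []]. Qed.

Lemma open_flag_absv (U : set flagT) : open U <->
  forall A, frames_over U A -> exists2 e : R, 0 < e & forall B, B \in unitmx ->
    (forall i j, absv (B i j - A i j) < e) -> frames_over U B.
Proof. exact: (open_GL_absv (@frames_over_sub U)). Qed.

Lemma flag_cvg (A : nat -> 'M[K]_d) A0 (U : nat -> flagT) F :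
  (forall n, adapted_frame (A n) (U n)) -> adapted_frame A0 F -> mx_lim A A0 ->
  U @ \oo --> F.
Proof.
move=> AU AF AA V; rewrite nbhsE => -[W [oW WF] WV].
have [e e0 eP] := (open_flag_absv W).1 oW A0 (ex_intro2 _ _ F AF WF).
have [N NP] := mx_lim_uniform AA e0; exists N => // n /= Nn; apply: WV.
have [uA _] := AU n; have [F' AF' WF'] := eP (A n) uA (NP n Nn).
by rewrite (adapted_frame_inj (AU n) AF').
Qed.

(** The map from frames to flags is open. If [B], near [A0], and [C] frame the same flag and
    [B = C *m P], then a small perturbation [C'] of [C] spans the same flag as [C' *m P], which is
    still near [A0]. *)
Lemma flag_near_frame (f : nat -> flagT) F A0 : f @ \oo --> F -> adapted_frame A0 F ->
  forall e : R, 0 < e -> exists N, forall n, (N <= n)%N ->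
    exists2 B, adapted_frame B (f n) & forall i j, absv (B i j - A0 i j) < e.
Proof.
move=> fF AF e e0.
pose V := [set E : flagT | exists2 B, adapted_frame B E & forall i j, absv (B i j - A0 i j) < e].
have VF : V F by exists A0 => // i j; rewrite subrr absv0.
suff oV : open V.
  have : nbhs F V by rewrite nbhsE; exists V.
  by move=> /fF[N _ NP]; exists N => n Nn; exact: NP.
apply/open_flag_absv => C [E CE [B BE BA]].
have [uC CF] := CE; have [uB BF] := BE.
pose P := invmx C *m B.
have CP : C *m P = B by rewrite /P mulKVmx.
have uP : P \in unitmx by rewrite unitmx_mul unitmx_inv uC uB.
apply: contrapT => nC.
have seqC n : exists C', [/\ C' \in unitmx, forall i j, absv (C' i j - C i j) < n.+1%:R^-1 &
    ~ frames_over V C'].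
  apply: contrapT => nC'; apply: nC; exists n.+1%:R^-1; first by rewrite invr_gt0.
  move=> C' uC' C'C; apply: contrapT => nV; apply: nC'; by exists C'.
have [Cn CnP] := choice seqC.
have CnC : mx_lim Cn C.
  move=> i j r r0; exists (Num.bound r^-1) => n rn.
  have [_ /(_ i j) h _] := CnP n; apply: lt_trans h _.
  rewrite -[ltRHS]invrK ltf_pV2 ?posrE ?invr_gt0 //.
  have r1 : 0 <= r^-1 by rewrite invr_ge0 ltW.
  by apply: lt_le_trans (archi_boundP r1) _; rewrite ler_nat ltnW.
have CnB : mx_lim (fun n => Cn n *m P) B.
  by rewrite -CP; apply: mx_lim_mul => //; exact: mx_lim_cst.
have near (ij : 'I_d * 'I_d) : exists N, forall n, (N <= n)%N ->
    absv ((Cn n *m P) ij.1 ij.2 - A0 ij.1 ij.2) < e.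
  have e' : 0 < e - absv (B ij.1 ij.2 - A0 ij.1 ij.2) by rewrite subr_gt0.
  have [N NP] := CnB ij.1 ij.2 _ e'; exists N => n /NP.
  rewrite ltrBrDr; apply: le_lt_trans; apply: le_trans (absvD _ _).
  by rewrite addrA subrK.
have [N NP] := choice near.
pose n := (\max_ij N ij)%N.
have [uCn _ nV] := CnP n; apply: nV.
have [E' CE'] := adapted_frame_exists theta uCn.
exists E' => //; exists (Cn n *m P); last first.
  by move=> i j; apply: (NP (i, j)); exact: (leq_bigmax (i, j)).
have [_ CF'] := CE'.
split; first by rewrite unitmx_mul uCn uP.
move=> k; rewrite CF'; apply/esym/first_columns_eq => //.
- by rewrite unitmx_mul uCn uP.
- exact: theta_lt.
rewrite mulKmx //; apply/(first_columns_sub _ uB uC).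
by rewrite -BF -CF.
Qed.

Lemma adapted_frame_act (A B : 'M[K]_d) (E F : flagT) : A \in unitmx ->
  adapted_frame B E -> (forall k, F k = (linfun (mulmx A) @: E k)%VS) ->
  adapted_frame (A *m B) F.
Proof.
move=> uA [uB BE] FE; split; first by rewrite unitmx_mul uA.
by move=> k; rewrite FE BE image_first_columns.
Qed.

End FlagTopology.

(** * Singular value decompositions: inverses and uniqueness *)

Section SVD.
Variables (R : realType) (b : base_field) (d : nat).
Local Notation K := (scalars R b).
Local Notation absv := (@absv R b).
Local Notation sor := (@scalar_of_real R b).
Local Notation conj := (@scalar_conj R b).

Lemma conjM x y : conj (x * y) = conj x * conj y.
Proof. by move: x y; case: b => //= x y; rewrite rmorphM. Qed.

Lemma conjD x y : conj (x + y) = conj x + conj y.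
Proof. by move: x y; case: b => //= x y; rewrite rmorphD. Qed.

Lemma conj_scalar r : conj (sor r) = sor r.
Proof. by case: b => //; exact: conjc_real. Qed.

Lemma conjK x : conj (conj x) = x.
Proof. by move: x; case: b => //= x; rewrite conjcK. Qed.

Lemma conj_sum (I : Type) (r : seq I) (P : pred I) (F : I -> K) :
  conj (\sum_(i <- r | P i) F i) = \sum_(i <- r | P i) conj (F i).
Proof.
by apply: (big_morph _ conjD); rewrite -(scalar0 R b) conj_scalar.
Qed.

Definition adjoint (A : 'M[K]_d) : 'M[K]_d := (map_mx conj A)^T.

Lemma adjointM A B : adjoint (A *m B) = adjoint B *m adjoint A.
Proof.
apply/matrixP => i j; rewrite !mxE conj_sum; apply: eq_bigr => k _.
by rewrite !mxE conjM mulrC.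
Qed.

Lemma adjointK A : adjoint (adjoint A) = A.
Proof. by apply/matrixP => i j; rewrite !mxE conjK. Qed.

Lemma adjoint_diag (s : 'rV[R]_d) : adjoint (real_diag b s) = real_diag b s.
Proof.
apply/matrixP => i j; rewrite !mxE eq_sym; case: eqP => [->|_].
  by rewrite !mulr1n conj_scalar.
by rewrite !mulr0n -(scalar0 R b) conj_scalar.
Qed.

Lemma unitaryE (k : 'M[K]_d) : is_unitary k <-> k *m adjoint k = 1%:M.
Proof. by []. Qed.

Lemma unitary_inv (k : 'M[K]_d) : is_unitary k -> invmx k = adjoint k.
Proof.
move=> uk; rewrite -[RHS](mulKmx (unitary_unitmx uk)).
by rewrite (uk : k *m adjoint k = _) mulmx1.
Qed.

Lemma unitaryV (k : 'M[K]_d) : is_unitary k -> is_unitary (invmx k).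
Proof.
move=> uk; apply/unitaryE; rewrite [in adjoint _]unitary_inv // adjointK.
by rewrite mulVmx // unitary_unitmx.
Qed.

Lemma unitaryM (k l : 'M[K]_d) : is_unitary k -> is_unitary l -> is_unitary (k *m l).
Proof.
move=> uk ul; apply/unitaryE; rewrite adjointM -mulmxA (mulmxA l).
by rewrite (ul : l *m adjoint l = _) mul1mx.
Qed.

Lemma unitaryZ (c : K) (k : 'M[K]_d) : absv c = 1 -> is_unitary k -> is_unitary (c *: k).
Proof.
move=> c1 uk; apply/unitaryE.
have -> : adjoint (c *: k) = conj c *: adjoint k.
  by apply/matrixP => i j; rewrite !mxE conjM.
rewrite -scalemxAl -scalemxAr scalerA mul_conj c1 expr1n scalar1 scale1r.
exact: uk.
Qed.

(** A representative of the longest Weyl element: conjugation by it restores the decreasing order of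
    the singular values after inversion. *)
Definition reversal : 'M[K]_d := \matrix_(i, j) (j == rev_ord i)%:R.

Lemma mul_reversal (A : 'M[K]_d) i j : (A *m reversal) i j = A i (rev_ord j).
Proof.
rewrite mxE (bigD1 (rev_ord j)) //= mxE rev_ordK eqxx mulr1 big1 ?addr0 // => k kj.
rewrite mxE; case: eqP => [jk|]; last by rewrite mulr0.
by move: kj; rewrite jk rev_ordK eqxx.
Qed.

Lemma reversalK : reversal *m reversal = 1%:M.
Proof. by apply/matrixP => i j; rewrite mul_reversal !mxE (inj_eq rev_ord_inj) eq_sym. Qed.

Lemma reversal_unitary : is_unitary reversal.
Proof.
apply/unitaryE; suff -> : adjoint reversal = reversal by exact: reversalK.
apply/matrixP => i j; rewrite !mxE -(inj_eq rev_ord_inj) rev_ordK eq_sym.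
case: eqP => _; rewrite ?mulr1n ?mulr0n.
  by rewrite -(scalar1 R b) conj_scalar.
by rewrite -(scalar0 R b) conj_scalar.
Qed.

Lemma reversal_diag (s : 'rV[R]_d) :
  reversal *m real_diag b s *m reversal = real_diag b (\row_i s 0 (rev_ord i)).
Proof.
apply/matrixP => i j; rewrite mul_reversal mul_mx_diag !mxE (inj_eq rev_ord_inj) eq_sym.
by case: eqP => [->|_]; rewrite ?mul1r ?mul0r ?mulr1n ?mulr0n.
Qed.

Lemma real_diag_unit (s : 'rV[R]_d) : (forall i, 0 < s 0 i) ->
  real_diag b s *m real_diag b (\row_i (s 0 i)^-1) = 1%:M.
Proof.
move=> s0; apply/matrixP => i j; rewrite mul_diag_mx !mxE; case: eqP => [->|_].
  by rewrite !mulr1n -scalarM mulfV ?gt_eqF // scalar1.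
by rewrite mulr0n mulr0.
Qed.

Lemma svd_inv (A k l : 'M[K]_d) (s : 'rV[R]_d) : (forall i, 0 < s 0 i) ->
  is_svd A k s l ->
  is_svd (invmx A) (invmx l *m reversal) (\row_i (s 0 (rev_ord i))^-1)
    (reversal *m invmx k).
Proof.
move=> spos [uk ul s0 smono ->]; split.
- by apply: unitaryM; [exact: unitaryV | exact: reversal_unitary].
- by apply: unitaryM; [exact: reversal_unitary | exact: unitaryV].
- by move=> i; rewrite mxE invr_ge0.
- move=> i j ij; rewrite !mxE lef_pV2 ?posrE //; apply: smono.
  by rewrite /= leq_sub2l // ltnS.
have -> : real_diag b (\row_i (s 0 (rev_ord i))^-1) =
    reversal *m real_diag b (\row_i (s 0 i)^-1) *m reversal.
  by rewrite reversal_diag; congr real_diag; apply/rowP => i; rewrite !mxE.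
have DD := real_diag_unit spos; have [uD _] := mulmx1_unit DD.
have uk' := unitary_unitmx uk; have ul' := unitary_unitmx ul.
have -> : invmx (k *m real_diag b s *m l) = invmx l *m invmx (real_diag b s) *m invmx k.
  have uA : k *m real_diag b s *m l \in unitmx by rewrite !unitmx_mul uk' uD ul'.
  apply: (can_inj (mulKmx uA)); rewrite mulmxV //.
  by rewrite -!mulmxA (mulmxA l) mulmxV // mul1mx (mulmxA (real_diag b s)) mulmxV // mul1mx mulmxV.
have -> : invmx (real_diag b s) = real_diag b (\row_i (s 0 i)^-1).
  by rewrite -[RHS](mulKmx uD) DD mulmx1.
by rewrite !mulmxA -(mulmxA _ reversal reversal) reversalK mulmx1
  -(mulmxA _ reversal reversal) reversalK mulmx1.
Qed.

Lemma svdZ (c : K) (A k l : 'M[K]_d) (s : 'rV[R]_d) : absv c = 1 ->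
  is_svd A k s l -> is_svd (c *: A) (c *: k) s l.
Proof.
move=> c1 [uk ul s0 smono ->]; split=> //; first exact: unitaryZ.
by rewrite -!scalemxAl.
Qed.

Lemma char_poly_conjugate (k k' M : 'M[K]_d) : k *m k' = 1%:M ->
  char_poly (k *m M *m k') = char_poly M.
Proof.
move=> kk; have [uk _] := mulmx1_unit kk.
have kkP : map_mx polyC k *m map_mx polyC k' = 1%:M by rewrite -map_mxM kk map_mx1.
have E : char_poly_mx (k *m M *m k') =
    map_mx polyC k *m char_poly_mx M *m map_mx polyC k'.
  rewrite /char_poly_mx !map_mxM mulmxBr mulmxBl; congr (_ - _).
  by rewrite scalar_mxC -mulmxA kkP mulmx1.
rewrite /char_poly E !det_mulmx mulrAC -det_mulmx.
by rewrite kkP det1 mul1r.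
Qed.

(** The squares of the singular values are the roots of the characteristic polynomial of
    [A *m adjoint A], and a decreasing list is determined by its multiset of entries. *)
Lemma svd_unique (A k l k' l' : 'M[K]_d) (s s' : 'rV[R]_d) :
  is_svd A k s l -> is_svd A k' s' l' -> s = s'.
Proof.
have gram (k1 l1 : 'M[K]_d) (t : 'rV[R]_d) : is_svd A k1 t l1 ->
    char_poly (A *m adjoint A) = \prod_(x <- [seq sor (t 0 i ^+ 2) | i <- enum 'I_d]) ('X - x%:P).
  move=> [uk ul t0 tmono ->].
  have -> : k1 *m real_diag b t *m l1 *m adjoint (k1 *m real_diag b t *m l1) =
      k1 *m (real_diag b t *m real_diag b t) *m adjoint k1.
    rewrite !adjointM adjoint_diag -!mulmxA (mulmxA l1).
    by rewrite (ul : l1 *m adjoint l1 = _) mul1mx.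
  rewrite char_poly_conjugate // char_poly_trig; last first.
    apply/is_trig_mxP => i j ij; rewrite mul_mx_diag !mxE.
    by rewrite -val_eqE ltn_eqF // mulr0n mul0r.
  rewrite big_map [RHS]big_enum /=; apply: eq_bigr => i _.
  by rewrite mul_mx_diag !mxE eqxx mulr1n -scalarM expr2.
move=> S S'; have := gram _ _ _ S; rewrite (gram _ _ _ S') => /prod_XsubC_eq.
move=> /(perm_map (fun x : K => Num.sqrt (absv x))).
have simp (t : 'rV[R]_d) : (forall i, 0 <= t 0 i) ->
    [seq Num.sqrt (absv x) | x <- [seq sor (t 0 i ^+ 2) | i <- enum 'I_d]] =
    [seq t 0 i | i <- enum 'I_d].
  move=> t0; rewrite -map_comp; apply: eq_map => i /=.
  by rewrite absv_scalar ger0_norm ?sqr_ge0 // sqrtr_sqr ger0_norm.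
case: S S' => _ _ s0 smono _ [_ _ s0' smono' _].
rewrite !simp // perm_sym => pe.
have sorted_row (t : 'rV[R]_d) : (forall i j : 'I_d, (i <= j)%N -> t 0 j <= t 0 i) ->
    sorted (fun x y : R => y <= x) [seq t 0 i | i <- enum 'I_d].
  move=> tmono; apply: (homo_sorted (e := fun i j : 'I_d => (i <= j)%N)) => //.
  by have := iota_sorted 0 d; rewrite -val_enum_ord sorted_map.
have E : [seq s 0 i | i <- enum 'I_d] = [seq s' 0 i | i <- enum 'I_d].
  apply: (@sorted_eq _ (fun x y : R => y <= x)) => //; try exact: sorted_row.
  - by move=> y x z xy yz; exact: le_trans yz xy.
  - by move=> x y; rewrite andbC => /le_anti.
by apply/rowP => i; move/eq_in_map: E => /(_ i); rewrite mem_enum; apply.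
Qed.

End SVD.

(** * Attracting flags of diverging sequences *)

Section Dynamics.
Variables (R : realType) (b : base_field) (d : nat) (theta : {set 'I_d.-1}).
Local Notation K := (scalars R b).
Local Notation absv := (@absv R b).
Local Notation sor := (@scalar_of_real R b).
Local Notation flagT := (flag K theta).

Lemma seq_lim_null (u : nat -> K) a (r : nat -> R) : seq_lim u a ->
  (forall n, 0 <= r n) ->
  (forall e : R, 0 < e -> exists N, forall n, (N <= n)%N -> r n <= e) ->
  forall v : nat -> K, (forall n, absv (v n) <= r n * absv (u n)) -> seq_lim v 0.
Proof.
move=> ua r0 rlim v vu e e0.
have [B B0 [N NP]] := seq_lim_bounded ua.
have e' : 0 < e / (2 * B) by rewrite divr_gt0 // mulr_gt0.
have [N' NP'] := rlim _ e'; exists (maxn N N') => n; rewrite geq_max => /andP[n1 n2].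
rewrite subr0; apply: le_lt_trans (vu n) _.
apply: (@le_lt_trans _ _ (e / (2 * B) * B)).
  by apply: ler_pM => //; [exact: absv_ge0 | exact: NP' | exact: NP].
have -> : e / (2 * B) * B = e / 2 by field; rewrite gt_eqF.
by lra.
Qed.

Variable k : 'I_d.-1.
Local Notation kd := (theta_lt k).

Definition top_block (A : 'M[K]_d) : 'M[K]_k.+1 :=
  \matrix_(i, c) A (widen_ord kd i) (widen_ord kd c).

Lemma top_block_minor A : \det (top_block A) = minor A (top_index kd) (top_index kd).
Proof. by congr determinant; apply/matrixP => i c; rewrite !mxE !ffunE. Qed.

Lemma widen_inord (i : 'I_d) : (i <= k)%N -> widen_ord kd (inord i) = i.
Proof. by move=> ik; apply: val_inj; rewrite /= inordK. Qed.

(* [C *m adj_block C] is [\det (top_block C)] times the identity on the first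
   [k.+1] rows and columns; it avoids inverting the block. *)
Definition adj_block (C : 'M[K]_d) : 'M[K]_d :=
  \matrix_(a, c) if (a <= k)%N && (c <= k)%N
    then (\adj (top_block C)) (inord a) (inord c) else 0.

Lemma mul_adj_block C (i c : 'I_d) : (i <= k)%N -> (c <= k)%N ->
  (C *m adj_block C) i c = \det (top_block C) *+ (i == c).
Proof.
move=> ik ck; rewrite mxE (bigID (fun a : 'I_d => (a <= k)%N)) /= [X in _ + X]big1 ?addr0.
  rewrite (big_ord_narrow kd) /=.
  have := mul_mx_adj (top_block C) => /matrixP/(_ (inord i) (inord c)).
  rewrite !mxE => E.
  have -> : (i == c) = (inord i == inord c :> 'I_k.+1).
    by rewrite -!val_eqE /= !inordK.
  rewrite -E; apply: eq_bigr => x _; have xk : (x <= k)%N by rewrite -ltnS ltn_ord.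
  by rewrite [top_block C _ _]mxE widen_inord // mxE /= xk ck inord_val.
by move=> a ak; rewrite mxE (negbTE ak) mulr0.
Qed.

Lemma mx_lim_adj_block (C : nat -> 'M[K]_d) C0 : mx_lim C C0 ->
  mx_lim (fun n => adj_block (C n)) (adj_block C0).
Proof.
move=> CC a c; rewrite mxE; under eq_fun do rewrite mxE.
case: ifP => _; last exact: seq_lim_cst.
by apply: mx_lim_adj => i j; rewrite mxE; under eq_fun do rewrite mxE; exact: CC.
Qed.

(** Right multiplication by [X n] normalises the leading columns: in [Z n] the leading block is a
    scalar tending to [del], and the entries below it carry ratios [s i / s c] with [c <= k < i],
    which tend to 0. Hence the [k]-th part of [V n] contains vectors converging to [del] times the
    leading columns of [k0]. *)
Lemma attracting_limit (kn ln : nat -> 'M[K]_d) (s : nat -> 'rV[R]_d) k0 l0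
    (B : 'M[K]_d) (V : nat -> flagT) (V0 : flagT) A0 :
  k \in theta ->
  mx_lim kn k0 -> mx_lim ln l0 -> k0 \in unitmx -> (forall n, kn n \in unitmx) ->
  (forall n i, 0 < s n 0 i) ->
  (forall n (i j : 'I_d), (i <= j)%N -> s n 0 j <= s n 0 i) ->
  (forall e : R, 0 < e -> exists N, forall n, (N <= n)%N ->
     s n 0 (root_snd k) <= e * s n 0 (root_fst k)) ->
  \det (top_block (l0 *m B)) != 0 ->
  (forall n, adapted_frame (kn n *m real_diag b (s n) *m ln n *m B) (V n)) ->
  V @ \oo --> V0 -> adapted_frame A0 V0 ->
  first_columns k0 k = first_columns A0 k.
Proof.
move=> kth klim llim uk0 ukn spos smono gap det0 VF VV AV.
have [uA0 _] := AV; pose th : {k : 'I_d.-1 | k \in theta} := exist _ k kth.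
have near m : exists nB : nat * 'M[K]_d, [/\ (m <= nB.1)%N, adapted_frame nB.2 (V nB.1) &
    forall i j, absv (nB.2 i j - A0 i j) < m.+1%:R^-1].
  have m0 : 0 < m.+1%:R^-1 :> R by rewrite invr_gt0.
  have [N NP] := flag_near_frame VV AV m0.
  have [Bm Bm1 Bm2] := NP (maxn N m) (leq_maxl _ _).
  by exists (maxn N m, Bm); split=> //; exact: leq_maxr.
have [nB nBP] := choice near.
pose ix m := (nB m).1; pose Bn m := (nB m).2.
have ixm m : (m <= ix m)%N by have [] := nBP m.
have BA : mx_lim Bn A0.
  move=> i j r r0; exists (Num.bound r^-1) => n rn.
  have [_ _ /(_ i j) h] := nBP n; apply: lt_trans h _.
  rewrite -[ltRHS]invrK ltf_pV2 ?posrE ?invr_gt0 //.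
  have r1 : 0 <= r^-1 by rewrite invr_ge0 ltW.
  by apply: lt_le_trans (archi_boundP r1) _; rewrite ler_nat ltnW.
pose C n := ln n *m B.
have CC : mx_lim C (l0 *m B) by apply: mx_lim_mul => //; exact: mx_lim_cst.
pose D n := C n *m adj_block (C n).
have DD : mx_lim D ((l0 *m B) *m adj_block (l0 *m B)).
  by apply: mx_lim_mul => //; exact: mx_lim_adj_block.
pose del := \det (top_block (l0 *m B)).
have ddel : seq_lim (fun n => \det (top_block (C n))) del.
  by apply: seq_lim_det => i j; rewrite mxE; under eq_fun do rewrite mxE; exact: CC.
pose X n : 'M[K]_d := \matrix_(a, c) (adj_block (C n) a c * sor ((s n 0 c)^-1)).
pose Z n := real_diag b (s n) *m C n *m X n.
have ZE n (i c : 'I_d) : Z n i c = sor (s n 0 i / s n 0 c) * D n i c.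
  rewrite /Z -mulmxA mul_diag_mx !mxE scalarM -!mulrA; congr (_ * _).
  rewrite mulr_sumr; apply: eq_bigr => a _; rewrite !mxE; ring.
have Zlim (i c : 'I_d) : (c <= k)%N -> seq_lim (fun n => Z n i c) (del *+ (i == c)).
  move=> ck; case: (leqP i k) => ik.
    have -> : (fun n => Z n i c) = (fun n => \det (top_block (C n)) *+ (i == c)).
      apply/funext => n; rewrite ZE /D mul_adj_block //.
      case: (eqVneq i c) => [->|ic]; last by rewrite !mulr0n mulr0.
      by rewrite divff ?gt_eqF // scalar1 mul1r.
    by case: (i == c); [exact: ddel | exact: seq_lim_cst].
  have -> : (i == c) = false by apply/negP => /eqP ic; move: ik; rewrite ic ltnNge ck.
  rewrite mulr0n.
  pose r n := s n 0 (root_snd k) / s n 0 (root_fst k).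
  have r0 n : 0 <= r n by rewrite divr_ge0 // ltW.
  apply: (seq_lim_null (DD i c) r0) => [e e0|n]; last rewrite ZE.
    have [N NP] := gap e e0; exists N => n /NP.
    by rewrite /r ler_pdivrMr.
  rewrite absvM absv_scalar ler_wpM2r ?absv_ge0 //.
  have q0 : 0 <= s n 0 i / s n 0 c by apply: divr_ge0; exact: ltW.
  rewrite (ger0_norm q0) /r.
  apply: ler_pM => //; [exact: ltW | by rewrite invr_ge0 ltW | exact: smono |].
  by rewrite lef_pV2 ?posrE //; apply: smono.
pose Y n := kn n *m Z n.
pose Z0 : 'M[K]_d := \matrix_(i, c) if (c <= k)%N then del *+ (i == c) else 0.
(* That the leading columns of [Y] lie in the parts of the flags means that the lower entries of
   [\adj (Bn m) *m Y (ix m)] vanish; with the adjugate this is a polynomial condition and passes to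
   the limit. *)
have Ylim (i c : 'I_d) : (c <= k)%N -> seq_lim (fun m => (\adj (Bn m) *m Y (ix m)) i c)
    ((\adj A0 *m (k0 *m Z0)) i c).
  move=> ck; rewrite mxE; under eq_fun do rewrite mxE.
  apply: seq_lim_sum => a; apply: seq_limM; first exact: (mx_lim_adj BA).
  rewrite mxE; under eq_fun do rewrite mxE.
  apply: seq_lim_sum => e; apply: seq_limM.
    exact: (seq_lim_sub ixm (klim a e)).
  by rewrite mxE ck; exact: (seq_lim_sub ixm (Zlim e c ck)).
have Yzero m (i c : 'I_d) : (k < i)%N -> (c <= k)%N -> (\adj (Bn m) *m Y (ix m)) i c = 0.
  move=> ki ck; have [_ [uB BV] _] := nBP m; have [uH HV] := VF (ix m).
  set H := kn _ *m _ *m _ *m _ in uH HV.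
  have YE : Y (ix m) = H *m X (ix m) by rewrite /Y /Z /C /H !mulmxA.
  rewrite YE mulmxA mxE big1 // => a _.
  have [ak|ka] := leqP a k; last by rewrite !mxE leqNgt ka /= mul0r mulr0.
  have HB : (first_columns H k <= first_columns (Bn m) k)%VS.
    by rewrite -(HV th) -(BV th).
  have := (first_columns_sub k uH uB).1 HB i a ki ak.
  rewrite /invmx uB -scalemxAl mxE => /eqP; rewrite mulf_eq0 invr_eq0.
  move: (uB); rewrite unitmxE unitfE => /negbTE -> /= /eqP ->.
  by rewrite mul0r.
apply: first_columns_eq => //; first exact: theta_lt.
move=> i c ki ck.
have : (\adj A0 *m (k0 *m Z0)) i c = 0.
  apply: (seq_lim_unique (Ylim i c ck)); under eq_fun do rewrite Yzero //.
  exact: seq_lim_cst.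
rewrite mulmxA mxE (bigD1 c) //= big1 ?addr0; last first.
  by move=> a ac; rewrite [Z0 _ _]mxE ck (negbTE ac) mulr0n mulr0.
rewrite [Z0 _ _]mxE ck eqxx mulr1n => /eqP; rewrite mulf_eq0 (negbTE det0) orbF => /eqP E.
by rewrite /invmx uA0 -scalemxAl mxE E mulr0.
Qed.

(** A kernel vector of the block yields [x] in the part of [E] of dimension [k.+1] such that the
    first [k.+1] coordinates of [l *m x] vanish. The latter says that [x] lies in the complementary
    part of [F], so transversality forces [x = 0]. *)
Lemma transverse_top_block (E F : flagT) (B l : 'M[K]_d) (kth : k \in theta)
    (rkth : rev_ord k \in theta) : l \in unitmx ->
  adapted_frame B E -> adapted_frame (invmx l *m reversal R b d) F ->
  transverse_flags E F -> \det (top_block (l *m B)) != 0.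
Proof.
move=> ul [uB BE] [uF FF] EF; rewrite -det_tr; apply/negP => /det0P[v v0 vM].
pose th : {k : 'I_d.-1 | k \in theta} := exist _ k kth.
pose rth : {k : 'I_d.-1 | k \in theta} := exist _ (rev_ord k) rkth.
pose u : 'cV[K]_d := \col_i if (i <= k)%N then v 0 (inord i) else 0.
pose x := B *m u.
have xE : x \in E th.
  rewrite BE; apply/mem_first_columns => // i ki.
  by rewrite mulKmx // mxE leqNgt ki.
have lx (i : 'I_d) : (i <= k)%N -> (l *m x) i 0 = 0.
  move=> ik; rewrite /x mulmxA mxE (bigID (fun a : 'I_d => (a <= k)%N)) /= [X in _ + X]big1 ?addr0.
    rewrite (big_ord_narrow kd) /=.
    have /matrixP/(_ 0 (inord i)) := vM; rewrite mxE [in RHS]mxE => E0.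
    rewrite -[RHS]E0; apply: eq_bigr => a _; have ak : (a <= k)%N by rewrite -ltnS ltn_ord.
    rewrite [(top_block _)^T _ _]mxE [top_block _ _ _]mxE widen_inord //.
    by rewrite [u _ _]mxE /= ak inord_val mulrC.
  by move=> a ak; rewrite [u _ _]mxE (negbTE ak) mulr0.
have xF : x \in F rth.
  rewrite FF; apply/mem_first_columns => // i ki.
  have -> : invmx (invmx l *m reversal R b d) = reversal R b d *m l.
    apply: (can_inj (mulKmx uF)); rewrite mulmxV // -!mulmxA (mulmxA (reversal _ _ _)).
    by rewrite reversalK mul1mx mulVmx.
  rewrite -mulmxA mxE (bigD1 (rev_ord i)) //= big1 ?addr0; last first.
    by move=> a ai; rewrite mxE (negbTE ai) mul0r.
  by rewrite lx ?mulr0 //=; move: ki (ltn_ord i) (ltn_ord k) => /=; lia.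
have [_ /directv_addP cap] : (E th + F rth = fullv)%VS /\ directv (E th + F rth).
  by apply: EF => /=; move: (ltn_ord k); lia.
have : x \in (E th :&: F rth)%VS by rewrite memv_cap xE.
rewrite cap memv0 => /eqP x0; move: v0; rewrite (_ : v = 0) ?eqxx //.
have u0 : u = 0 by rewrite -(mulKmx uB u) -/x x0 mulmx0.
apply/rowP => a; have /matrixP/(_ (widen_ord kd a) 0) := u0.
by rewrite !mxE /= -ltnS ltn_ord inord_val.
Qed.

End Dynamics.

(** * Norms of exterior powers compared with products of singular values *)

Section MinorNorms.
Variables (R : realType) (b : base_field) (d : nat) (k : 'I_d.-1).
Local Notation K := (scalars R b).
Local Notation absv := (@absv R b).
Local Notation N := (@minor_norm R b d k.+1).
Local Notation kd := (theta_lt k).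
Local Notation top := (@top_product R d k.+1).

Lemma minor_normZ (c : K) A : absv c = 1 -> N (c *: A) = N A.
Proof.
move=> c1; apply: eq_bigr => r _; apply: eq_bigr => e _; rewrite /minor.
have -> : \matrix_(i < k.+1, j < k.+1) (c *: A) (r i) (e j) =
    c *: \matrix_(i < k.+1, j < k.+1) A (r i) (e j).
  by apply/matrixP => i j; rewrite !mxE.
by rewrite detZ absvM absvX c1 expr1n mul1r.
Qed.

Lemma minor_norm1_gt0 : 0 < N 1%:M.
Proof.
apply: lt_le_trans (absv_minor_le _ (top_index kd) (top_index kd)).
rewrite -top_block_minor; have -> : top_block k (1%:M : 'M[K]_d) = 1%:M.
  by apply/matrixP => i c; rewrite !mxE -!val_eqE.
by rewrite det1 absv1.
Qed.

Lemma minor_norm_gt0 (A : 'M[K]_d) : A \in unitmx -> 0 < N A.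
Proof.
move=> uA; rewrite lt_neqAle minor_norm_ge0 andbT eq_sym; apply/eqP => A0.
have := @minor_norm_mul R b d k.+1 A (invmx A).
by rewrite mulmxV // A0 mul0r leNgt minor_norm1_gt0.
Qed.

Definition svd_const : R := unitary_bound R d k.+1 ^+ 2 * (1 + N 1%:M).

Lemma unitary_bound_gt0 : 0 < unitary_bound R d k.+1.
Proof.
apply: lt_le_trans minor_norm1_gt0 _; apply: minor_norm_bounded => i j.
by rewrite mxE; case: (i == j); rewrite ?absv1 ?absv0.
Qed.

Lemma minor_norm_unitary A : is_unitary A -> N A <= unitary_bound R d k.+1.
Proof. by move=> uA; apply: minor_norm_bounded => i j; exact: unitary_absv_le. Qed.

Lemma minor_norm_mul_unitary (u A v : 'M[K]_d) : is_unitary u -> is_unitary v ->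
  N (u *m A *m v) <= unitary_bound R d k.+1 ^+ 2 * N A.
Proof.
move=> uu uv; apply: le_trans (minor_norm_mul _ _ _) _.
apply: le_trans (ler_wpM2r (minor_norm_ge0 _ _) (minor_norm_mul _ _ _)) _.
rewrite expr2 mulrAC; apply: ler_wpM2r; first exact: minor_norm_ge0.
by apply: ler_pM; rewrite ?minor_norm_ge0 ?minor_norm_unitary.
Qed.

Lemma svd_norm_le (A u v : 'M[K]_d) s : is_svd A u s v -> N A <= svd_const * top s.
Proof.
move=> [uu uv s0 smono ->]; apply: le_trans (minor_norm_mul_unitary _ uu uv) _.
rewrite /svd_const -mulrA; apply: ler_wpM2l; first exact: sqr_ge0.
apply: le_trans (@minor_norm_diag_le R b d k.+1 isT kd s s0 smono) _ => //.
rewrite mulrC; apply: ler_wpM2r; last by rewrite lerDr.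
by apply: prodr_ge0.
Qed.

(** The leading minor of the product of the three inner factors splits exactly; the outer unitary
    factors cost only a constant. *)
Lemma svd_product_ge (A B u v u' v' : 'M[K]_d) s s' : is_svd A u s v -> is_svd B u' s' v' ->
  top s * absv (\det (top_block k (v *m u'))) * top s' <=
  unitary_bound R d k.+1 ^+ 2 * N (A *m B).
Proof.
move=> [uu uv s0 _ ->] [uu' uv' s0' _ ->].
have := minor_norm_scale_ge (b := b) kd (v *m u') s0 s0'.
rewrite -top_block_minor => H; apply: le_trans H _.
have -> : real_diag b s *m (v *m u') *m real_diag b s' =
    invmx u *m (u *m real_diag b s *m v *m (u' *m real_diag b s' *m v')) *m invmx v'.
  rewrite !mulmxA mulVmx ?unitary_unitmx // mul1mx.
  by rewrite -(mulmxA _ v') mulmxV ?unitary_unitmx // mulmx1.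
by apply: minor_norm_mul_unitary; exact: unitaryV.
Qed.

Lemma svd_norm_ge (A u v : 'M[K]_d) s : is_svd A u s v ->
  top s <= unitary_bound R d k.+1 ^+ 2 * N A.
Proof.
move=> sA; have [uu uv s0 smono E] := sA.
(* The identity is decomposed with left factor [invmx v], so that the inner block in
   [svd_product_ge] is the identity. *)
have I1 : is_svd (1%:M : 'M[K]_d) (invmx v) (const_mx 1) v.
  split=> //; first exact: unitaryV.
  - by move=> i; rewrite mxE.
  - by move=> i j _; rewrite !mxE.
  have -> : real_diag b (const_mx 1 : 'rV[R]_d) = 1%:M.
    by apply/matrixP => i j; rewrite !mxE scalar1.
  by rewrite mulmx1 mulVmx ?unitary_unitmx.
have := svd_product_ge sA I1; rewrite mulmxV ?unitary_unitmx // mulmx1.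
have -> : top_block k (1%:M : 'M[K]_d) = 1%:M.
  by apply/matrixP => i c; rewrite !mxE -!val_eqE.
rewrite det1 absv1 mulr1; have -> : top (const_mx 1) = 1.
  by rewrite /top_product big1 // => i _; rewrite mxE.
by rewrite mulr1.
Qed.

End MinorNorms.

Section Lifts.
Variables (R : realType) (b : base_field) (d : nat).
Local Notation K := (scalars R b).
Local Notation absv := (@absv R b).
Local Notation PSLd := (PSL K d).
Hypothesis d0 : (0 < d)%N.

(** Comparing determinants gives [c ^+ d = 1]: two lifts differ by a root of unity, which changes
    neither norms nor singular values. *)
Lemma det_scale_absv (c : K) (A B : 'M[K]_d) : A = c *: B -> \det A = 1 -> \det B = 1 ->
  absv c = 1.
Proof.
move=> ->; rewrite detZ => cB B1; move: cB; rewrite B1 mulr1 => /(congr1 absv).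
rewrite absvX absv1 => /eqP; rewrite pexpr_eq1 ?absv_ge0 //.
by move=> /eqP.
Qed.

Lemma lift_mul (g h : PSLd) : exists2 c : K, absv c = 1 &
  (lift (g * h)%g : 'M[K]_d) = c *: ((lift g : 'M[K]_d) *m lift h).
Proof.
have [c cE] := lift_pi (SL_mul (lift g) (lift h)); exists c => //.
apply: (det_scale_absv cE); first exact/eqP/SLmxP.
by rewrite /= det_mulmx !(eqP (SLmxP _)) mulr1.
Qed.

Lemma lift_inv (g : PSLd) : exists2 c : K, absv c = 1 &
  (lift (g^-1)%g : 'M[K]_d) = c *: invmx (lift g).
Proof.
have [c cE] := lift_pi (SL_inv (lift g)); exists c => //.
apply: (det_scale_absv cE); first exact/eqP/SLmxP.
by rewrite /= det_inv (eqP (SLmxP _)) invr1.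
Qed.

Definition exp_cartan (g : PSLd) : 'rV[R]_d := map_mx expR (cartan_proj g).

Lemma exp_cartan_gt0 g i : 0 < exp_cartan g 0 i.
Proof. by rewrite mxE expR_gt0. Qed.

(** A nonzero root rules out the default value 0 of [singular_values], whose logarithms all vanish
    because [ln 0 = 0]; the selected row therefore comes from a decomposition. *)
Lemma cartan_svd (g : PSLd) (k : 'I_d.-1) : simple_root k (cartan_proj g) != 0 ->
  exists u v : 'M[K]_d, is_svd (lift g) u (exp_cartan g) v.
Proof.
rewrite /exp_cartan /cartan_proj /singular_values.
case: xgetP => [s _ [u [v sv]] _|none].
  exists u, v; rewrite (_ : map_mx expR _ = s) //.
  apply/rowP => i; rewrite !mxE lnK // posrE.
  have [uu uv s0 smono E] := sv; rewrite lt_neqAle s0 andbT eq_sym.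
  have : \det (lift g : 'M[K]_d) != 0 by rewrite (eqP (SLmxP _)) oner_neq0.
  rewrite E !det_mulmx det_diag !mulf_eq0 !negb_or => /andP[/andP[_ + _]].
  move=> /prodf_neq0/(_ i isT); rewrite mxE.
  by apply: contraNN => /eqP ->; rewrite scalar0.
by rewrite /simple_root !mxE ln0 // subrr eqxx.
Qed.

Lemma exp_cartan_ratio g (k : 'I_d.-1) :
  exp_cartan g 0 (root_snd k) = expR (- simple_root k (cartan_proj g)) * exp_cartan g 0 (root_fst k).
Proof.
rewrite /exp_cartan [LHS]mxE [X in _ * X]mxE -expRD /simple_root; congr expR.
rewrite opprB; exact: (esym (subrK _ _)).
Qed.

Lemma top_product_exp_cartan g (k : 'I_d.-1) :
  top_product k.+1 (exp_cartan g) = expR (fund_weight k (cartan_proj g)).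
Proof.
rewrite /top_product /fund_weight (@big_morph _ _ expR 1 *%R 0 +%R) ?expR0 //.
  by apply: eq_bigr => i _; rewrite mxE.
exact: expRD.
Qed.

End Lifts.

(** * Anosov subgroups *)

Section AnosovDynamics.
Variables (R : realType) (b : base_field) (d : nat) (theta : {set 'I_d.-1}).
Local Notation K := (scalars R b).
Local Notation absv := (@absv R b).
Local Notation PSLd := (PSL K d).
Local Notation flagT := (flag K theta).
Variables (Gamma : set PSLd) (S : set PSLd) (delta : nat).
Local Notation Lambda := (@limit_set R b d theta Gamma).
Hypotheses (sym : symmetric_roots theta) (sG : is_subgroup Gamma).
Hypotheses (div : divergent theta Gamma)
  (tr : forall F G, Lambda F -> Lambda G -> F <> G ->
     transverse_flags F G).
Hypothesis gen : finite_generating_set S Gamma.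
Local Notation T := (subgroup_of sG).
Local Notation l := (@sub_length PSLd Gamma sG S).
Hypothesis hyp : four_point l delta.
Let ln : word_norm l := sub_word_norm sG gen.
Local Notation asymp := (asymp l).
Variable xi : gromov_boundary S -> flagT.
Hypotheses (xi_inj : injective xi) (xi_range : range xi = Lambda)
  (xi_cont : continuous xi).
Hypothesis xi_equiv : forall g p, Gamma g ->
  forall k, xi (boundary_act g p) k = act_subspace g (xi p k).
Hypothesis inf_limit : infinite_set (Lambda).

Lemma boundary_infinite : infinite_boundary l.
Proof.
apply: (infinite_boundary_points gen hyp) => fin; apply: inf_limit.
by rewrite -xi_range; apply: finite_image.
Qed.

Lemma limit_xi p : Lambda (xi p).
Proof. by rewrite -xi_range; exists p. Qed.

(** Divergence and limit sets are phrased with injective sequences; strictly growing lengths provide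
    injectivity. *)
Lemma injective_subsequence (g : nat -> T) : (forall n, n <= l (g n))%N ->
  exists2 phi : nat -> nat, (forall i, i <= phi i)%N & injective (g \o phi).
Proof.
move=> gl; pose fix phi n := if n is m.+1 then (l (g (phi m))).+1 else 0%N.
have inc i : (l (g (phi i)) < l (g (phi i.+1)))%N by rewrite /= gl.
have mono i j : (i < j)%N -> (l (g (phi i)) < l (g (phi j)))%N.
  elim: j => // j IH; rewrite ltnS leq_eqVlt => /orP[/eqP ->|/IH h]; first exact: inc.
  exact: ltn_trans h (inc j).
exists phi.
  elim=> // i IH /=; rewrite ltnS; apply: leq_trans IH _; exact: gl.
move=> i j /= E; apply/eqP; rewrite eqn_leq.
case: (ltngtP i j) => // /mono; rewrite E ltnn //.
Qed.

(** Turns divergence along sequences into a bound outside a ball: bad elements of unbounded length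
    would contain a sequence of distinct ones. *)
Lemma root_gap (M : R) : exists n0 : nat, forall g : T, (n0 <= l g)%N ->
  forall k, k \in theta -> M < simple_root k (cartan_proj (sval g)).
Proof.
apply: contrapT => nex.
have bad n : exists g : T, (n <= l g)%N /\ exists2 k, k \in theta &
    simple_root k (cartan_proj (sval g)) <= M.
  apply: contrapT => nb; apply: nex; exists n => g ng k kt.
  by rewrite ltNge; apply/negP => le; apply: nb; exists g; split=> //; exists k.
have [g gP] := choice bad.
have [phi _ inj] := injective_subsequence (fun n => (gP n).1).
have := div (gamma := fun n => sval (g (phi n))) _ (fun m => in_subgroup _).
have sinj : injective (fun n => sval (g (phi n))).
  by move=> i j /val_inj; exact: inj.
move=> /(_ sinj) /cvgeyPgt /(_ M) [N _ /(_ N (leqnn _)) /=].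
have [_ [k kt kM]] := gP (phi N).
rewrite ltNge => /negP; apply.
apply: (@le_trans _ _ (simple_root k (cartan_proj (sval (g (phi N)))))%:E); last by rewrite lee_fin.
exact: bigmin_le_cond.
Qed.

Lemma limit_set_mem (g : nat -> T) (U : nat -> flagT) F : (forall n, n <= l (g n))%N ->
  (forall n, is_attracting_flag (sval (g n)) (U n)) -> U @ \oo --> F ->
  Lambda F.
Proof.
move=> gl gU UF; have [phi ip inj] := injective_subsequence gl.
exists (fun n => sval (g (phi n))), (U \o phi); split=> //.
- by move=> i j /val_inj; exact: inj.
- by move=> m; exact: in_subgroup.
move=> V /UF[N _ NP]; exists N => // n /= Nn; apply: NP => /=.
exact: leq_trans (ip n).
Qed.

(* A flag without adapted frame would be isolated in the quotient topology,
   while the flags [U_theta(g)] have frames. *)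
Lemma limit_set_frame F : Lambda F -> exists A, adapted_frame A F.
Proof.
move=> [gamma [U [_ _ gU UF]]]; apply: contrapT => nA.
have oF : open [set F].
  apply/open_flag_absv => A [E AE EF]; case: nA; exists A.
  by rewrite /= in EF; rewrite -EF.
have : nbhs F [set F] by rewrite nbhsE; exists [set F].
move=> /UF[N _ /(_ N (leqnn _)) /= UN].
have [_ [k [v [_ kU]]]] := gU N; apply: nA; exists k.
by move: kU; rewrite UN.
Qed.

Hypothesis theta0 : exists k, k \in theta.

Lemma d_gt0 : (0 < d)%N.
Proof. by have [k _] := theta0; case: d k => [[]|//]. Qed.

Definition svd_sequence (h : nat -> T) (u v : nat -> 'M[K]_d) :=
  forall n, [/\ is_svd (lift (sval (h n))) (u n) (exp_cartan (sval (h n))) (v n),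
    forall k, k \in theta -> 0 < simple_root k (cartan_proj (sval (h n))) &
    forall k, k \in theta -> 0 < simple_root k (cartan_proj (sval (h n))^-1%g)].

(** Inverting the decomposition of [g] makes [invmx v *m reversal R b d] the left factor. The
    positive roots give [g^-1] a decomposition with its own Cartan projection, and uniqueness
    identifies the two; the scalar between the lifts does not change spans. *)
Lemma inverse_attracting_flag (g : PSLd) (u v : 'M[K]_d) (F : flagT) :
  is_svd (lift g) u (exp_cartan g) v ->
  (forall k, k \in theta -> 0 < simple_root k (cartan_proj g^-1%g)) ->
  adapted_frame (invmx v *m reversal R b d) F -> is_attracting_flag g^-1%g F.
Proof.
move=> sv root AF; split=> //.
have [c c1 cE] := lift_inv d_gt0 g.
have sinv := svdZ c1 (svd_inv (exp_cartan_gt0 g) sv); rewrite -cE in sinv.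
have [k kt] := theta0; have [u' [v' sv']] := cartan_svd (lt0r_neq0 (root k kt)).
have E := svd_unique sv' sinv; rewrite -/(exp_cartan g^-1%g).
exists (c *: (invmx v *m reversal R b d)), (reversal R b d *m invmx u); split.
  by rewrite E.
have [uF FF] := AF.
have c0 : c != 0 by rewrite -absv_gt0 c1.
have ucF : c *: (invmx v *m reversal R b d) \in unitmx by rewrite unitmxZ ?unitfE.
split=> // i; rewrite FF; apply: first_columns_eq => //; first exact: theta_lt.
move=> r e ir ei; have := mulVmx ucF; rewrite -scalemxAr => /matrixP/(_ r e).
rewrite !mxE => /eqP.
have -> : (r == e) = false by apply/negP => /eqP re; move: ir; rewrite re ltnNge ei.
by rewrite mulf_eq0 (negbTE c0) => /eqP.
Qed.

(* A third boundary point, away from the limit of [h^-1], is attracted to [q]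
   by [h], which identifies the limit [u0] of the left unitary factors. *)
Lemma svd_attracting_limit (h : nat -> T) (u v : nat -> 'M[K]_d) u0 v0 q :
  (forall n, n <= l (h n))%N -> svd_sequence h u v ->
  mx_lim u u0 -> mx_lim v v0 ->
  asymp (fun n => (h n)^-1)%g (fun n => (h n)^-1)%g ->
  represents q h -> adapted_frame u0 (xi q).
Proof.
move=> hl hsv ulim vlim hV qh; have [hh _] := qh.
have uu n : is_unitary (u n) by have [[]] := hsv n.
have uv n : is_unitary (v n) by have [[]] := hsv n.
have uu0 := unitary_lim uu ulim; have uv0 := unitary_lim uv vlim.
have [uq Auq] := limit_set_frame (limit_xi q).
pose A0 := invmx v0 *m reversal R b d.
have frame_unit (w : 'M[K]_d) : is_unitary w -> invmx w *m reversal R b d \in unitmx.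
  by move=> uw; apply: unitary_unitmx; apply: unitaryM; [exact: unitaryV | exact: reversal_unitary].
have [F AF] := adapted_frame_exists theta (frame_unit _ uv0).
have [Fn AFn] := choice (fun n => adapted_frame_exists theta (frame_unit _ (uv n))).
have Alim : mx_lim (fun n => invmx (v n) *m reversal R b d) A0.
  have E : (fun n => invmx (v n)) = (fun n => adjoint (v n)).
    by apply/funext => n; exact: unitary_inv.
  apply: mx_lim_mul; last exact: mx_lim_cst.
  rewrite unitary_inv // E => i j; rewrite !mxE; under eq_fun do rewrite !mxE.
  exact: seq_lim_conj.
(* [F] is the limit of the attracting flags of the elements [(h n)^-1]. *)
have LF : Lambda F.
  apply: (@limit_set_mem (fun n => (h n)^-1)%g Fn).
  - by move=> n; rewrite (norm_inv ln).
  - by move=> n; have [sv r1 r2] := hsv n; exact: inverse_attracting_flag sv r2 (AFn n).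
  - exact: flag_cvg AFn AF Alim.
(* Of three boundary points, at most one is the limit of [h^-1] and at most one is sent to [F], so
   some point avoids both. *)
have [X [XX Xab]] := boundary_infinite 3%N.
have [p pP] : exists p : nat -> gromov_boundary S, forall a, (a < 3)%N -> represents (p a) (X a).
  have ex a : exists p : gromov_boundary S, (a < 3)%N -> represents p (X a).
    have [a3|] := ltnP a 3; last by move=> _; exists q.
    by have [p pX] := represents_exists gen (XX a a3); exists p.
  by have [p pP] := choice ex; exists p.
have [a [a3 nhX xiF]] : exists a, [/\ (a < 3)%N, ~ asymp (fun n => (h n)^-1)%g (X a) & xi (p a) <> F].
  apply: contrapT => na.
  have either a : (a < 3)%N -> asymp (fun n => (h n)^-1)%g (X a) \/ xi (p a) = F.
    move=> a3; apply: contrapT => /not_orP[h1 h2]; apply: na; by exists a.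
  have one a c : (a < 3)%N -> (c < 3)%N -> a <> c ->
      asymp (fun n => (h n)^-1)%g (X a) -> asymp (fun n => (h n)^-1)%g (X c) -> False.
    move=> a3 c3 ac ha hc; apply: (Xab a c a3 c3 ac).
    by apply: (asymp_trans hyp) (asympC ln ha) hc.
  have two a c : (a < 3)%N -> (c < 3)%N -> a <> c -> xi (p a) = F -> xi (p c) = F -> False.
    move=> a3 c3 ac Fa Fc; apply: (Xab a c a3 c3 ac).
    apply/(represents_eq gen hyp (pP a a3) (pP c c3)); apply: xi_inj.
    by rewrite Fa.
  have [h0|h0] := either 0%N isT; have [h1|h1] := either 1%N isT;
    have [h2|h2] := either 2%N isT; solve
    [ exact: (one 0%N 1%N) | exact: (one 0%N 2%N) | exact: (one 1%N 2%N)
    | exact: (two 0%N 1%N) | exact: (two 0%N 2%N) | exact: (two 1%N 2%N) ].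
have [B BE] := limit_set_frame (limit_xi (p a)).
have transEF := tr (limit_xi (p a)) LF xiF.
pose V n := xi (boundary_act (sval (h n)) (p a)).
have Vlim : V @ \oo --> xi q.
  have act := boundary_act_cvg gen hyp hV qh (pP a a3) nhX.
  by move=> W /(xi_cont (x := q)); exact: act.
have VB n : adapted_frame (lift (sval (h n)) *m B) (V n).
  apply: adapted_frame_act BE _; first exact: SL_unit.
  by move=> k; rewrite /V xi_equiv //; exact: in_subgroup.
have [uq' uqF] := Auq.
split; first exact: unitary_unitmx.
move=> k; rewrite uqF; apply/esym.
have kt := svalP k.
apply: (attracting_limit (s := fun n => exp_cartan (sval (h n))) kt ulim vlim _ _ _ _ _ _ _ Vlim Auq).
- exact: unitary_unitmx.
- by move=> n; exact: unitary_unitmx.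
- by move=> n i; exact: exp_cartan_gt0.
- by move=> n; have [[_ _ _ smono _] _ _] := hsv n; exact: smono.
- move=> e e0.
  have [n0 n0P] := root_gap (- exp.ln e).
  exists n0 => n n0n; rewrite exp_cartan_ratio.
  apply: ler_wpM2r; first by apply: ltW; exact: exp_cartan_gt0.
  rewrite -[leRHS]lnK ?posrE // ler_expR lerNl; apply/ltW/n0P => //.
  exact: leq_trans (hl n).
- have rkt : rev_ord (val k) \in theta by rewrite -sym.
  exact: (transverse_top_block kt rkt (unitary_unitmx uv0) BE AF transEF).
- by move=> n; have [[_ _ _ _ <-] _ _] := hsv n; exact: VB.
Qed.

Variable k : 'I_d.-1.
Hypothesis kt : k \in theta.
Local Notation N := (@minor_norm R b d k.+1).

(* Otherwise, in the limit along bad pairs, [g^-1] and [h] converge to distinct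
   boundary points, so by transversality the leading blocks of the inner unitary
   factors of [g] and [h] pair nondegenerately. *)
Lemma minor_norm_mul_ge (D : nat) : exists (n0 : nat) (c : R), 0 < c /\
  forall g h : T, (n0 <= l g)%N -> (n0 <= l h)%N -> (l g + l h <= l (g * h)%g + D)%N ->
  c * (N (lift (sval g)) * N (lift (sval h))) <= N ((lift (sval g) : 'M[K]_d) *m lift (sval h)).
Proof.
apply: contrapT => nex; have [n1 n1P] := root_gap 0.
have bad n : exists gh : T * T, [/\ (n + n1 <= l gh.1)%N, (n + n1 <= l gh.2)%N,
    (l gh.1 + l gh.2 <= l (gh.1 * gh.2)%g + D)%N &
    N ((lift (sval gh.1) : 'M[K]_d) *m lift (sval gh.2)) <
      n.+1%:R^-1 * (N (lift (sval gh.1)) * N (lift (sval gh.2)))].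
  apply: contrapT => nb; apply: nex; exists (n + n1)%N, n.+1%:R^-1.
  split; first by rewrite invr_gt0.
  move=> g h lg lh lgh; rewrite leNgt; apply/negP => lt; apply: nb.
  by exists (g, h).
have [gh ghP] := choice bad.
(* Cancellation in [g * h] is the Gromov product of [g^-1] and [h], so the left factor enters
   through its inverse. *)
pose y (e : bool) n : T := if e then ((gh n).1)^-1%g else (gh n).2.
have yl e n : (n + n1 <= l (y e n))%N.
  by have [h1 h2 _ _] := ghP n; case: e => //=; rewrite (norm_inv ln).
have ylV e n : (n + n1 <= l (y e n)^-1%g)%N by rewrite (norm_inv ln).
have xl (a : bool * bool) M : exists N0, forall n, (N0 <= n)%N ->
    (M <= l (if a.2 then y a.1 n else (y a.1 n)^-1%g))%N.
  exists M => n Mn; apply: leq_trans Mn (leq_trans (leq_addr n1 n) _).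
  by case: a.2.
have [phi1 iphi1 asy1] := asymp_subsequence ln xl.
have svd_ex e n : exists uv : 'M[K]_d * 'M[K]_d,
    is_svd (lift (sval (y e n))) uv.1 (exp_cartan (sval (y e n))) uv.2.
  have r0 := n1P (y e n) (leq_trans (leq_addl _ _) (yl e n)) k kt.
  by have [u [v sv]] := cartan_svd (lt0r_neq0 r0); exists (u, v).
have [uv uvP] := choice (fun en => svd_ex en.1 en.2).
pose A (ec : bool * bool) n := if ec.2 then (uv (ec.1, phi1 n)).1 else (uv (ec.1, phi1 n)).2.
have A1 ec n i j : absv (A ec n i j) <= 1.
  apply: unitary_absv_le; rewrite /A; have [uu uw _ _ _] := uvP (ec.1, phi1 n).
  by case: ec.2.
have [phi2 iphi2 A0ex] := mx_subsequence A1.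
have [A0 A0P] := choice A0ex.
pose phi := phi1 \o phi2.
have iphi : forall n, (n <= phi n)%N.
  exact/subseq_index_ge/subseq_index_comp.
pose H e n := y e (phi n).
have asyH e : asymp (H e) (H e).
  exact: (asymp_sub (subseq_index_ge iphi2) (subseq_index_ge iphi2) (asy1 (e, true))).
have asyHV e : asymp (fun n => (H e n)^-1)%g (fun n => (H e n)^-1)%g.
  exact: (asymp_sub (subseq_index_ge iphi2) (subseq_index_ge iphi2) (asy1 (e, false))).
have [q qP] := choice (fun e => represents_exists gen (asyH e)).
have frames e : adapted_frame (A0 (e, true)) (xi (q e)).
  apply: (@svd_attracting_limit (H e) (A (e, true) \o phi2) (A (e, false) \o phi2) _
    (A0 (e, false)) (q e)) => //.
  - by move=> n; apply: leq_trans (iphi n) (leq_trans (leq_addr n1 _) (yl e _)).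
  - move=> n; split; first exact: (uvP (e, phi n)).
      move=> i it; apply: n1P => //; exact: leq_trans (leq_addl _ _) (yl e (phi n)).
    move=> i it; rewrite -svalV; apply: n1P => //.
    exact: leq_trans (leq_addl _ _) (ylV e (phi n)).
(* Equal limits would make the Gromov products of [g^-1] and [h] unbounded, against the bound
   [D]. *)
have qne : xi (q false) <> xi (q true).
  move=> /xi_inj/esym/(represents_eq gen hyp (qP true) (qP false)) /(_ D.+1)[N0 NP].
  have := NP N0 N0 (leqnn _) (leqnn _).
  have [_ _ h _] := ghP (phi N0); rewrite /H /y (norm_inv ln) /ndist invgK.
  by rewrite addnS ltnNge h.
have transE := tr (limit_xi (q false)) (limit_xi (q true)) qne.
have uA e : is_unitary (A0 (e, true)).
  apply: (unitary_lim _ (A0P (e, true))) => n; rewrite /A /=.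
  by have [] := uvP (e, phi n).
(* The limit of the right unitary factors of [g], obtained by inverting the decompositions of
   [g^-1]. *)
pose L := reversal R b d *m invmx (A0 (true, true)).
have ru := unitary_unitmx (reversal_unitary R b d).
have uL : L \in unitmx.
  by rewrite unitmx_mul ru unitmx_inv unitary_unitmx.
have LE : invmx L *m reversal R b d = A0 (true, true).
  apply: (can_inj (mulKmx uL)); rewrite mulKVmx // /L -mulmxA mulVmx ?mulmx1 //.
  exact: unitary_unitmx.
have rkt : rev_ord k \in theta by rewrite -sym.
have frameL : adapted_frame (invmx L *m reversal R b d) (xi (q true)) by rewrite LE.
have det0 := transverse_top_block kt rkt uL (frames false) frameL transE.
pose u n := (uv (true, phi n)).1; pose u' n := (uv (false, phi n)).1.
have uu n : is_unitary (u n) by have [] := uvP (true, phi n).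
pose M n := reversal R b d *m invmx (u n) *m u' n.
have Mlim : mx_lim M (L *m A0 (false, true)).
  apply: mx_lim_mul; last exact: (A0P (false, true)).
  apply: mx_lim_mul; first exact: mx_lim_cst.
  have E : (fun n => invmx (u n)) = (fun n => adjoint (u n)).
    by apply/funext => n; exact: unitary_inv.
  rewrite E unitary_inv // => i j; rewrite !mxE; under eq_fun do rewrite !mxE.
  by apply: seq_lim_conj; exact: (A0P (true, true)).
have dlim : seq_lim (fun n => \det (top_block k (M n))) (\det (top_block k (L *m A0 (false, true)))).
  by apply: seq_lim_det => i j; rewrite mxE; under eq_fun do rewrite mxE; exact: Mlim.
have [c c0 [N0 N0P]] := seq_lim_away dlim det0.
pose Ub := unitary_bound R d k.+1 ^+ 2.
have Ub0 : 0 < Ub by rewrite exprn_gt0 // unitary_bound_gt0.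
pose C := svd_const R b k.
have C0 : 0 < C by rewrite mulr_gt0 // ltr_wpDr // minor_norm_ge0.
(* [C * C] bounds the two norms by singular values and [Ub / c] comes from the product estimate; the
   bad pairs contradict the resulting bound once [n] exceeds [Q]. *)
pose Q := C * C * (Ub / c).
have Q0 : 0 < Q by apply: mulr_gt0; [exact: mulr_gt0 | exact: divr_gt0].
have [n [N0n Qn]] : exists n, (N0 <= n)%N /\ Q < n.+1%:R.
  exists (maxn N0 (Num.bound Q)); split; first exact: leq_maxl.
  apply: lt_le_trans (archi_boundP (ltW Q0)) _; rewrite ler_nat.
  exact: leq_trans (leq_maxr _ _) (leqnSn _).
have [_ _ _ small] := ghP (phi n).
set g := (gh (phi n)).1 in small *; set h := (gh (phi n)).2 in small *.
set NA := N (lift (sval g)) in small; set NB := N (lift (sval h)) in small.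
set NAB := N _ in small.
have [z z1 zE] := lift_inv d_gt0 (sval (H true n)).
have gE : (sval (H true n))^-1%g = sval g by rewrite /H /y -svalV invgK.
rewrite gE in zE.
have svh := uvP (false, phi n).
have svg := svdZ z1 (svd_inv (exp_cartan_gt0 _) (uvP (true, phi n))).
rewrite -[y _ _]/(H true n) -zE in svg.
have := svd_product_ge k svg svh; rewrite -/Ub -/(u n) -/(u' n) -/(M n) -[y _ _]/h -/NAB.
have leA := svd_norm_le k svg; have leB := svd_norm_le k svh.
rewrite -/C -/NA in leA; rewrite -/C -[y _ _]/h -/NB in leB.
set tA := top_product _ _ in leA *; set tB := top_product _ _ in leB *.
have tA0 : 0 <= tA by apply: prodr_ge0 => i _; have [_ _ + _ _] := svg; exact.
have tB0 : 0 <= tB by apply: prodr_ge0 => i _; have [_ _ + _ _] := svh; exact.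
have NA0 : 0 <= NA by exact: minor_norm_ge0.
have NB0 : 0 <= NB by exact: minor_norm_ge0.
have cM := N0P n N0n; move: (absv _) cM => dM cM prodge.
have ttc : tA * tB * c <= Ub * NAB.
  apply: le_trans prodge; rewrite mulrAC; apply: ler_wpM2r => //.
  by apply: ler_wpM2l.
have AB : NA * NB <= Q * NAB.
  apply: (@le_trans _ _ ((C * tA) * (C * tB))); first exact: ler_pM.
  have -> : C * tA * (C * tB) = C * C * (tA * tB) by ring.
  have CC0 : 0 < C * C by exact: mulr_gt0.
  rewrite /Q -[leRHS]mulrA (ler_pM2l CC0).
  have -> : Ub / c * NAB = Ub * NAB / c by rewrite mulrAC.
  by rewrite ler_pdivlMr.
have NAB0 : 0 < NAB.
  by apply: minor_norm_gt0; rewrite unitmx_mul !SL_unit.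
have : NAB < (phi n).+1%:R^-1 * (Q * NAB).
  by apply: lt_le_trans small _; rewrite ler_pM2l // invr_gt0.
rewrite mulrA -[ltLHS]mul1r ltr_pM2r // mulrC ltr_pdivlMr // mul1r.
rewrite ltNge => /negP; apply; apply: ltW; apply: lt_le_trans Qn _.
by rewrite ler_nat ltnS.
Qed.

(** The upper bound is submultiplicativity. The lower bound is [minor_norm_mul_ge] when both factors
    are long; otherwise it is submultiplicativity for [g^-1 * (g * h)] or [(g * h) * h^-1], the
    short factor ranging over a finite ball. *)
Lemma log_minor_quasi_additive :
  quasi_additive l (fun g : T => exp.ln (N (lift (sval g)))).
Proof.
move=> D; have [n0 [c [c0 cP]]] := minor_norm_mul_ge D.
have Npos (g : PSLd) : 0 < N (lift g) by apply: minor_norm_gt0; exact: SL_unit.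
pose F (g : T) := exp.ln (N (lift (sval g))).
have NM (g h : T) : N (lift (sval (g * h)%g)) = N ((lift (sval g) : 'M[K]_d) *m lift (sval h)).
  by have [z z1] := lift_mul d_gt0 (sval g) (sval h); rewrite svalM => ->; rewrite minor_normZ.
have upper g h : F (g * h)%g <= F g + F h.
  rewrite /F -lnM ?posrE // ler_ln ?posrE ?mulr_gt0 // NM; exact: minor_norm_mul.
pose B := \sum_(g <- nball ln n0) (`|F g| + `|F (g^-1)%g|).
have BP g : (l g <= n0)%N -> `|F g| + `|F (g^-1)%g| <= B.
  move=> gn; have gb : g \in nball ln n0 by rewrite mem_nball.
  rewrite /B (perm_big _ (perm_to_rem gb)) big_cons lerDl.
  by apply: sumr_ge0 => x _; exact: addr_ge0.
exists (B + `|exp.ln c|) => g h gh; have up := upper g h.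
rewrite -/(F (g * h)%g) -/(F g) -/(F h).
have Bc0 : 0 <= `|exp.ln c| by [].
have B0 : 0 <= B by apply: sumr_ge0 => x _; exact: addr_ge0.
have absF (x : T) : - `|F x| <= F x <= `|F x| by rewrite -ler_norml.
have lnc : - `|exp.ln c| <= exp.ln c <= `|exp.ln c| by rewrite -ler_norml.
rewrite ler_norml; apply/andP; split; last by lra.
have [gn|ng] := leqP (l g) n0.
  have := upper g^-1%g (g * h)%g; rewrite mulKg.
  by have := BP g gn; have := absF g; have := absF g^-1%g; lra.
have [hn|nh] := leqP (l h) n0.
  have := upper (g * h)%g h^-1%g; rewrite mulgK.
  by have := BP h hn; have := absF h; have := absF h^-1%g; lra.
have := cP g h (ltnW ng) (ltnW nh) gh; rewrite -NM => ge.
have : exp.ln c + (F g + F h) <= F (g * h)%g.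
  rewrite /F -!lnM ?posrE ?mulr_gt0 // ler_ln ?posrE ?mulr_gt0 //.
by lra.
Qed.

End AnosovDynamics.

(* Maximum principle: a positive maximum would propagate down to [P 0]. *)
Lemma partial_sums_le0 (R : realType) (d : nat) (P : nat -> R) : P 0%N = 0 -> P d = 0 ->
  (forall m, (0 < m < d)%N -> P m = 0 \/ P m + P m = P m.-1 + P m.+1) ->
  forall m, (m <= d)%N -> P m <= 0.
Proof.
move=> P0 Pd step m md; rewrite leNgt; apply/negP => Pm.
pose M := [arg max_(i > inord m : 'I_d.+1) P i]%O.
have [Mmax Mpos] : (forall i, (i <= d)%N -> P i <= P M) /\ 0 < P M.
  rewrite /M; case: arg_maxP => //= i _ imax.
  have le r : (r <= d)%N -> P r <= P i.
    by move=> rd; have := imax (inord r) isT; rewrite inordK.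
  by split=> //; exact: lt_le_trans Pm (le m md).
have Md : (M <= d)%N by rewrite -ltnS.
have : forall r, (r <= d)%N -> P r = P M -> False.
  elim=> [|r IH] rd E; first by move: Mpos; rewrite -E P0 ltxx.
  have rd' : (r.+1 < d)%N.
    by rewrite ltn_neqAle rd andbT; apply/eqP => rE; move: Mpos; rewrite -E rE Pd ltxx.
  case: (step r.+1 ltac:(by rewrite rd')) => [E0|/= E2].
    by move: Mpos; rewrite -E E0 ltxx.
  apply: (IH (ltnW rd)); apply/eqP; rewrite eq_le Mmax ?(ltnW rd) //=.
  by have := Mmax r.+2 rd'; move: E2; rewrite E; lra.
by move=> /(_ M Md erefl).
Qed.

(** * Fundamental weights as coordinates on [a_theta] *)

Section Weights.
Variables (R : realType) (d : nat) (theta : {set 'I_d.-1}).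
Implicit Types (a : 'rV[R]_d) (k : 'I_d.-1).

Lemma fund_weight_linear k : linear (@fund_weight R d k).
Proof.
move=> c u v; rewrite /fund_weight scaler_sumr -big_split /=.
by apply: eq_bigr => i _; rewrite !mxE.
Qed.

HB.instance Definition _ k := GRing.isLinear.Build R 'rV[R]_d R^o _
  (@fund_weight R d k) (@fund_weight_linear k).

(** The partial sums of [a] vanish at both ends and at the indices of [theta], and are discretely
    affine at the others because neighbouring entries agree there. The maximum principle for [a] and
    [- a] makes them zero. *)
Lemma fund_weights_separate a : \sum_(i < d) a 0 i = 0 ->
  (forall k, k \notin theta -> a 0 (root_fst k) = a 0 (root_snd k)) ->
  (forall k, k \in theta -> fund_weight k a = 0) -> a = 0.
Proof.
have half a' : \sum_(i < d) a' 0 i = 0 ->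
    (forall k, k \notin theta -> a' 0 (root_fst k) = a' 0 (root_snd k)) ->
    (forall k, k \in theta -> fund_weight k a' = 0) ->
    forall m, (m <= d)%N -> \sum_(i < d | (i < m)%N) a' 0 i <= 0.
  move=> s0 r0 w0.
  have next (i : 'I_d) : \sum_(e < d | (e < i.+1)%N) a' 0 e =
      \sum_(e < d | (e < i)%N) a' 0 e + a' 0 i.
    rewrite (bigD1 i) //= addrC; congr (_ + _); apply: eq_bigl => e.
    by rewrite ltnS -val_eqE /= ltn_neqAle andbC.
  apply: partial_sums_le0; first by rewrite big1.
    by rewrite -[RHS]s0; apply: eq_bigl => i; rewrite ltn_ord.
  move=> m /andP[m0 md]; have kd : (m.-1 < d.-1)%N by lia.
  pose k : 'I_d.-1 := Ordinal kd.
  have [kt|kt] := boolP (k \in theta).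
    left; rewrite -[RHS](w0 k kt) /fund_weight; apply: eq_bigl => i /=.
    by rewrite -[RHS]ltnS prednK.
  right; have := r0 k kt; have := next (root_fst k); have := next (root_snd k).
  by rewrite /= prednK // => -> -> ->; ring.
move=> s0 r0 w0; have le0 := half a s0 r0 w0.
have ge0 m : (m <= d)%N -> 0 <= \sum_(i < d | (i < m)%N) a 0 i.
  move=> md; have opp (P : pred 'I_d) : \sum_(i < d | P i) (- a) 0 i = - \sum_(i < d | P i) a 0 i.
    by rewrite -sumrN; apply: eq_bigr => i _; rewrite mxE.
  rewrite -oppr_le0 -opp; apply: half => // [|k kt|k kt]; first by rewrite opp s0 oppr0.
    by rewrite !mxE r0.
  by rewrite /fund_weight opp -/(fund_weight k a) w0 ?oppr0.
have z m : (m <= d)%N -> \sum_(i < d | (i < m)%N) a 0 i = 0.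
  by move=> md; apply/le_anti; rewrite le0 // ge0.
apply/rowP => i; rewrite mxE; have := z i.+1 (ltn_ord i).
rewrite (bigD1 i) //= => E; rewrite -[LHS]addr0 -[RHS]E; congr (_ + _).
rewrite -[LHS](z i (ltnW (ltn_ord i))); apply: eq_bigl => e.
by rewrite ltnS -val_eqE /= ltn_neqAle andbC.
Qed.

(* Square system whose solutions with right-hand side supported on [theta]
   lie in [a_theta]. *)
Definition weight_system a : 'rV[R]_d :=
  \row_i match insub (i : nat) : option 'I_d.-1 with
         | Some k => if k \in theta then fund_weight k a else simple_root k a
         | None => coord_sum a
         end.

Fact weight_system_linear : linear weight_system.
Proof.
move=> c u v; apply/rowP => i; rewrite !mxE; case: insubP => [k _ _|_].
  by case: ifP => _; [exact: fund_weight_linear | exact: simple_root_linear].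
exact: coord_sum_linear.
Qed.

HB.instance Definition _ :=
  GRing.isLinear.Build R 'rV[R]_d 'rV[R]_d _ weight_system weight_system_linear.

Lemma weight_systemE a (i : 'I_d) k : i = k :> nat ->
  weight_system a 0 i = if k \in theta then fund_weight k a else simple_root k a.
Proof.
move=> ik; rewrite mxE; case: insubP => [k' _ ik'|].
  by have -> : k' = k by apply: val_inj; rewrite ik'.
by rewrite ik ltn_ord.
Qed.

Lemma weight_system_last a (i : 'I_d) : (d.-1 <= i)%N -> weight_system a 0 i = coord_sum a.
Proof. by move=> di; rewrite mxE; case: insubP => // k; rewrite ltnNge di. Qed.

Lemma weight_system_inj a : weight_system a = 0 -> a = 0.
Proof.
move=> a0; case: (posnP d) => [dz|dpos].
  by apply/rowP => i; exfalso; case: i => m; rewrite dz.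
have zi i : weight_system a 0 i = 0 by rewrite a0 mxE.
have dd : (d.-1 < d)%N by rewrite prednK.
apply: fund_weights_separate.
- by have := zi (Ordinal dd); rewrite weight_system_last.
- move=> k kt; have := zi (root_fst k); rewrite (weight_systemE a (k := k)) //.
  by rewrite (negbTE kt) => /eqP; rewrite subr_eq0 => /eqP.
by move=> k kt; have := zi (root_fst k); rewrite (weight_systemE a (k := k)) // kt.
Qed.

(** [weight_system] is injective, hence onto, and preimages of the unit vectors indexed by [theta]
    are the dual vectors. *)
Lemma dual_weights : exists u : 'I_d.-1 -> 'rV[R]_d, forall k, k \in theta ->
  u k \in a_theta R theta /\
  forall k', k' \in theta -> fund_weight k' (u k) = (k' == k)%:R.
Proof.
have full : limg (linfun weight_system) = fullv.
  apply/eqP; rewrite eqEdim subvf /= limg_dim_eq //.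
  apply/eqP; rewrite -subv0; apply/subvP => a; rewrite memv_cap memv_ker lfunE /=.
  by move=> /andP[_ /eqP /weight_system_inj ->]; exact: mem0v.
have ex k : exists a, weight_system a = delta_mx 0 (root_fst k).
  have : (delta_mx 0 (root_fst k) : 'rV[R]_d) \in limg (linfun weight_system).
    by rewrite full memvf.
  by move=> /memv_imgP[a _ E]; exists a; rewrite E lfunE.
have [u uP] := choice ex; exists u => k kt.
have entry k' : weight_system (u k) 0 (root_fst k') = (k' == k)%:R.
  by rewrite uP mxE eqxx /= -val_eqE.
split; last first.
  by move=> k' kt'; rewrite -entry (weight_systemE (u k) (k := k')) // kt'.
apply/mem_a_theta; split.
  have dpos : (0 < d)%N by case: d k {kt entry u uP ex full} => [[]|].
  have dd : (d.-1 < d)%N by rewrite prednK.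
  have := congr1 (fun x : 'rV[R]_d => x 0 (Ordinal dd)) (uP k).
  rewrite weight_system_last // /coord_sum => ->; rewrite mxE eqxx /= -val_eqE /=.
  by rewrite gtn_eqF.
move=> k' kt'; have := entry k'; rewrite (weight_systemE (u k) (k := k')) // (negbTE kt').
have -> : (k' == k) = false by apply/negP => /eqP E; move: kt'; rewrite E kt.
by move=> /eqP; rewrite subr_eq0 => /eqP.
Qed.

End Weights.

Section PartialCartan.
Variables (R : realType) (b : base_field) (d : nat) (theta : {set 'I_d.-1}).
Variable phi : 'Hom(subvs_of (a_theta R theta), R^o).

(** The combination [v] of dual vectors satisfies the defining conditions, so [xget] does not return
    its default, and [fund_weights_separate] makes [v] the only solution. *)
Lemma partial_cartan_weights : exists c : 'I_d.-1 -> R, forall g : PSL (scalars R b) d,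
  phi (partial_cartan_proj theta g) =
  \sum_(k in theta) c k * fund_weight k (cartan_proj g).
Proof.
have [u uP] := dual_weights R theta.
pose U k := vsproj (a_theta R theta) (u k).
have UE k : k \in theta -> vsval (U k) = u k.
  by move=> kt; rewrite vsprojK //; have [] := uP k kt.
exists (fun k => phi (U k)) => g.
pose w k := fund_weight k (cartan_proj g).
pose v := \sum_(k in theta) w k *: U k.
have vP k : k \in theta -> fund_weight k (vsval v) = w k.
  move=> kt; rewrite /v !linear_sum /= (bigD1 k) //= big1 ?addr0.
    rewrite !linearZ /= UE //; have [_ ->] := uP k kt => //.
    by rewrite eqxx /GRing.scale /= mulr1.
  move=> i /andP[it ik]; rewrite !linearZ /= UE //; have [_ ->] := uP i it => //.
  by rewrite eq_sym (negbTE ik) /GRing.scale /= mulr0.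
have -> : partial_cartan_proj theta g = v.
  rewrite /partial_cartan_proj; case: xgetP => [x _ xP|/(_ v)[]//].
  apply: val_inj; apply/eqP; rewrite -subr_eq0; apply/eqP.
  have /mem_a_theta[s0 r0] : vsval x - vsval v \in a_theta R theta.
    by rewrite memvB // subvsP.
  apply: (@fund_weights_separate R d theta) => // k kt.
  by rewrite linearB /= (xP k kt) (vP k kt) subrr.
rewrite linear_sum; apply: eq_bigr => k _.
by rewrite linearZ /GRing.scale /= mulrC.
Qed.

End PartialCartan.

Section QuasiAdditive.
Variables (R : realType) (T : groupType) (l : T -> nat).

Lemma quasi_additive_lincomb (I : finType) (A : {set I}) (c : I -> R) (F : I -> T -> R) :
  (forall i, i \in A -> quasi_additive l (F i)) ->
  quasi_additive l (fun g => \sum_(i in A) c i * F i g).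
Proof.
move=> qF D.
have ex i : exists C : R, i \in A -> forall g h : T, (l g + l h <= l (g * h)%g + D)%N ->
    `|F i (g * h)%g - F i g - F i h| <= C.
  have [iA|_] := boolP (i \in A); last by exists 0.
  by have [C CP] := qF i iA D; exists C.
have [C CP] := choice ex; exists (\sum_(i in A) `|c i| * C i) => g h gh.
rewrite -!sumrB; apply: le_trans (ler_norm_sum _ _ _) _; apply: ler_sum => i iA.
by rewrite -!mulrBr normrM ler_wpM2l // CP.
Qed.

Lemma quasi_additive_close (f f' : T -> R) (B : R) : (forall g, `|f g - f' g| <= B) ->
  quasi_additive l f' -> quasi_additive l f.
Proof.
move=> ff qf D; have [C CP] := qf D; exists (C + (B + B + B)) => g h gh.
have := CP g h gh; have := ff g; have := ff h; have := ff (g * h)%g.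
rewrite !ler_norml => /andP[? ?] /andP[? ?] /andP[? ?] /andP[? ?].
by apply/andP; split; lra.
Qed.

End QuasiAdditive.

(** * Critical exponents *)

Lemma esum_expR_ltyP (R : realType) (T : choiceType) (f : T -> R) (A : set T) (s : R) :
  (\esum_(x in A) (expR (- s * f x))%:E < +oo)%E <-> converges_at f A s.
Proof.
have e0 x : A x -> (0 <= (expR (- s * f x))%:E)%E by rewrite lee_fin expR_ge0.
split=> [fin | [M MP]].
  exists (fine (\esum_(x in A) (expR (- s * f x))%:E)) => L uL LA.
  rewrite -lee_fin fineK; last by rewrite ge0_fin_numE // esum_ge0.
  apply: esum_ge; exists [set` L]; first by split=> //; exact: finite_seq.
  by rewrite -fsbig_seq // sumEFin lexx.
apply: (@le_lt_trans _ _ M%:E); last exact: ltry.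
rewrite /esum; apply: ge_ereal_sup => _ [X [finX XA] <-].
rewrite fsbig_finite //= sumEFin lee_fin; apply: MP => // x.
by rewrite in_fset_set // => /set_mem/XA.
Qed.

(** For empty [theta] there is only one flag, so the limit set would be finite. *)
Lemma non_elementary_root (R : realType) (b : base_field) (d : nat)
    (theta : {set 'I_d.-1}) (Gamma : set (PSL (scalars R b) d)) :
  non_elementary theta Gamma -> exists k, k \in theta.
Proof.
move=> inf; apply: contrapT => none; apply: inf.
have [[F LF]|empty] := pselect (exists F, @limit_set R b d theta Gamma F); last first.
  by apply: (@sub_finite_set _ _ set0) => // F LF; apply: empty; exists F.
apply: (@sub_finite_set _ _ [set F]) => // F' _ /=.
apply/val_inj/ffunP => k; exfalso; apply: none.
by exists (val k); exact: (svalP k).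
Qed.

Section CartanGrowth.
Variables (R : realType) (b : base_field) (d : nat) (theta : {set 'I_d.-1}).
Variables (Gamma S : set (PSL (scalars R b) d)) (sG : is_subgroup Gamma).
Hypotheses (gen : finite_generating_set S Gamma) (div : divergent theta Gamma).
Local Notation T := (subgroup_of sG).
Local Notation l := (@sub_length _ Gamma sG S).

(** Outside a ball the roots in [theta] are positive, so a decomposition exists and compares the
    norm with the product of the leading singular values; the finite ball is absorbed in [B]. *)
Lemma fund_weight_log_minor k : k \in theta -> exists B : R, forall g : T,
  `|fund_weight k (cartan_proj (sval g)) -
    exp.ln (minor_norm (R:=R) (b:=b) k.+1 (lift (sval g)))| <= B.
Proof.
move=> kt; have [n0 n0P] := root_gap S sG div 0.
pose F (g : T) := fund_weight k (cartan_proj (sval g)) -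
    exp.ln (minor_norm (R:=R) (b:=b) k.+1 (lift (sval g))).
pose C := svd_const R b k; pose U := unitary_bound R d k.+1 ^+ 2.
have U0 : 0 < U by rewrite exprn_gt0 // unitary_bound_gt0.
have ln := sub_word_norm sG gen.
pose B := \sum_(g <- nball ln n0) `|F g|.
have B0 : 0 <= B by exact: sumr_ge0.
exists (B + `|exp.ln C| + `|exp.ln U|) => g; rewrite -/(F g).
have [gn|ng] := leqP (l g) n0.
  have gb : g \in nball ln n0 by rewrite mem_nball.
  have : `|F g| <= B by rewrite /B (perm_big _ (perm_to_rem gb)) big_cons lerDl sumr_ge0.
  by have := normr_ge0 (exp.ln C); have := normr_ge0 (exp.ln U); lra.
have [u [v sv]] := cartan_svd (lt0r_neq0 (n0P g (ltnW ng) k kt)).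
have N0 : 0 < minor_norm (R:=R) (b:=b) k.+1 (lift (sval g)).
  by apply: minor_norm_gt0; exact: SL_unit.
have := svd_norm_le k sv; have := svd_norm_ge k sv.
rewrite top_product_exp_cartan -/C -/U /F; move: (minor_norm _ _) N0 => N N0.
move: (fund_weight _ _ : R) => w geN leN.
have C0 : 0 < C by have := lt_le_trans N0 leN; rewrite pmulr_lgt0 // expR_gt0.
have : exp.ln N <= exp.ln C + w.
  rewrite -(expRK w) -lnM ?posrE ?expR_gt0 // ler_ln ?posrE //.
  by rewrite mulr_gt0 ?expR_gt0.
have : w <= exp.ln U + exp.ln N.
  by rewrite -[leLHS](expRK w) -lnM ?posrE // ler_ln ?posrE ?expR_gt0 // mulr_gt0.
have := ler_norm (exp.ln C); have := ler_norm (exp.ln U).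
have := normr_ge0 (exp.ln C); have := normr_ge0 (exp.ln U).
by move=> *; rewrite ler_norml; apply/andP; split; lra.
Qed.

End CartanGrowth.

(** * Passing between subsets of [Gamma] and the group that it forms *)

Section SubgroupTransfer.
Variables (gT : groupType) (Gamma : set gT) (sG : is_subgroup Gamma).
Local Notation T := (subgroup_of sG).
Variables (G : set gT) (GGamma : G `<=` Gamma).
Local Notation G' := [set x : T | G (sval x)].

Lemma subgroup_preimage : is_subgroup G -> is_subgroup G'.
Proof.
move=> [G1 GM GV]; split=> [|x y|x] /=; first exact: G1.
  exact: GM.
exact: GV.
Qed.

Lemma infinite_index_preimage : infinite_index G Gamma -> infinite_index G' setT.
Proof.
move=> inf fin; apply: inf.
have := finite_image (fun X : set T => [set sval x | x in X]) fin.
apply: sub_finite_set => _ [x Gx <-].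
exists [set (to_sub sG Gx * h)%g | h in G']; first by exists (to_sub sG Gx).
apply/seteqP; split=> [_ [_ [h Gh <-] <-]|_ [h Gh <-]]; first by exists (sval h).
exists (to_sub sG Gx * to_sub sG (GGamma Gh))%g => //.
by exists (to_sub sG (GGamma Gh)).
Qed.

Lemma converges_at_preimage (R : realType) (f : gT -> R) (s : R) :
  converges_at (f \o sval : T -> R) G' s <-> converges_at f G s.
Proof.
split=> -[M MP]; exists M => L uL LG.
  have ex x : exists y : T, x \in L -> sval y = x.
    have [xL|nx] := boolP (x \in L); last by exists 1%g.
    by exists (to_sub sG (GGamma (LG x xL))).
  have [h hP] := choice ex.
  have := MP [seq h x | x <- L]; rewrite big_map /=.
  rewrite (_ : \sum_(j <- L) _ = \sum_(x <- L) expR (- s * f x)); last first.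
    by apply: eq_big_seq => x xL; rewrite hP.
  apply.
    by rewrite map_inj_in_uniq // => x y xL yL E; rewrite -(hP x xL) -(hP y yL) E.
  by move=> _ /mapP[x xL ->] /=; rewrite hP //; exact: LG.
rewrite -(big_map sval xpredT (fun x => expR (- s * f x))); apply: MP.
  by rewrite map_inj_uniq //; exact: val_inj.
by move=> _ /mapP[x xL ->]; exact: LG.
Qed.

End SubgroupTransfer.

Lemma quasiconvex_preimage (gT : groupType) (Gamma G : set gT) (sG : is_subgroup Gamma) :
  G `<=` Gamma -> quasiconvex G Gamma -> exists S, finite_generating_set S Gamma /\
  exists C : nat, forall m (p : nat -> subgroup_of sG),
    (forall i j, (i <= j)%N -> (j <= m)%N ->
       ndist (sub_length S) (p i) (p j) = (j - i)%N) ->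
    [set x | G (sval x)] (p 0%N) -> [set x | G (sval x)] (p m) ->
    forall i, (i <= m)%N ->
    exists2 h, [set x | G (sval x)] h & (ndist (sub_length S) (p i) h <= C)%N.
Proof.
move=> GGamma [S [gen [C _ CP]]]; exists S; split=> //; exists C => m p pd p0 pm i im.
have geo : geodesic S m (sval \o p) by move=> j k jk km; exact: pd.
have [h Gh ph] := CP m (sval \o p) (fun j _ => in_subgroup (p j)) geo p0 pm i im.
by exists (to_sub sG (GGamma _ Gh)).
Qed.

(** The gap hypothesis is applied at the critical exponent of [G] itself, which is a nonnegative
    real because it is bounded by that of [Gamma]. *)
Lemma critical_exponent_gap (R : realType) (b : base_field) (d : nat)
    (theta : {set 'I_d.-1}) (phi : 'Hom(subvs_of (a_theta R theta), R^o))
    (Gamma G : set (PSL (scalars R b) d)) :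
  G `<=` Gamma ->
  (forall dG : R, 0 <= dG ->
    (forall s, 0 < s -> s < dG ->
       ~ converges_at (fun g => phi (partial_cartan_proj theta g)) G s) ->
    exists2 eps : R, 0 < eps & forall s, 0 < s -> s <= dG + eps ->
       ~ converges_at (fun g => phi (partial_cartan_proj theta g)) Gamma s) ->
  (critical_exponent phi Gamma < +oo)%E ->
  (critical_exponent phi G < critical_exponent phi Gamma)%E.
Proof.
move=> GGamma gap; set f := fun g => _ in gap.
have ceE (A : set (PSL (scalars R b) d)) : critical_exponent phi A =
    ereal_inf [set s%:E | s in [set s : R | 0 < s /\ converges_at f A s]].
  congr (ereal_inf (image _ _)); apply/seteqP; split=> s [s0 h]; split=> //.
    exact/esum_expR_ltyP.
  exact/(esum_expR_ltyP f A s).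
rewrite !ceE => fin; set dG := ereal_inf _.
have dG0 : (0%:E <= dG)%E by apply: le_ereal_inf_tmp => _ [s [s0 _] <-]; rewrite lee_fin ltW.
have dGle : (dG <= ereal_inf [set s%:E | s in [set s : R | (0 < s)%R /\ converges_at f Gamma s]])%E.
  apply: ereal_inf_le_tmp => _ [s [s0 [M MP]] <-]; exists s => //; split=> //.
  by exists M => L uL LG; apply: MP => // x /LG/GGamma.
have dGE : dG = (fine dG)%:E by rewrite fineK // ge0_fin_numE // (le_lt_trans dGle).
have [|s s0 sd cv|eps eps0 epsP] := gap (fine dG); first exact: fine_ge0.
  have : (dG <= s%:E)%E by apply: ereal_inf_lbound; exists s.
  by rewrite dGE lee_fin leNgt sd.
rewrite dGE; apply: (@lt_le_trans _ _ (fine dG + eps)%:E); first by rewrite lte_fin ltrDl.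
apply: le_ereal_inf_tmp => _ [s [s0 cv] <-]; rewrite lee_fin leNgt; apply/negP => sl.
by apply: (epsP s s0 (ltW sl)).
Qed.

Theorem corollary1p3 (R : realType) (b : base_field) (d : nat)
    (theta : {set 'I_d.-1}) (Gamma G : set (PSL (scalars R b) d))
    (phi : 'Hom(subvs_of (a_theta R theta), GRing.regular R)) :
  symmetric_roots theta ->
  is_subgroup Gamma -> anosov theta Gamma -> non_elementary theta Gamma ->
  is_subgroup G -> (G `<=` Gamma)%classic ->
  infinite_index G Gamma -> quasiconvex G Gamma ->
  (critical_exponent phi Gamma < +oo)%E ->
  (critical_exponent phi G < critical_exponent phi Gamma)%E.
Proof.
move=> sym sGamma [[div tr] [S [gen gh [xi [[xi_inj xi_range xi_cont _] xi_equiv]]]]].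
move=> inf sG GGamma iiG qcG.
have theta0 := non_elementary_root inf.
have [delta hyp] := gromov_four_point sGamma gen gh.
have [S' [gen' [C qc]]] := quasiconvex_preimage sGamma GGamma qcG.
have [a aP] := sub_length_lipschitz sGamma gen gen'.
have [c cP] := sub_length_lipschitz sGamma gen' gen.
pose f (g : subgroup_of sGamma) : R := phi (partial_cartan_proj theta (sval g)).
have qa : quasi_additive (sub_length S) f.
  have [w wE] := partial_cartan_weights b phi.
  have ex k : exists B : R, k \in theta -> forall g : subgroup_of sGamma,
      `|fund_weight k (cartan_proj (sval g)) -
        exp.ln (minor_norm (R:=R) (b:=b) k.+1 (lift (sval g)))| <= B.
    have [kt|_] := boolP (k \in theta); last by exists 0.
    by have [B BP] := fund_weight_log_minor sGamma gen div kt; exists B.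
  have [B BP] := choice ex.
  have close (g : subgroup_of sGamma) : `|f g - \sum_(k in theta) w k *
      exp.ln (minor_norm (R:=R) (b:=b) k.+1 (lift (sval g)))| <=
      \sum_(k in theta) `|w k| * B k.
    rewrite /f wE -sumrB; apply: le_trans (ler_norm_sum _ _ _) _.
    by apply: ler_sum => k kt; rewrite -mulrBr normrM ler_wpM2l // BP.
  apply: (quasi_additive_close close); apply: quasi_additive_lincomb => k kt.
  exact: (log_minor_quasi_additive sym div tr gen hyp xi_inj xi_range xi_cont xi_equiv).
have le1 (x : subgroup_of sGamma) : (sub_length S x <= maxn a c * sub_length S' x)%N.
  by apply: leq_trans (aP x) _; rewrite leq_mul2r leq_maxl orbT.
have le2 (x : subgroup_of sGamma) : (sub_length S' x <= maxn a c * sub_length S x)%N.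
  by apply: leq_trans (cP x) _; rewrite leq_mul2r leq_maxr orbT.
apply: critical_exponent_gap => // dG dG0 dGP.
have [|eps eps0 epsP] := growth_gap (sub_word_norm sGamma gen) (sub_word_norm sGamma gen')
  hyp le1 le2 (boundary_infinite gen hyp xi_range inf) qa
  (subgroup_preimage sGamma sG) (infinite_index_preimage (sG := sGamma) GGamma iiG) qc dG0.
  move=> s s0 sd cv; apply: (dGP s s0 sd).
  exact/(converges_at_preimage sGamma GGamma (fun g => phi (partial_cartan_proj theta g) : R)).
exists eps => // s s0 sd [M MP]; apply: (epsP s s0 sd); exists M => L uL _.
rewrite -(big_map sval xpredT (fun x => expR (- s * phi (partial_cartan_proj theta x)))).
apply: MP; first by rewrite map_inj_uniq //; exact: val_inj.
by move=> _ /mapP[x _ ->]; exact: in_subgroup.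
Qed.
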